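(* Let $A$ be a locally unital graded algebra that is locally finite-dimensional and bounded below, equipped with a graded triangular basis. For $b\in\mathbf B$, the indecomposable injective module $I(b)$ has a $\nabla$-flag, with $$(I(b):\nabla(a))_q=\overline{[\bar\Delta(a):L(b)]_q}$$ for all $a\in\mathbf B$. If the graded triangular basis admits a duality, then $(I(b):\nabla(a))_q=[\bar\nabla(a):L(b)]_q$.
   Context: Conventions. $\Bbbk$ is an algebraically closed field; all algebras, categories and functors are $\Bbbk$-linear; graded means $\mathbb Z$-graded. For a graded vector space $V$, $qV$ is the shift $(qV)_d=V_{d-1}$; $\dim_qV=\sum_d(\dim V_d)q^d$; for a formal series $f=\sum_dr_dq^d$ put $\overline f=\sum_dr_dq^{-d}$. A locally unital graded algebra is a graded associative algebra $A=\bigoplus_{i,j\in\mathbf I}1_iA1_j$ with a given family of mutually orthogonal homogeneous idempotents $1_i$ $(i\in\mathbf I)$. Graded left modules are locally unital: $V=\bigoplus_{i}1_iV$. $A$-gmod is the abelian category of graded left $A$-modules with degree-preserving homomorphisms. $\operatorname{Hom}_A(V,W)=\bigoplus_{d\in\mathbb Z}\operatorname{Hom}_A(V,W)_d$, where $\operatorname{Hom}_A(V,W)_d$ is the space of $A$-module homomorphisms $f$ with $f(V_n)\subseteq W_{n+d}$ for all $n$. $V$ is locally finite-dimensional if $\dim 1_iV_d<\infty$ for all $i,d$; bounded above if for each $i$ there is $N_i$ with $1_iV_d=0$ for $d>N_i$. $A$ is locally finite-dimensional and bounded below if all $(1_iA1_j)_d$ are finite-dimensional and, for all $i,j$, $(1_iA1_j)_d=0$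 for $d\ll 0$. For $V$ locally finite-dimensional and $L$ irreducible, $[V:L]_q=\sum_dm_dq^d$ where $m_d$ is the maximum, over all finite filtrations of $V$ by graded submodules, of the number of sections isomorphic to $q^dL$. Graded triangular basis. For such $A$ this is the following data: a subset $\mathbf S\subseteq\mathbf I$; a poset $(\Lambda,\leq)$ that is lower finite (each $\{\mu\in\Lambda:\mu\leq\lambda\}$ is finite); a function $\mathbf S\to\Lambda$, $s\mapsto\dot s$, with finite (possibly empty) fibers $\mathbf S_\lambda$; homogeneous sets $\mathrm X(i,s)\subset1_iA1_s$, $\mathrm H(s,t)\subset1_sA1_t$, $\mathrm Y(t,j)\subset1_tA1_j$ for $i,j\in\mathbf I$, $s,t\in\mathbf S$. With $\mathrm X(s)=\bigcup_i\mathrm X(i,s)$, $\mathrm Y(t)=\bigcup_j\mathrm Y(t,j)$, the axioms are: (A1) the products $xhy$ for $(x,h,y)\in\bigcup_{s,t\in\mathbf S}\mathrm X(s)\times\mathrm H(s,t)\times\mathrm Y(t)$ form a basis of $A$; (A2) $\mathrm X(s,s)=\mathrm Y(s,s)=\{1_s\}$ for $s\in\mathbf S$; (A3) for $s\neq t$ in $\mathbf S$: $\mathrm X(s,t)\neq\varnothing\Rightarrow\dot s>\dot t$, $\mathrm H(s,t)\neq\varnothing\Rightarrow\dot s=\dot t$, $\mathrm Y(s,t)\neq\varnothing\Rightarrow\dot s<\dot t$; (A4) for each $i\in\mathbf I-\mathbf S$, the sets $\{s\in\mathbf S:\mathrm X(i,s)\neq\varnothing\}$ and $\{s\in\mathbf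 S:\mathrm Y(s,i)\neq\varnothing\}$ are finite. Functors. For $\lambda\in\Lambda$ let $e_\lambda=\sum_{s\in\mathbf S_\lambda}1_s$; let $A_{\geq\lambda}$ be the quotient of $A$ by the two-sided ideal generated by all $e_\mu$ with $\mu\not\geq\lambda$ (with idempotents the images $\bar1_i$), let $\bar e_\lambda$ be the image of $e_\lambda$ in it, and let $A_\lambda=\bar e_\lambda A_{\geq\lambda}\bar e_\lambda$, a unital graded algebra. Let $j^\lambda:A_{\geq\lambda}\text{-gmod}\to A_\lambda\text{-gmod}$, $V\mapsto\bar e_\lambda V$, with left adjoint $j^\lambda_!=A_{\geq\lambda}\bar e_\lambda\otimes_{A_\lambda}-$ and right adjoint $j^\lambda_*=\bigoplus_{i\in\mathbf I}\operatorname{Hom}_{A_\lambda}(\bar e_\lambda A_{\geq\lambda}\bar1_i,-)$. $A_{\geq\lambda}$-modules are viewed as $A$-modules by inflation. Modules. Fix a set $\mathbf B=\coprod_{\lambda\in\Lambda}\mathbf B_\lambda$ such that $L_\lambda(b)$ $(b\in\mathbf B_\lambda)$ is a full set of irreducible graded left $A_\lambda$-modules up to isomorphism and degree shift. Let $P_\lambda(b)$ and $I_\lambda(b)$ be a projective cover and an injective hull of $L_\lambda(b)$ in $A_\lambda$-gmod. For $b\in\mathbf B_\lambda$, $\Delta(b)=j^\lambda_!P_\lambda(b)$, $\bar\Delta(b)=j^\lambda_!L_\lambda(b)$, $\bar\nabla(b)=j^\lambda_*L_\lambda(b)$, $\nabla(b)=j^\lambda_*I_\lambda(b)$, viewed as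 graded $A$-modules. $L(b)$ is the unique irreducible graded quotient of $\Delta(b)$ (equivalently the socle of $\nabla(b)$); the $L(b)$ $(b\in\mathbf B)$ form a full set of irreducible graded left $A$-modules up to isomorphism and degree shift. $I(b)$ is an injective hull of $L(b)$ in $A$-gmod. Flags. A $\nabla$-layer of type $\lambda$ is a graded $A$-module isomorphic to $j^\lambda_*\bar V$ for an injective graded left $A_\lambda$-module $\bar V$ that is locally finite-dimensional and bounded above. $V$ has a $\nabla$-flag if for some $n\geq0$ there is a graded filtration $V=V_0\supset V_1\supset\dots\supset V_n=0$ and distinct $\lambda_1,\dots,\lambda_n\in\Lambda$ such that $V_{r-1}/V_r$ is a $\nabla$-layer of type $\lambda_r$ for each $r$. For such $V$, $(V:\nabla(a))_q:=\dim_q\operatorname{Hom}_A(\bar\Delta(a),V)$, which is the total graded multiplicity of $\nabla(a)$ as a summand of the layers. Duality. The graded triangular basis is said to admit a duality $\tau$ if $A$ admits a graded algebra anti-automorphism $\tau:A\to A$ fixing each $1_i$ $(i\in\mathbf I)$.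
   Formalization: The last formula is proved when L(a) and L(b) are isomorphic to their graded duals twisted by the duality; without this normalization it fails, since L(b) is chosen only up to degree shift and the duality may permute irreducibles. *)

(* Defs.v *)
From HB Require Import structures.
From mathcomp Require Import all_boot all_order all_algebra.
From mathcomp Require Import boolp classical_sets functions cardinality.

Set Implicit Arguments.
Unset Strict Implicit.
Unset Printing Implicit Defensive.

Import Order.TTheory GRing.Theory.
Local Open Scope classical_set_scope.
Local Open Scope ring_scope.
Local Open Scope quotient_scope.

#[local] Obligation Tactic := idtac.

Section LinearAlgebra.
Variable k : fieldType.

Definition lfree (V : lmodType k) (T : Type) (f : T -> V) : Prop :=
  forall n (c : 'I_n -> T) (a : 'I_n -> k), injective c ->
    \sum_(i < n) a i *: f (c i) = 0 -> forall i, a i = 0.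

Definition lspanning (V : lmodType k) (T : Type) (f : T -> V) : Prop :=
  forall v, exists n (c : 'I_n -> T) (a : 'I_n -> k),
    v = \sum_(i < n) a i *: f (c i).

Definition is_basis (V : lmodType k) (T : Type) (f : T -> V) : Prop :=
  lfree f /\ lspanning f.

Definition has_dim (V : lmodType k) (n : nat) : Prop :=
  exists f : 'I_n -> V, is_basis f.

Definition fin_dim (V : lmodType k) : Prop := exists n, has_dim V n.

Record subsp (V : lmodType k) := Subsp {
  subsp_set :> V -> Prop;
  subsp0 : subsp_set 0;
  subspL : forall c x y, subsp_set x -> subsp_set y -> subsp_set (c *: x + y) }.

Lemma subspD (V : lmodType k) (U : subsp V) x y : U x -> U y -> U (x + y).
Proof. by move=> Ux Uy; rewrite -[x]scale1r; apply: subspL. Qed.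

Lemma subspZ (V : lmodType k) (U : subsp V) c x : U x -> U (c *: x).
Proof. by move=> Ux; rewrite -[_ *: _]addr0; apply: subspL => //; apply: subsp0. Qed.

Lemma subspN (V : lmodType k) (U : subsp V) x : U x -> U (- x).
Proof. by move=> Ux; rewrite -scaleN1r; apply: subspZ. Qed.

Lemma subspB (V : lmodType k) (U : subsp V) x y : U x -> U y -> U (x - y).
Proof. by move=> Ux /subspN Uy; apply: subspD. Qed.

Definition subsp_mem (V : lmodType k) (U : subsp V) : {pred V} := fun x => `[< U x >].

Lemma subsp_memP (V : lmodType k) (U : subsp V) x : reflect (U x) (x \in subsp_mem U).
Proof. exact: asboolP. Qed.

Definition lsub (V : lmodType k) (U : subsp V) : Type := {x : V | x \in subsp_mem U}.

End LinearAlgebra.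

Section SubspaceType.
Variables (k : fieldType) (V : lmodType k) (U : subsp V).

HB.instance Definition _ := SubType.on (lsub U).
HB.instance Definition _ := Choice.on (lsub U).

Fact lsub_closed : subsemimod_closed (subsp_mem U).
Proof.
split; [split|].
- by apply/subsp_memP; apply: subsp0.
- by move=> x y /subsp_memP Ux /subsp_memP Uy; apply/subsp_memP; apply: subspD.
- by move=> c x /subsp_memP Ux; apply/subsp_memP; apply: subspZ.
Qed.

HB.instance Definition _ :=
  GRing.SubChoice_isSubLmodule.Build k V (subsp_mem U) (lsub U) lsub_closed.

Definition lsub_in (x : V) (Ux : U x) : lsub U := exist _ x (introT (subsp_memP U x) Ux).

Lemma lsub_valP (x : lsub U) : U (val x).
Proof. by apply/subsp_memP; apply: (valP x). Qed.

Lemma lsub_val0 : val (0 : lsub U) = 0. Proof. exact: raddf0. Qed.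
Lemma lsub_valD (x y : lsub U) : val (x + y) = val x + val y. Proof. exact: raddfD. Qed.
Lemma lsub_valZ c (x : lsub U) : val (c *: x) = c *: val x. Proof. exact: linearZ. Qed.

Lemma lsub_inj (x y : lsub U) : val x = val y -> x = y. Proof. exact: val_inj. Qed.

End SubspaceType.

Section QuotientSpace.
Variables (k : fieldType) (V : lmodType k) (U : subsp V).

Definition lquot_rel (x y : V) : bool := `[< U (x - y) >].

Fact lquot_refl : reflexive lquot_rel.
Proof. by move=> x; apply/asboolP; rewrite subrr; apply: subsp0. Qed.
Fact lquot_sym : symmetric lquot_rel.
Proof.
by move=> x y; apply/asboolP/asboolP => /subspN; rewrite opprB.
Qed.
Fact lquot_trans : transitive lquot_rel.
Proof.
move=> y x z /asboolP Uxy /asboolP Uyz; apply/asboolP.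
by have := subspD Uxy Uyz; rewrite addrA subrK.
Qed.

Canonical lquot_equiv := EquivRel lquot_rel lquot_refl lquot_sym lquot_trans.

Definition lquot : Type := {eq_quot lquot_equiv}.
HB.instance Definition _ := Choice.on lquot.

Definition lpi (x : V) : lquot := \pi_{eq_quot lquot_equiv} x.
Definition lrepr (x : lquot) : V := repr (x : {eq_quot lquot_equiv}).

Lemma lreprK : cancel lrepr lpi. Proof. by move=> x; apply: reprK. Qed.

Lemma lpiP (x y : V) : lpi x = lpi y <-> U (x - y).
Proof.
split=> [e|Uxy]; first by move/eqmodP: e => /asboolP.
by apply/eqmodP; apply/asboolP.
Qed.

Lemma lrepr_pi (x : V) : U (lrepr (lpi x) - x).
Proof. by apply/lpiP; rewrite lreprK. Qed.

Definition lquot_add (x y : lquot) : lquot := lpi (lrepr x + lrepr y).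
Definition lquot_opp (x : lquot) : lquot := lpi (- lrepr x).
Definition lquot_scale (c : k) (x : lquot) : lquot := lpi (c *: lrepr x).

Lemma lpi_add x y : lquot_add (lpi x) (lpi y) = lpi (x + y).
Proof. by apply/lpiP; rewrite opprD addrACA; apply: subspD; apply: lrepr_pi. Qed.
Lemma lpi_opp x : lquot_opp (lpi x) = lpi (- x).
Proof. by apply/lpiP; rewrite -opprD; apply: subspN; apply: lrepr_pi. Qed.
Lemma lpi_scale c x : lquot_scale c (lpi x) = lpi (c *: x).
Proof. by apply/lpiP; rewrite -scalerBr; apply: subspZ; apply: lrepr_pi. Qed.

Fact lquot_addA : associative lquot_add.
Proof.
move=> x y z; rewrite -(lreprK x) -(lreprK y) -(lreprK z).
by rewrite !lpi_add addrA.
Qed.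
Fact lquot_addC : commutative lquot_add.
Proof. by move=> x y; rewrite /lquot_add addrC. Qed.
Fact lquot_add0 : left_id (lpi 0) lquot_add.
Proof. by move=> x; rewrite -(lreprK x) lpi_add add0r. Qed.
Fact lquot_addN : left_inverse (lpi 0) lquot_opp lquot_add.
Proof. by move=> x; rewrite -(lreprK x) lpi_opp lpi_add addNr. Qed.

HB.instance Definition _ :=
  GRing.isZmodule.Build lquot lquot_addA lquot_addC lquot_add0 lquot_addN.

Fact lquot_scaleA a b x : lquot_scale a (lquot_scale b x) = lquot_scale (a * b) x.
Proof. by rewrite -(lreprK x) !lpi_scale scalerA. Qed.
Fact lquot_scale1 : left_id 1 lquot_scale.
Proof. by move=> x; rewrite -(lreprK x) lpi_scale scale1r. Qed.
Fact lquot_scaleDr : right_distributive lquot_scale +%R.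
Proof.
move=> c x y; rewrite -(lreprK x) -(lreprK y) /GRing.add /=.
by rewrite !(lpi_scale, lpi_add) scalerDr.
Qed.
Fact lquot_scaleDl x : {morph lquot_scale^~ x : a b / a + b}.
Proof.
move=> a b; rewrite -(lreprK x) !lpi_scale {2}/GRing.add /=.
by rewrite lpi_add scalerDl.
Qed.

HB.instance Definition _ :=
  GRing.Zmodule_isLmodule.Build k lquot
    lquot_scaleA lquot_scale1 lquot_scaleDr lquot_scaleDl.

Lemma lpiL c x y : lpi (c *: x + y) = c *: lpi x + lpi y.
Proof. by rewrite -[RHS]/(lquot_add (lquot_scale c (lpi x)) (lpi y)) lpi_scale lpi_add. Qed.

End QuotientSpace.

(** A locally unital graded algebra is presented by its homogeneous pieces:
  [A i j d] is the degree-[d] part of 1_i A 1_j, so that A is the direct sum of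
  the [A i j d]; likewise [V i d] is the degree-[d] part of 1_i V for a graded
  left module V.  Products are indexed by a proof of the equation between
  degrees, which avoids casts along equalities of integers. *)

Record galg (k : fieldType) (I : Type) := GAlg {
  gcar :> I -> I -> int -> lmodType k;
  gone : forall i, gcar i i 0;
  gmul : forall {i j l d e f},
    d + e = f :> int -> gcar i j d -> gcar j l e -> gcar i l f;
  gmul_linl : forall i j l d e f (H : d + e = f) (b : gcar j l e) c (a a' : gcar i j d),
    gmul H (c *: a + a') b = c *: gmul H a b + gmul H a' b;
  gmul_linr : forall i j l d e f (H : d + e = f) (a : gcar i j d) c (b b' : gcar j l e),
    gmul H a (c *: b + b') = c *: gmul H a b + gmul H a b';
  gmulA : forall i j l m d e f de ef def (H1 : d + e = de) (H2 : de + f = def)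
      (H3 : e + f = ef) (H4 : d + ef = def)
      (a : gcar i j d) (b : gcar j l e) (c : gcar l m f),
    gmul H2 (gmul H1 a b) c = gmul H4 a (gmul H3 b c);
  gmul1l : forall i j d (H : 0 + d = d) (a : gcar i j d), gmul H (gone i) a = a;
  gmul1r : forall i j d (H : d + 0 = d) (a : gcar i j d), gmul H a (gone j) = a }.

Arguments gone {k I} g i.
Arguments gmul {k I} g {i j l d e f} H a b.

Record gmod (k : fieldType) (I : Type) (A : galg k I) := GMod {
  mcar :> I -> int -> lmodType k;
  mact : forall {i j d e f}, d + e = f :> int -> A i j d -> mcar j e -> mcar i f;
  mact_linl : forall i j d e f (H : d + e = f) (v : mcar j e) c (a a' : A i j d),
    mact H (c *: a + a') v = c *: mact H a v + mact H a' v;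
  mact_linr : forall i j d e f (H : d + e = f) (a : A i j d) c (v v' : mcar j e),
    mact H a (c *: v + v') = c *: mact H a v + mact H a v';
  mactA : forall i j l d e f de ef def (H1 : d + e = de) (H2 : de + f = def)
      (H3 : e + f = ef) (H4 : d + ef = def)
      (a : A i j d) (b : A j l e) (v : mcar l f),
    mact H2 (gmul A H1 a b) v = mact H4 a (mact H3 b v);
  mact1 : forall i d (H : 0 + d = d) (v : mcar i d), mact H (gone A i) v = v }.

Arguments mact {k I A} g {i j d e f} H a v.

Section BasicAction.
Variables (k : fieldType) (I : Type) (A : galg k I).

Lemma gmulDl i j l d e f (H : d + e = f) (b : A j l e) (a a' : A i j d) :
  gmul A H (a + a') b = gmul A H a b + gmul A H a' b.
Proof. by have := gmul_linl H b 1 a a'; rewrite !scale1r. Qed.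
Lemma gmulDr i j l d e f (H : d + e = f) (a : A i j d) (b b' : A j l e) :
  gmul A H a (b + b') = gmul A H a b + gmul A H a b'.
Proof. by have := gmul_linr H a 1 b b'; rewrite !scale1r. Qed.
Lemma gmul0l i j l d e f (H : d + e = f) (b : A j l e) : gmul A H (0 : A i j d) b = 0.
Proof. by apply: (addIr (gmul A H 0 b)); rewrite -gmulDl !add0r. Qed.
Lemma gmul0r i j l d e f (H : d + e = f) (a : A i j d) : gmul A H a (0 : A j l e) = 0.
Proof. by apply: (addIr (gmul A H a 0)); rewrite -gmulDr !add0r. Qed.
Lemma gmulZl i j l d e f (H : d + e = f) (b : A j l e) c (a : A i j d) :
  gmul A H (c *: a) b = c *: gmul A H a b.
Proof. by have := gmul_linl H b c a 0; rewrite gmul0l !addr0. Qed.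
Lemma gmulZr i j l d e f (H : d + e = f) (a : A i j d) c (b : A j l e) :
  gmul A H a (c *: b) = c *: gmul A H a b.
Proof. by have := gmul_linr H a c b 0; rewrite gmul0r !addr0. Qed.

Variable V : gmod A.

Lemma mactDl i j d e f (H : d + e = f) (v : V j e) (a a' : A i j d) :
  mact V H (a + a') v = mact V H a v + mact V H a' v.
Proof. by have := mact_linl H v 1 a a'; rewrite !scale1r. Qed.
Lemma mactDr i j d e f (H : d + e = f) (a : A i j d) (v v' : V j e) :
  mact V H a (v + v') = mact V H a v + mact V H a v'.
Proof. by have := mact_linr H a 1 v v'; rewrite !scale1r. Qed.
Lemma mact0l i j d e f (H : d + e = f) (v : V j e) : mact V H (0 : A i j d) v = 0.
Proof. by apply: (addIr (mact V H 0 v)); rewrite -mactDl !add0r. Qed.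
Lemma mact0r i j d e f (H : d + e = f) (a : A i j d) : mact V H a (0 : V j e) = 0.
Proof. by apply: (addIr (mact V H a 0)); rewrite -mactDr !add0r. Qed.
Lemma mactZl i j d e f (H : d + e = f) (v : V j e) c (a : A i j d) :
  mact V H (c *: a) v = c *: mact V H a v.
Proof. by have := mact_linl H v c a 0; rewrite mact0l !addr0. Qed.
Lemma mactZr i j d e f (H : d + e = f) (a : A i j d) c (v : V j e) :
  mact V H a (c *: v) = c *: mact V H a v.
Proof. by have := mact_linr H a c v 0; rewrite mact0r !addr0. Qed.

End BasicAction.

Definition alg_locally_findim (k : fieldType) I (A : galg k I) : Prop :=
  forall i j d, fin_dim (A i j d).

Definition alg_bounded_below (k : fieldType) I (A : galg k I) : Prop :=
  forall i j, exists N : int, forall d, d < N -> forall a : A i j d, a = 0.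

Definition mod_locally_findim (k : fieldType) I (A : galg k I) (V : gmod A) : Prop :=
  forall i d, fin_dim (V i d).

Definition mod_bounded_above (k : fieldType) I (A : galg k I) (V : gmod A) : Prop :=
  forall i, exists N : int, forall d, N < d -> forall v : V i d, v = 0.

(** [ghom V W d] is Hom_A(V,W)_d. *)
Record ghom (k : fieldType) (I : Type) (A : galg k I) (V W : gmod A) (d : int) := GHom {
  hfun :> forall {i n m}, n + d = m :> int -> V i n -> W i m;
  hfun_lin : forall i n m (H : n + d = m) c (v v' : V i n),
    hfun H (c *: v + v') = c *: hfun H v + hfun H v';
  hfun_act : forall i j c n m n' m' (H1 : c + n = n') (H2 : n' + d = m')
      (H3 : n + d = m) (H4 : c + m = m') (a : A i j c) (v : V j n),
    hfun H2 (mact V H1 a v) = mact W H4 a (hfun H3 v) }.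

Arguments hfun {k I A V W d} g {i n m} H v.

Section HomSpace.
Variables (k : fieldType) (I : Type) (A : galg k I) (V W : gmod A) (d : int).
Notation hom := (ghom V W d).

Lemma ghom_ext (f g : hom) :
  (forall i n m (H : n + d = m) (v : V i n), hfun f H v = hfun g H v) -> f = g.
Proof.
case: f g => [f fl fa] [g gl ga] /= e.
have {}e : f = g.
  apply: functional_extensionality_dep => i; apply: functional_extensionality_dep => n.
  apply: functional_extensionality_dep => m; apply: functional_extensionality_dep => H.
  by apply: functional_extensionality_dep => v; apply: e.
by rewrite e in fl fa *; congr GHom; apply: Prop_irrelevance.
Qed.

HB.instance Definition _ := gen_eqMixin hom.
HB.instance Definition _ := gen_choiceMixin hom.

Program Definition hom_zero : hom := @GHom _ _ _ _ _ _ (fun i n m _ _ => 0) _ _.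
Next Obligation. by move=> *; rewrite scaler0 addr0. Qed.
Next Obligation. by move=> * /=; rewrite mact0r. Qed.

Program Definition hom_add (f g : hom) : hom :=
  @GHom _ _ _ _ _ _ (fun i n m H v => hfun f H v + hfun g H v) _ _.
Next Obligation. by move=> * /=; rewrite !hfun_lin scalerDr addrACA. Qed.
Next Obligation.
move=> f g i j c n m n' m' H1 H2 H3 H4 a v.
by rewrite /= mactDr (hfun_act f H1 H2 H3 H4) (hfun_act g H1 H2 H3 H4).
Qed.

Program Definition hom_scale (c : k) (f : hom) : hom :=
  @GHom _ _ _ _ _ _ (fun i n m H v => c *: hfun f H v) _ _.
Next Obligation. by move=> * /=; rewrite !hfun_lin scalerDr !scalerA mulrC. Qed.
Next Obligation.
by move=> c0 f i j c n m n' m' H1 H2 H3 H4 a v /=; rewrite mactZr (hfun_act f H1 H2 H3 H4).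
Qed.

Definition hom_opp (f : hom) : hom := hom_scale (-1) f.

Fact hom_addA : associative hom_add.
Proof. by move=> f g h; apply: ghom_ext => * /=; rewrite addrA. Qed.
Fact hom_addC : commutative hom_add.
Proof. by move=> f g; apply: ghom_ext => * /=; rewrite addrC. Qed.
Fact hom_add0 : left_id hom_zero hom_add.
Proof. by move=> f; apply: ghom_ext => * /=; rewrite add0r. Qed.
Fact hom_addN : left_inverse hom_zero hom_opp hom_add.
Proof. by move=> f; apply: ghom_ext => * /=; rewrite scaleN1r addNr. Qed.

HB.instance Definition _ := GRing.isZmodule.Build hom hom_addA hom_addC hom_add0 hom_addN.

Fact hom_scaleA a b f : hom_scale a (hom_scale b f) = hom_scale (a * b) f.
Proof. by apply: ghom_ext => * /=; rewrite scalerA. Qed.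
Fact hom_scale1 : left_id 1 hom_scale.
Proof. by move=> f; apply: ghom_ext => * /=; rewrite scale1r. Qed.
Fact hom_scaleDr : right_distributive hom_scale +%R.
Proof. by move=> c f g; apply: ghom_ext => * /=; rewrite scalerDr. Qed.
Fact hom_scaleDl f : {morph hom_scale^~ f : a b / a + b}.
Proof. by move=> a b; apply: ghom_ext => * /=; rewrite scalerDl. Qed.

HB.instance Definition _ :=
  GRing.Zmodule_isLmodule.Build k hom hom_scaleA hom_scale1 hom_scaleDr hom_scaleDl.

End HomSpace.

Section Morphisms.
Variables (k : fieldType) (I : Type) (A : galg k I).

(** The morphisms of A-gmod are the homomorphisms of degree 0. *)
Definition mor (V W : gmod A) : Type := ghom V W 0.

Definition mfun (V W : gmod A) (f : mor V W) {i n} (v : V i n) : W i n :=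
  hfun f (addr0 n) v.

Definition mor_inj (V W : gmod A) (f : mor V W) : Prop :=
  forall i n (v : V i n), mfun f v = 0 -> v = 0.

Definition mor_surj (V W : gmod A) (f : mor V W) : Prop :=
  forall i n (w : W i n), exists v, mfun f v = w.

Definition giso (V W : gmod A) : Prop := exists f : mor V W, mor_inj f /\ mor_surj f.

(** The degree shift q^e V, with (q^e V)_d = V_(d - e). *)
Fact gshift_deg (e c n m : int) : c + n = m -> c + (n - e) = m - e.
Proof. by move=> <-; rewrite addrA. Qed.

Program Definition gshift (e : int) (V : gmod A) : gmod A :=
  @GMod _ _ _ (fun i d => V i (d - e))
    (fun i j c n m H a v => mact V (gshift_deg e H) a v) _ _ _ _.
Next Obligation. by move=> *; apply: mact_linl. Qed.
Next Obligation. by move=> *; apply: mact_linr. Qed.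
Next Obligation. by move=> *; apply: mactA. Qed.
Next Obligation. by move=> *; apply: mact1. Qed.

Record gsubmod (V : gmod A) := GSubmod {
  smset :> forall {i n}, subsp (V i n);
  sm_act : forall i j d e f (H : d + e = f) (a : A i j d) (v : V j e),
    smset v -> smset (mact V H a v) }.

Definition sm_le (V : gmod A) (U U' : gsubmod V) : Prop :=
  forall i n (v : V i n), smset U v -> smset U' v.

Definition sm_is_zero (V : gmod A) (U : gsubmod V) : Prop :=
  forall i n (v : V i n), smset U v -> v = 0.

Definition sm_is_full (V : gmod A) (U : gsubmod V) : Prop :=
  forall i n (v : V i n), smset U v.

Program Definition gsub (V : gmod A) (U : gsubmod V) : gmod A :=
  @GMod _ _ _ (fun i n => lsub (@smset V U i n))
    (fun i j d e f H a v => lsub_in (sm_act H a (lsub_valP v))) _ _ _ _.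
Next Obligation. by move=> *; apply: lsub_inj; rewrite lsub_valD lsub_valZ /= mact_linl. Qed.
Next Obligation.
move=> V U i j d e f H a c v v'; apply: lsub_inj; rewrite [RHS]lsub_valD [X in _ = X + _]lsub_valZ.
have E : mact V H a (val (c *: v + v')) = c *: mact V H a (val v) + mact V H a (val v').
  by rewrite lsub_valD lsub_valZ mact_linr.
exact: E.
Qed.
Next Obligation. by move=> *; apply: lsub_inj; apply: mactA. Qed.
Next Obligation. by move=> *; apply: lsub_inj; apply: mact1. Qed.

Program Definition gquot (V : gmod A) (U : gsubmod V) : gmod A :=
  @GMod _ _ _ (fun i n => lquot (@smset V U i n))
    (fun i j d e f H a v => lpi _ (mact V H a (lrepr v))) _ _ _ _.
Next Obligation. by move=> * /=; rewrite mact_linl lpiL. Qed.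
Next Obligation.
move=> V U i j d e f H a c v v' /=; rewrite -lpiL -mact_linr; apply/lpiP.
have -> (x y : V i f) : x - y = (-1) *: y + x by rewrite scaleN1r addrC.
rewrite -mact_linr; apply: sm_act; rewrite scaleN1r addrC; apply/lpiP.
by rewrite lreprK lpiL !lreprK.
Qed.
Next Obligation.
move=> V U i j l d e f de ef def H1 H2 H3 H4 a b v /=; apply/lpiP; rewrite (mactA H1 H2 H3 H4).
have -> (x y : V i def) : x - y = (-1) *: y + x by rewrite scaleN1r addrC.
rewrite -mact_linr; apply: sm_act; rewrite scaleN1r addrC; apply/lpiP.
by rewrite lreprK.
Qed.
Next Obligation. by move=> * /=; rewrite mact1 lreprK. Qed.

(** [U], intersected with [U'], as a submodule of [U']. *)
Program Definition sm_pull (V : gmod A) (U U' : gsubmod V) : gsubmod (gsub U') :=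
  @GSubmod (gsub U') (fun i n => @Subsp _ _ (fun v => smset U (val v)) _ _) _.
Next Obligation.
move=> V U U' i n; have E : smset U (val (0 : lsub (@smset V U' i n))).
  by rewrite lsub_val0; apply: subsp0.
exact: E.
Qed.
Next Obligation.
move=> V U U' i n c x y Ux Uy; have E : smset U (val (c *: x + y)).
  by rewrite lsub_valD lsub_valZ; apply: subspL.
exact: E.
Qed.
Next Obligation. by move=> V U U' i j d e f H a v; apply: sm_act. Qed.

(** The section U'/U of V, for submodules U of U' of V. *)
Definition gsection (V : gmod A) (U' U : gsubmod V) : gmod A := gquot (sm_pull U U').

(** A finite filtration F_0 = V, F_0 >= F_1 >= ... >= F_n = 0; the values F_r
  for n < r are irrelevant. *)
Definition filtration (V : gmod A) (n : nat) (F : nat -> gsubmod V) : Prop :=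
  [/\ sm_is_full (F 0%N), sm_is_zero (F n) &
      forall r, (r < n)%N -> sm_le (F r.+1) (F r)].

Definition irreducible (V : gmod A) : Prop :=
  (exists i n (v : V i n), v <> 0) /\
  forall U : gsubmod V, sm_is_zero U \/ sm_is_full U.

Definition section_count (V L : gmod A) (d : int) (n : nat) (F : nat -> gsubmod V) : nat :=
  #|[pred r : 'I_n | `[< giso (gsection (F r) (F r.+1)) (gshift d L) >]]|.

(** [comp_mult V L m] says that [V : L]_q is the series sum_d (m d) q^d. *)
Definition comp_mult (V L : gmod A) (m : int -> nat) : Prop :=
  forall d,
    (exists n (F : nat -> gsubmod V), filtration n F /\ section_count L d n F = m d) /\
    (forall n (F : nat -> gsubmod V), filtration n F -> (section_count L d n F <= m d)%N).

Definition projective (P : gmod A) : Prop :=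
  forall (M N : gmod A) (g : mor M N) (f : mor P N), mor_surj g ->
    exists h : mor P M, forall i n (v : P i n), mfun g (mfun h v) = mfun f v.

Definition injective_mod (J : gmod A) : Prop :=
  forall (M N : gmod A) (g : mor M N) (f : mor M J), mor_inj g ->
    exists h : mor N J, forall i n (v : M i n), mfun h (mfun g v) = mfun f v.

Definition projective_cover (P L : gmod A) : Prop :=
  projective P /\ exists p : mor P L, mor_surj p /\
    forall U : gsubmod P,
      (forall i n (v : P i n), exists u w, [/\ smset U u, mfun p w = 0 & v = u + w]) ->
      sm_is_full U.

Definition injective_hull (J L : gmod A) : Prop :=
  injective_mod J /\ exists f : mor L J, mor_inj f /\
    forall U : gsubmod J,
      (forall i n (v : L i n), smset U (mfun f v) -> v = 0) -> sm_is_zero U.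

Definition full_irreducibles (B : Type) (L : B -> gmod A) : Prop :=
  [/\ forall b, irreducible (L b),
      forall V, irreducible V -> exists b d, giso V (gshift d (L b)) &
      forall b b' d, giso (L b) (gshift d (L b')) -> b = b'].

End Morphisms.

Section QuotientAlgebra.
Variables (k : fieldType) (I : Type) (A : galg k I).

Record gideal := GIdeal {
  idset :> forall {i j d}, subsp (A i j d);
  id_mull : forall i j l d e f (H : d + e = f) (a : A i j d) (b : A j l e),
    idset b -> idset (gmul A H a b);
  id_mulr : forall i j l d e f (H : d + e = f) (a : A i j d) (b : A j l e),
    idset a -> idset (gmul A H a b) }.

(** The two-sided ideal generated by the 1_i with [E i]. *)
Inductive in_ideal_gen (E : I -> Prop) : forall i j d, A i j d -> Prop :=
| ideal_gen_one i : E i -> in_ideal_gen E (gone A i)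
| ideal_gen_zero i j d : in_ideal_gen E (0 : A i j d)
| ideal_gen_lin i j d c (a b : A i j d) :
    in_ideal_gen E a -> in_ideal_gen E b -> in_ideal_gen E (c *: a + b)
| ideal_gen_mull i j l d e f (H : d + e = f) (a : A i j d) (b : A j l e) :
    in_ideal_gen E b -> in_ideal_gen E (gmul A H a b)
| ideal_gen_mulr i j l d e f (H : d + e = f) (a : A i j d) (b : A j l e) :
    in_ideal_gen E a -> in_ideal_gen E (gmul A H a b).

Definition ideal_gen (E : I -> Prop) : gideal :=
  @GIdeal (fun i j d => Subsp (@ideal_gen_zero E i j d) (@ideal_gen_lin E i j d))
    (@ideal_gen_mull E) (@ideal_gen_mulr E).

Variable J : gideal.

Let qcar i j d := lquot (@idset J i j d).
Let qmul i j l d e f (H : d + e = f) (a : qcar i j d) (b : qcar j l e) : qcar i l f :=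
  lpi _ (gmul A H (lrepr a) (lrepr b)).

Lemma lpi_gmul i j l d e f (H : d + e = f) (a : A i j d) (b : A j l e) :
  qmul H (lpi _ a) (lpi _ b) = lpi _ (gmul A H a b).
Proof.
apply/lpiP; set a' := lrepr _; set b' := lrepr _.
have -> : gmul A H a' b' - gmul A H a b = gmul A H a' (b' - b) + gmul A H (a' - a) b.
  rewrite gmulDr gmulDl -[- b]scaleN1r -[- a]scaleN1r gmulZr gmulZl !scaleN1r.
  by rewrite addrA subrK.
by apply: subspD; [apply: id_mull | apply: id_mulr]; apply: lrepr_pi.
Qed.

Program Definition galg_quot : galg k I :=
  @GAlg k I qcar (fun i => lpi _ (gone A i)) qmul _ _ _ _ _.
Next Obligation.
move=> i j l d e f H b c a a' /=.
rewrite -(lreprK a) -(lreprK a') -(lreprK b) -lpiL !lpi_gmul -lpiL.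
by rewrite gmul_linl.
Qed.
Next Obligation.
move=> i j l d e f H a c b b' /=.
rewrite -(lreprK a) -(lreprK b') -(lreprK b) -lpiL !lpi_gmul -lpiL.
by rewrite gmul_linr.
Qed.
Next Obligation.
move=> i j l m d e f de ef def H1 H2 H3 H4 a b c /=.
rewrite -(lreprK a) -(lreprK b) -(lreprK c) !lpi_gmul.
by rewrite (gmulA H1 H2 H3 H4).
Qed.
Next Obligation. by move=> i j d H a; rewrite -(lreprK a) lpi_gmul gmul1l. Qed.
Next Obligation. by move=> i j d H a; rewrite -(lreprK a) lpi_gmul gmul1r. Qed.

(** Inflation along the quotient map from [A] to [galg_quot]. *)
Program Definition inflate (V : gmod galg_quot) : gmod A :=
  @GMod k I A V (fun i j d e f H a v => mact V H (lpi (@idset J i j d) a) v) _ _ _ _.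
Next Obligation. by move=> V i j d e f H v c a a' /=; rewrite lpiL mact_linl. Qed.
Next Obligation. by move=> V i j d e f H a c v v' /=; rewrite mact_linr. Qed.
Next Obligation.
move=> V i j l d e f de ef def H1 H2 H3 H4 a b v /=.
rewrite -lpi_gmul; exact: (mactA H1 H2 H3 H4).
Qed.
Next Obligation. by move=> V i d H v; apply: (mact1 H). Qed.

End QuotientAlgebra.

(** For [p : K -> I] injective with finite image F and e the sum of the 1_i with
  i in F, [galg_trunc p A] is the unital algebra eAe, and its modules, presented
  through the idempotents 1_i with i in F, are the unital eAe-modules. *)
Section Truncation.
Variables (k : fieldType) (K I : Type) (p : K -> I).

Program Definition galg_trunc (A : galg k I) : galg k K :=
  @GAlg k K (fun s t d => A (p s) (p t) d) (fun s => gone A (p s))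
    (fun s t u d e f H a b => gmul A H a b) _ _ _ _ _.
Next Obligation. by move=> *; apply: gmul_linl. Qed.
Next Obligation. by move=> *; apply: gmul_linr. Qed.
Next Obligation. by move=> *; apply: gmulA. Qed.
Next Obligation. by move=> *; apply: gmul1l. Qed.
Next Obligation. by move=> *; apply: gmul1r. Qed.

Variable A : galg k I.
Notation eAe := (galg_trunc A).

(** V |-> eV *)
Program Definition gmod_trunc (V : gmod A) : gmod eAe :=
  @GMod k K eAe (fun s d => V (p s) d) (fun s t d e f H a v => mact V H a v) _ _ _ _.
Next Obligation. by move=> *; apply: mact_linl. Qed.
Next Obligation. by move=> *; apply: mact_linr. Qed.
Next Obligation. by move=> *; apply: mactA. Qed.
Next Obligation. by move=> *; apply: mact1. Qed.

(** The left module A 1_i. *)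
Program Definition lreg (i : I) : gmod A :=
  @GMod k I A (fun j d => A j i d) (fun j l d e f H a b => gmul A H a b) _ _ _ _.
Next Obligation. by move=> *; apply: gmul_linl. Qed.
Next Obligation. by move=> *; apply: gmul_linr. Qed.
Next Obligation. by move=> *; apply: gmulA. Qed.
Next Obligation. by move=> *; apply: gmul1l. Qed.

(** The right adjoint V |-> (+)_i Hom_eAe (e A 1_i, V) of [gmod_trunc], with
  (a f)(x) = f (x a). *)

Section Coinduction.
Variable V : gmod eAe.

Let ccar i d := ghom (gmod_trunc (lreg i)) V d.

Fact coind_deg (d e f n m : int) : d + e = f -> n + f = m -> (n + d) + e = m.
Proof. by move=> <- <-; rewrite addrA. Qed.

Program Definition coind_act i j d e f (H : d + e = f) (a : A i j d) (g : ccar j e) :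
    ccar i f :=
  @GHom k K eAe (gmod_trunc (lreg i)) V f
    (fun s n m Hm (x : A (p s) i n) =>
       hfun g (coind_deg H Hm) (gmul A (erefl (n + d)) x a)) _ _.
Next Obligation.
move=> i j d e f H a g s n m Hm c x x' /=.
by rewrite gmul_linl; apply: (hfun_lin (d := e) g).
Qed.
Next Obligation.
move=> i j d e f H a g s t c n m n' m' H1 H2 H3 H4 b x /=.
have H5 : c + (n + d) = n' + d by rewrite addrA H1.
by rewrite (gmulA H1 _ (erefl _) H5); apply: (hfun_act (d := e) g).
Qed.

Lemma coind_actE i j d e f (H : d + e = f) (a : A i j d) (g : ccar j e)
    s n m (Hm : n + f = m) (x : A (p s) i n) nd (H1 : n + d = nd) (H2 : nd + e = m) :
  hfun (coind_act H a g) Hm x = hfun g H2 (gmul A H1 x a).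
Proof. by case: nd / H1 H2 => H2 /=; rewrite (Prop_irrelevance H2 (coind_deg H Hm)). Qed.

Program Definition coind : gmod A := @GMod k I A ccar coind_act _ _ _ _.
Next Obligation.
move=> i j d e f H g c a a'; apply: ghom_ext => s n m Hm x /=.
by rewrite gmul_linr; apply: (hfun_lin (d := e) g).
Qed.
Next Obligation. by move=> i j d e f H a c g g'; apply: ghom_ext. Qed.
Next Obligation.
move=> i j l d e f de ef def H1 H2 H3 H4 a b g; apply: ghom_ext => s n m Hm x.
have Hd : (n + d) + ef = m by rewrite -addrA H4.
have He : ((n + d) + e) + f = m by rewrite -addrA H3.
have He' : (n + d) + e = n + de by rewrite -H1 addrA.
have Hf : (n + de) + f = m by rewrite -He'.
rewrite (coind_actE _ _ _ _ _ (erefl (n + d)) Hd) (coind_actE _ _ _ _ _ He' Hf).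
rewrite (coind_actE _ _ _ _ _ (erefl (n + de)) Hf).
by rewrite (gmulA (erefl (n + d)) He' H1 (erefl (n + de))).
Qed.
Next Obligation.
move=> i d H g; apply: ghom_ext => s n m Hm x.
by rewrite (coind_actE _ _ _ _ _ (addr0 n) Hm) gmul1r.
Qed.

End Coinduction.

(** The left adjoint V |-> Ae (x)_eAe V of [gmod_trunc].

  The degree-[d] part of 1_i Ae (x)_eAe V consists of the formal sums of pure
  tensors a (x) v, with a in 1_i A 1_s and v in 1_s V homogeneous of degrees
  adding up to [d], modulo the relations of the tensor product over eAe. *)

Section Induction.
Variable V : gmod eAe.

Section Tensors.
Variables (i : I) (d : int).

Record ptens := PTens {
  pt_idx : K; pt_ldeg : int; pt_rdeg : int; pt_deg : pt_ldeg + pt_rdeg = d;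
  pt_left : A i (p pt_idx) pt_ldeg; pt_right : V pt_idx pt_rdeg }.

Inductive tens_eq : seq ptens -> seq ptens -> Prop :=
| tens_refl u : tens_eq u u
| tens_sym u v : tens_eq u v -> tens_eq v u
| tens_trans u v w : tens_eq u v -> tens_eq v w -> tens_eq u w
| tens_cat u u' v v' : tens_eq u u' -> tens_eq v v' -> tens_eq (u ++ v) (u' ++ v')
| tens_comm u v : tens_eq (u ++ v) (v ++ u)
| tens_zero s m n (H : m + n = d) (v : V s n) :
    tens_eq [:: @PTens s m n H 0 v] [::]
| tens_addl s m n (H : m + n = d) (a a' : A i (p s) m) (v : V s n) :
    tens_eq [:: @PTens s m n H (a + a') v] [:: @PTens s m n H a v; @PTens s m n H a' v]
| tens_addr s m n (H : m + n = d) (a : A i (p s) m) (v v' : V s n) :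
    tens_eq [:: @PTens s m n H a (v + v')] [:: @PTens s m n H a v; @PTens s m n H a v']
| tens_bal s t m c n mc cn (H1 : m + c = mc) (H2 : mc + n = d) (H3 : c + n = cn)
    (H4 : m + cn = d) (a : A i (p s) m) (b : eAe s t c) (v : V t n) :
    tens_eq [:: @PTens t mc n H2 (gmul A H1 a b) v] [:: @PTens s m cn H4 a (mact V H3 b v)].

HB.instance Definition _ := gen_eqMixin ptens.
HB.instance Definition _ := gen_choiceMixin ptens.

Definition tens_rel (u v : seq ptens) : bool := `[< tens_eq u v >].

Fact tens_rel_refl : reflexive tens_rel.
Proof. by move=> u; apply/asboolP; apply: tens_refl. Qed.
Fact tens_rel_sym : symmetric tens_rel.
Proof. by move=> u v; apply/asboolP/asboolP; apply: tens_sym. Qed.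
Fact tens_rel_trans : transitive tens_rel.
Proof. by move=> v u w /asboolP uv /asboolP vw; apply/asboolP; apply: tens_trans uv vw. Qed.

Canonical tens_equiv := EquivRel tens_rel tens_rel_refl tens_rel_sym tens_rel_trans.

Definition tens : Type := {eq_quot tens_equiv}.
HB.instance Definition _ := Choice.on tens.

Definition tpi (u : seq ptens) : tens := \pi_{eq_quot tens_equiv} u.
Definition trepr (x : tens) : seq ptens := repr (x : {eq_quot tens_equiv}).

Lemma treprK : cancel trepr tpi. Proof. by move=> x; apply: reprK. Qed.

Lemma tpiP u v : tpi u = tpi v <-> tens_eq u v.
Proof.
split=> [e|uv]; first by move/eqmodP: e => /asboolP.
by apply/eqmodP; apply/asboolP.
Qed.

Lemma trepr_pi u : tens_eq (trepr (tpi u)) u.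
Proof. by apply/tpiP; rewrite treprK. Qed.

Definition pscale (c : k) (x : ptens) : ptens := PTens (pt_deg x) (c *: pt_left x) (pt_right x).

Lemma tens_scale c u v : tens_eq u v -> tens_eq (map (pscale c) u) (map (pscale c) v).
Proof.
elim=> {u v} /=.
- by move=> u; apply: tens_refl.
- by move=> u v _; apply: tens_sym.
- by move=> u v w _ uv _; apply: tens_trans.
- by move=> u u' v v' _ uu' _ vv'; rewrite !map_cat; apply: tens_cat.
- by move=> u v; rewrite !map_cat; apply: tens_comm.
- by move=> s m n H v; rewrite /pscale /= scaler0; apply: tens_zero.
- by move=> s m n H a a' v; rewrite /pscale /= scalerDr; apply: tens_addl.
- by move=> s m n H a v v'; apply: tens_addr.
- by move=> *; rewrite /pscale /= -gmulZl; apply: tens_bal.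
Qed.

Lemma tens_mid x u v : tens_eq (x :: u ++ v) (u ++ x :: v).
Proof.
have -> : u ++ x :: v = (u ++ [:: x]) ++ v by rewrite -catA.
rewrite -[x :: u ++ v]/(([:: x] ++ u) ++ v).
by apply: tens_cat; [apply: tens_comm | apply: tens_refl].
Qed.

Definition tens_add (x y : tens) : tens := tpi (trepr x ++ trepr y).
Definition tens_scl (c : k) (x : tens) : tens := tpi (map (pscale c) (trepr x)).
Definition tens_opp (x : tens) : tens := tens_scl (-1) x.

Lemma tpi_add u v : tens_add (tpi u) (tpi v) = tpi (u ++ v).
Proof. by apply/tpiP; apply: tens_cat; apply: trepr_pi. Qed.
Lemma tpi_scl c u : tens_scl c (tpi u) = tpi (map (pscale c) u).
Proof. by apply/tpiP; apply: tens_scale; apply: trepr_pi. Qed.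

Fact tens_addA : associative tens_add.
Proof.
move=> x y z; rewrite -(treprK x) -(treprK y) -(treprK z).
by rewrite !tpi_add catA.
Qed.
Fact tens_addC : commutative tens_add.
Proof. by move=> x y; apply/tpiP; apply: tens_comm. Qed.
Fact tens_add0 : left_id (tpi [::]) tens_add.
Proof. by move=> x; rewrite -(treprK x) tpi_add. Qed.

Fact tens_sclDl x : {morph tens_scl^~ x : a b / a + b >-> tens_add a b}.
Proof.
move=> a b; rewrite -(treprK x) !tpi_scl tpi_add; apply/tpiP.
elim: (trepr x) => [|[s m n H l r] u IH] /=; first exact: tens_refl.
apply: (@tens_trans _ ([:: PTens H (a *: l) r; PTens H (b *: l) r] ++
   (map (pscale a) u ++ map (pscale b) u))).
  rewrite -cat1s; apply: tens_cat IH; rewrite /pscale /= scalerDl; exact: tens_addl.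
rewrite /= -cat1s -[X in tens_eq _ X]cat1s; apply: tens_cat; first exact: tens_refl.
exact: tens_mid.
Qed.
Fact tens_scl0 x : tens_scl 0 x = tpi [::].
Proof.
rewrite -(treprK x) tpi_scl; apply/tpiP.
elim: (trepr x) => [|[s m n H l r] u IH] /=; first exact: tens_refl.
rewrite -cat1s -[X in tens_eq _ X]cats0; apply: tens_cat IH.
by rewrite /pscale /= scale0r; apply: tens_zero.
Qed.
Fact tens_scl1 : left_id 1 tens_scl.
Proof.
move=> x; rewrite -(treprK x) tpi_scl (eq_map (g := id)) ?map_id //.
by case=> * /=; rewrite /pscale /= scale1r.
Qed.
Fact tens_addN : left_inverse (tpi [::]) tens_opp tens_add.
Proof. by move=> x; rewrite -{2}(tens_scl1 x) -tens_sclDl addNr tens_scl0. Qed.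

HB.instance Definition _ :=
  GRing.isZmodule.Build tens tens_addA tens_addC tens_add0 tens_addN.

Fact tens_sclA a b x : tens_scl a (tens_scl b x) = tens_scl (a * b) x.
Proof.
rewrite -(treprK x) !tpi_scl -map_comp; congr tpi.
by apply: eq_map => -[*]; rewrite /pscale /= scalerA.
Qed.
Fact tens_sclDr : right_distributive tens_scl +%R.
Proof.
move=> c x y; rewrite -(treprK x) -(treprK y).
by rewrite -[LHS]/(tens_scl c (tens_add _ _)) tpi_add !tpi_scl map_cat -tpi_add.
Qed.

HB.instance Definition _ :=
  GRing.Zmodule_isLmodule.Build k tens tens_sclA tens_scl1 tens_sclDr tens_sclDl.

End Tensors.

Fact ind_deg (d e f m n : int) : d + e = f -> m + n = e -> (d + m) + n = f.
Proof. by move=> <- <-; rewrite addrA. Qed.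

Definition ptens_act i j d e f (H : d + e = f) (b : A i j d) (x : ptens j e) : ptens i f :=
  PTens (ind_deg H (pt_deg x)) (gmul A (erefl _) b (pt_left x)) (pt_right x).

Definition ind_act i j d e f (H : d + e = f) (b : A i j d) (x : tens j e) : tens i f :=
  tpi (map (ptens_act H b) (trepr x)).

Lemma ptens_actE i j d e f (H : d + e = f) (b : A i j d) s m n (Hx : m + n = e)
    (a : A j (p s) m) (v : V s n) dm (H1 : d + m = dm) (H2 : dm + n = f) :
  ptens_act H b (PTens Hx a v) = PTens H2 (gmul A H1 b a) v.
Proof.
case: dm / H1 H2 => H2; rewrite /ptens_act /=.
by rewrite (Prop_irrelevance H2 (ind_deg H Hx)).
Qed.

Lemma tens_act i j d e f (H : d + e = f) (b : A i j d) u v :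
  tens_eq u v -> tens_eq (map (ptens_act H b) u) (map (ptens_act H b) v).
Proof.
elim=> {u v} /=.
- by move=> u; apply: tens_refl.
- by move=> u v _; apply: tens_sym.
- by move=> u v w _ uv _; apply: tens_trans.
- by move=> u u' v v' _ uu' _ vv'; rewrite !map_cat; apply: tens_cat.
- by move=> u v; rewrite !map_cat; apply: tens_comm.
- by move=> s m n Hx v; rewrite /ptens_act /= gmul0r; apply: tens_zero.
- by move=> s m n Hx a a' v; rewrite /ptens_act /= gmulDr; apply: tens_addl.
- by move=> s m n Hx a v v'; apply: tens_addr.
- move=> s t m c n mc cn H1 H2 H3 H4 a b' v.
  have H5 : (d + m) + c = d + mc by rewrite -H1 addrA.
  have H6 : (d + m) + cn = f by rewrite -addrA H4.
  have H7 : (d + mc) + n = f by rewrite -addrA H2.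
  rewrite (ptens_actE _ _ _ _ _ (erefl (d + mc)) H7).
  rewrite (ptens_actE _ _ _ _ _ (erefl (d + m)) H6).
  rewrite -(gmulA (erefl (d + m)) H5 H1 (erefl (d + mc))).
  exact: tens_bal.
Qed.

Lemma tpi_act i j d e f (H : d + e = f) (b : A i j d) (u : seq (ptens j e)) :
  ind_act H b (tpi u) = tpi (map (ptens_act H b) u).
Proof. by apply/tpiP; apply: tens_act; apply: trepr_pi. Qed.

Lemma tpiD i d (u v : seq (ptens i d)) : tpi (u ++ v) = tpi u + tpi v.
Proof. by rewrite -tpi_add. Qed.
Lemma tpiZ i d c (u : seq (ptens i d)) : tpi (map (pscale c) u) = c *: tpi u.
Proof. by rewrite -tpi_scl. Qed.

Program Definition ind : gmod A := @GMod k I A tens ind_act _ _ _ _.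
Next Obligation.
move=> i j d e f H x c a a'; rewrite -(treprK x) !tpi_act -tpiZ -tpiD; apply/tpiP.
elim: (trepr x) => [|[s m n Hx l r] u IH] /=; first exact: tens_refl.
apply: (@tens_trans _ _ _ ([:: pscale c (ptens_act H a (PTens Hx l r));
     ptens_act H a' (PTens Hx l r)] ++
   (map (pscale c) (map (ptens_act H a) u) ++ map (ptens_act H a') u))).
  rewrite -cat1s; apply: tens_cat IH.
  by rewrite /pscale /ptens_act /= gmulDl gmulZl; apply: tens_addl.
rewrite /= -cat1s -[X in tens_eq _ X]cat1s; apply: tens_cat; first exact: tens_refl.
exact: tens_mid.
Qed.
Next Obligation.
move=> i j d e f H a c x y; rewrite -(treprK x) -(treprK y).
rewrite -tpiZ -tpiD !tpi_act -tpiZ -tpiD map_cat -!map_comp.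
congr (tpi (_ ++ _)); apply: eq_map => -[s m n Hx l r].
by rewrite /pscale /ptens_act /= gmulZr.
Qed.
Next Obligation.
move=> i j l d e f de ef def H1 H2 H3 H4 a b x; rewrite -(treprK x) !tpi_act -map_comp.
congr tpi; apply: eq_map => -[s m n Hx y v] /=.
have H5 : de + m = d + (e + m) by rewrite -H1 addrA.
have H6 : (d + (e + m)) + n = def by rewrite -H2 -Hx -H1 !addrA.
rewrite (ptens_actE _ _ _ _ _ H5 H6) [in RHS]/ptens_act /= .
rewrite (gmulA H1 H5 (erefl (e + m)) (erefl (d + (e + m)))).
by congr PTens; apply: Prop_irrelevance.
Qed.
Next Obligation.
move=> i d H x; rewrite -(treprK x) tpi_act (eq_map (g := id)) ?map_id // => -[s m n Hx y v].
by rewrite (ptens_actE _ _ _ _ _ (add0r m) Hx) gmul1l.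
Qed.

End Induction.

End Truncation.

Section Duality.
Variables (k : fieldType) (I : Type) (A : galg k I).

(** A graded algebra anti-automorphism fixing each 1_i. *)
Record duality := Duality {
  du : forall {i j d}, A i j d -> A j i d;
  du_lin : forall i j d c (a b : A i j d), du (c *: a + b) = c *: du a + du b;
  du_bij : forall i j d, bijective (@du i j d);
  du_one : forall i, du (gone A i) = gone A i;
  du_mul : forall i j l d e f (H : d + e = f) (H' : e + d = f)
      (a : A i j d) (b : A j l e),
    du (gmul A H a b) = gmul A H' (du b) (du a) }.

Program Definition linear_forms (V : lmodType k) : subsp (V -> k^o) :=
  @Subsp k (V -> k^o) (fun f => forall c x y, f (c *: x + y) = c *: f x + f y) _ _.
Next Obligation. by move=> V c x y; rewrite scaler0 addr0. Qed.
Next Obligation.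
move=> V a f g fl gl c x y.
have E : a *: f (c *: x + y) + g (c *: x + y) = c *: (a *: f x + g x) + (a *: f y + g y).
  by rewrite fl gl !scalerDr !scalerA [a * c]mulrC addrACA.
exact: E.
Qed.

Variable tau : duality.

(** The degree-[d] part of 1_i of the dual of V is the linear dual of 1_i V_(-d),
  with (a f)(v) = f (tau(a) v).  An anti-automorphism fixing each 1_i need not fix
  irreducibles: dualizing permutes them, and also reverses degree shifts, so that
  self-duality of an irreducible also normalizes its grading. *)
Section Dual.
Variable V : gmod A.

Let dcar i d := lsub (linear_forms (V i (- d))).

Fact dual_deg (d e f : int) : d + e = f -> d + - f = - e.
Proof. by move=> <-; rewrite opprD addNKr. Qed.

Lemma dual_lin i d (g : dcar i d) c x y :
  val g (c *: x + y) = c *: val g x + val g y.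
Proof. exact: (lsub_valP g). Qed.

Program Definition dual_act i j d e f (H : d + e = f) (a : A i j d) (g : dcar j e) :
    dcar i f :=
  @lsub_in _ _ (linear_forms (V i (- f)))
    (fun v : V i (- f) => val g (mact V (dual_deg H) (du tau a) v)) _.
Next Obligation.
by move=> i j d e f H a g c x y; rewrite mact_linr dual_lin.
Qed.

Program Definition gdual : gmod A := @GMod k I A dcar dual_act _ _ _ _.
Next Obligation.
move=> i j d e f H g c a a'; apply: lsub_inj; apply: funext => v.
have E : val g (mact V (dual_deg H) (du tau (c *: a + a')) v) =
   c *: val g (mact V (dual_deg H) (du tau a) v) + val g (mact V (dual_deg H) (du tau a') v).
  by rewrite du_lin mact_linl dual_lin.
exact: E.
Qed.
Next Obligation. by move=> i j d e f H a c g g'; apply: lsub_inj. Qed.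
Next Obligation.
move=> i j l d e f de ef def H1 H2 H3 H4 a b g; apply: lsub_inj; apply: funext => v /=.
have H5 : e + d = de by rewrite addrC.
by rewrite (du_mul tau H1 H5) (mactA H5 (dual_deg H2) (dual_deg H4) (dual_deg H3)).
Qed.
Next Obligation.
move=> i d H g; apply: lsub_inj; apply: funext => v /=.
by rewrite du_one mact1.
Qed.

End Dual.

End Duality.

Section Triples.
Variables (k : fieldType) (I : Type) (A : galg k I) (S : {pred I}).
Notation sS := {s : I | s \in S}.

(** A subset of the homogeneous elements of 1_i A 1_j is presented by its
  intersections with the homogeneous pieces. *)
Variables (X : forall (i : I) (s : sS) d, set (A i (sval s) d))
          (H : forall (s t : sS) d, set (A (sval s) (sval t) d))
          (Y : forall (t : sS) (j : I) d, set (A (sval t) j d)).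

(** The triples (x, h, y) whose product lies in the degree-[d] part of 1_i A 1_j. *)
Record gtriple (i j : I) (d : int) := GTriple {
  tr_s : sS; tr_t : sS;
  tr_dx : int; tr_dh : int; tr_dy : int;
  tr_deg : (tr_dx + tr_dh) + tr_dy = d;
  tr_x : A i (sval tr_s) tr_dx;
  tr_h : A (sval tr_s) (sval tr_t) tr_dh;
  tr_y : A (sval tr_t) j tr_dy;
  tr_X : X tr_x; tr_H : H tr_h; tr_Y : Y tr_y }.

Definition gtriple_mul i j d (u : gtriple i j d) : A i j d :=
  gmul A (tr_deg u) (gmul A (erefl _) (tr_x u) (tr_h u)) (tr_y u).

End Triples.

Record gtbasis (k : fieldType) (disp : Order.disp_t) (Lam : porderType disp)
    (I : Type) (A : galg k I) := GTBasis {
  gS : {pred I};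
  gdot : {s : I | s \in gS} -> Lam;
  gX : forall (i : I) (s : {s | s \in gS}) d, set (A i (sval s) d);
  gH : forall (s t : {s | s \in gS}) d, set (A (sval s) (sval t) d);
  gY : forall (t : {s | s \in gS}) (j : I) d, set (A (sval t) j d);
  gLam_fin : forall lam : Lam, finite_set [set mu | (mu <= lam)%O];
  gdot_fin : forall lam, finite_set [set s | gdot s = lam];
  gtb_basis : forall i j d, is_basis (@gtriple_mul k I A gS gX gH gY i j d);
  gtb_X1 : forall s, gX (i := sval s) (s := s) (d := 0) = [set gone A (sval s)];
  gtb_Xd : forall s d, d <> 0 -> gX (i := sval s) (s := s) (d := d) = set0;
  gtb_Y1 : forall s, gY (t := s) (j := sval s) (d := 0) = [set gone A (sval s)];
  gtb_Yd : forall s d, d <> 0 -> gY (t := s) (j := sval s) (d := d) = set0;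
  gtb_X : forall s t d, s <> t -> gX (i := sval s) (s := t) (d := d) !=set0 ->
    (gdot t < gdot s)%O;
  gtb_H : forall s t d, s <> t -> gH (s := s) (t := t) (d := d) !=set0 -> gdot s = gdot t;
  gtb_Y : forall s t d, s <> t -> gY (t := s) (j := sval t) (d := d) !=set0 ->
    (gdot s < gdot t)%O;
  gtb_Xfin : forall i, i \notin gS ->
    finite_set [set s | exists d, gX (i := i) (s := s) (d := d) !=set0];
  gtb_Yfin : forall i, i \notin gS ->
    finite_set [set s | exists d, gY (t := s) (j := i) (d := d) !=set0] }.

Section Standardization.
Variables (k : fieldType) (disp : Order.disp_t) (Lam : porderType disp).
Variables (I : Type) (A : galg k I) (T : gtbasis Lam A).

(** The index set of the idempotents 1_s with s in S_lam. *)
Definition gS_at (lam : Lam) : Type := {s : {s : I | s \in gS T} | gdot s == lam}.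
Definition gS_at_val (lam : Lam) (s : gS_at lam) : I := sval (sval s).

(** The two-sided ideal generated by the e_mu with not (mu >= lam) is the one
  generated by the 1_s with s in S_mu, since 1_s = 1_s e_mu. *)
Definition ideal_not_ge (lam : Lam) : gideal A :=
  ideal_gen A (fun i => exists s : {s : I | s \in gS T},
    i = sval s /\ ~~ (lam <= gdot s)%O).

(** A_(>= lam) *)
Definition Age (lam : Lam) : galg k I := galg_quot (ideal_not_ge lam).

(** A_lam, see [galg_trunc]. *)
Definition Aat (lam : Lam) : galg k (gS_at lam) := galg_trunc (@gS_at_val lam) (Age lam).

(** The functors j^lam_! and j^lam_*, followed by inflation to A. *)
Definition jlower (lam : Lam) (V : gmod (Aat lam)) : gmod A := inflate (ind V).
Definition jstar (lam : Lam) (V : gmod (Aat lam)) : gmod A := inflate (coind V).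

Definition nabla_layer (lam : Lam) (V : gmod A) : Prop :=
  exists W : gmod (Aat lam),
    [/\ injective_mod W, mod_locally_findim W, mod_bounded_above W & giso V (jstar W)].

Definition has_nabla_flag (V : gmod A) : Prop :=
  exists n (F : nat -> gsubmod V) (lam : 'I_n -> Lam),
    [/\ filtration n F, injective lam &
        forall r : 'I_n, nabla_layer (lam r) (gsection (F r) (F r.+1))].

(** [nabla_mult L V m], for L = L_lam(a), says that (V : nabla(a))_q, the graded
  dimension of Hom_A(j^lam_! L, V), is the series with coefficients [m]. *)
Definition nabla_mult (lam : Lam) (L : gmod (Aat lam)) (V : gmod A) (m : int -> nat) : Prop :=
  forall d, has_dim (ghom (jlower L) V d) (m d).

End Standardization.

Definition bar_series (m : int -> nat) : int -> nat := fun d => m (- d).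

(* Main.v *)
Require Import Defs.
From HB Require Import structures.
From mathcomp Require Import all_boot all_order all_algebra.
From mathcomp Require Import boolp classical_sets functions cardinality.

Set Implicit Arguments.
Unset Strict Implicit.
Unset Printing Implicit Defensive.

Import Order.TTheory GRing.Theory Num.Theory.
Local Open Scope ring_scope.

#[local] Obligation Tactic := idtac.

(** Both halves of the claim come from properties of injective modules: maps into an
  injective hull count composition factors, and maps into an injective module that are
  prescribed on a submodule extend.

  Multiplicities.  Let [L] be irreducible with injective hull [J], and let [V] be
  locally finite-dimensional.  For a finite filtration of [V], consider the spaces of
  maps V -> J that vanish on the successive terms.  Crossing a section isomorphic to [L]
  enlarges the space by one dimension: by injectivity the inclusion L -> J lifts, and by
  Schur's lemma over an algebraically closed field it is the only map up to scalars
  ([killers_step]).  Crossing another section changes nothing if the filtration has as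
  many sections [L] as possible, for a new map would exhibit one more subquotient [L]
  ([killers_refine]).  Hence dim Hom(V, J) is that maximal number, and with degree shifts
  dim Hom(V, J)_d = [V : q^(-d) L] ([comp_mult_hull]).  For V = j_! L_mu(a) this is the
  formula for (I(b) : nabla(a))_q; for V = A 1_i it shows that [J] is locally
  finite-dimensional.

  Flag.  For a lower set D of weights let V^D consist of the vectors [v] such that
  e_nu A v = 0 for all nu in D.  Since the socle of J = I(b) contains a weight vector of
  weight lam, J^D = 0 as soon as D contains the finite set of weights below lam.
  Enlarging D by one minimal weight mu at a time gives a finite filtration of [J], whose
  sections are j_* W for W = e_mu J^D.  The canonical map from J^D to j_* W has kernel
  J^(D + mu).  It is onto: an element of j_* W is a map [f] on e_mu A 1_i, the rule
  x h y |-> x f(h y) on the triangular basis extends it to a map on the submodule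
  generated by e_mu A 1_i, well defined by straightening, and this map extends to all of
  A 1_i because [J] is injective ([layer_section_iso]).  Moreover [W] is injective,
  because j_! preserves injections: A_(>= mu) e_mu is a free right A_mu-module with
  basis the elements x of the triangular basis ([jlower_inj], [layer_injective]).
  Straightening itself is [through_span]: a product that passes through the weight nu is
  a combination of basis elements that pass through weights at most nu.

  Duality.  An anti-automorphism tau under which L(a) is self-dual makes L_mu(a)
  self-dual, since L_mu(a) is the truncation of L(a) ([head_truncation]).  Then j_* L_mu(a)
  is the graded dual of j_! L_mu(a) ([jlower_jstar_pairing]), and annihilators turn
  filtrations of one into filtrations of the other, so that composition multiplicities
  agree up to inversion of [q] ([comp_mult_pairing]). *)

(** * Linear algebra over a field *)

Section Linear.
Variable k : fieldType.
Implicit Types V W : lmodType k.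

Definition lin V W (f : V -> W) : Prop :=
  forall c x y, f (c *: x + y) = c *: f x + f y.

Section LinTheory.
Variables (V W : lmodType k) (f : V -> W).
Hypothesis fl : lin f.

Lemma lin0 : f 0 = 0.
Proof.
by have := fl (-1) 0 0; rewrite scaler0 addr0 scaleN1r addNr.
Qed.

Lemma linD x y : f (x + y) = f x + f y.
Proof. by have := fl 1 x y; rewrite !scale1r. Qed.

Lemma linZ c x : f (c *: x) = c *: f x.
Proof. by have := fl c x 0; rewrite lin0 !addr0. Qed.

Lemma linN x : f (- x) = - f x.
Proof. by rewrite -!scaleN1r linZ. Qed.

Lemma linB x y : f (x - y) = f x - f y.
Proof. by rewrite linD linN. Qed.

Lemma lin_sum (J : Type) (r : seq J) (P : pred J) (F : J -> V) :
  f (\sum_(j <- r | P j) F j) = \sum_(j <- r | P j) f (F j).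
Proof. by apply: (big_morph f linD lin0). Qed.

Lemma lin_comb n (a : 'I_n -> k) (F : 'I_n -> V) :
  f (\sum_i a i *: F i) = \sum_i a i *: f (F i).
Proof. by rewrite lin_sum; apply: eq_bigr => i _; rewrite linZ. Qed.

End LinTheory.

Lemma subsp_sum V (U : subsp V) (J : Type) (r : seq J) (P : pred J) (F : J -> V) :
  (forall j, P j -> U (F j)) -> U (\sum_(j <- r | P j) F j).
Proof.
by move=> UF; elim/big_ind: _ => //; [apply: subsp0 | move=> x y; apply: subspD].
Qed.

Lemma basis_ind V (T : Type) (f : T -> V) (U : subsp V) :
  lspanning f -> (forall t, U (f t)) -> forall v, U v.
Proof.
move=> sp Uf v; have [n [c [a ->]]] := sp v.
by apply: subsp_sum => j _; apply: subspZ.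
Qed.

Program Definition equal_sp V W (f g : V -> W) (fl : lin f) (gl : lin g) : subsp V :=
  @Subsp k V (fun v => f v = g v) _ _.
Next Obligation. by move=> *; rewrite /= !lin0. Qed.
Next Obligation. by move=> V W f g fl gl c x y /=; rewrite fl gl => -> ->. Qed.

Lemma lfree_collapse V (T : Type) (f : T -> V) n (c : 'I_n -> T) (a : 'I_n -> k) :
  lfree f -> \sum_i a i *: f (c i) = 0 ->
  forall W (F : T -> W), \sum_i a i *: F (c i) = 0.
Proof.
move=> fr e W F.
pose s : seq {classic T} := undup (codom (c : 'I_n -> {classic T})).
have cs i : (c i : {classic T}) \in s by rewrite mem_undup codom_f.
have pi i : (index (c i : {classic T}) s < size s)%N by rewrite index_mem.
pose p i := Ordinal (pi i).
pose c' (j : 'I_(size s)) : T := tnth (in_tuple s) j.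
have c'p i : c' (p i) = c i.
  by rewrite /c' (tnth_nth (c i : {classic T})) /= nth_index.
have c'inj : injective c'.
  move=> i j; have [t] : exists t, t = tnth (in_tuple s) i by eexists.
  move=> _; rewrite /c' !(tnth_nth t) /= => ee.
  apply: val_inj; apply/eqP; rewrite /=.
  by rewrite -(nth_uniq (t : {classic T}) (ltn_ord i) (ltn_ord j) (undup_uniq _)) ee.
have E (X : lmodType k) (G : T -> X) :
    \sum_i a i *: G (c i) = \sum_j (\sum_(i | p i == j) a i) *: G (c' j).
  rewrite (partition_big p xpredT) //=; apply: eq_bigr => j _.
  by rewrite scaler_suml; apply: eq_bigr => i /eqP <-; rewrite c'p.
rewrite E big1 // => j _.
by rewrite (fr _ c' (fun j => \sum_(i | p i == j) a i)) ?scale0r // -E.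
Qed.

(** The values on a basis may be prescribed; the graph of the extension is the set of
  pairs of combinations with the same coefficients, and [lfree_collapse] makes it a
  function although the indices in a combination may repeat. *)
Lemma linear_extension V W (T : Type) (f : T -> V) (F : T -> W) :
  is_basis f -> exists G : V -> W, lin G /\ forall t, G (f t) = F t.
Proof.
move=> [fr sp].
pose R v w := exists n (c : 'I_n -> T) (a : 'I_n -> k),
  v = \sum_i a i *: f (c i) /\ w = \sum_i a i *: F (c i).
have Rex v : exists w, R v w.
  by have [n [c [a ->]]] := sp v; exists (\sum_i a i *: F (c i)), n, c, a.
have RL b v w v' w' : R v w -> R v' w' -> R (b *: v + v') (b *: w + w').
  move=> [n [c [a [-> ->]]]] [n' [c' [a' [-> ->]]]].
  pose C (i : 'I_(n + n')) : T := match fintype.split i with inl i => c i | inr i => c' i end.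
  pose D (i : 'I_(n + n')) : k := match fintype.split i with inl i => b * a i | inr i => a' i end.
  exists (n + n')%N, C, D.
  have S (X : lmodType k) (g : T -> X) :
      b *: (\sum_i a i *: g (c i)) + \sum_i a' i *: g (c' i) = \sum_i D i *: g (C i).
    rewrite /C /D big_split_ord /=; congr (_ + _); [rewrite scaler_sumr|]; apply: eq_bigr => i _.
      by rewrite (unsplitK (inl i) : fintype.split (lshift n' i) = inl i) scalerA.
    by rewrite (unsplitK (inr i) : fintype.split (rshift n i) = inr i).
  by rewrite !S.
have R0 w : R 0 w -> w = 0.
  by move=> [n [c [a [e ->]]]]; apply: lfree_collapse fr (esym e) _ _.
have Rfun v w w' : R v w -> R v w' -> w = w'.
  move=> Rw Rw'; apply/eqP; rewrite -subr_eq0; apply/eqP/R0.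
  by have := RL (-1) _ _ _ _ Rw' Rw; rewrite !scaleN1r addNr addrC.
have [G GP] : {G : V -> W & forall v, R v (G v)}.
  by apply: (@choice _ _ R) => v; apply: Rex.
exists G; split=> [c x y|t]; first by apply: Rfun (GP _) _; apply: RL.
apply: Rfun (GP _) _; exists 1%N, (fun=> t), (fun=> 1).
by rewrite !big_ord1 !scale1r.
Qed.

Definition ffree V n (f : 'I_n -> V) : Prop :=
  forall a : 'I_n -> k, \sum_i a i *: f i = 0 -> forall i, a i = 0.

Definition comb V n (f : 'I_n -> V) (v : V) : Prop :=
  exists a : 'I_n -> k, v = \sum_i a i *: f i.

Definition sdim V (U : V -> Prop) n : Prop :=
  exists f : 'I_n -> V, ffree f /\ forall v, U v <-> comb f v.

Lemma lfree_ffree V n (f : 'I_n -> V) : lfree f <-> ffree f.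
Proof.
split=> [fr a e|fr m c a ci e i]; first exact: (fr _ id a (fun _ _ => id)).
pose a' j := \sum_(i | c i == j) a i.
have ca' i' : a' (c i') = a i'.
  rewrite /a' (big_pred1 i') // => j; rewrite /= inj_eq //.
rewrite -ca'; apply: fr; rewrite -[RHS]e [RHS](partition_big c xpredT) //=.
by apply: eq_bigr => j _; rewrite scaler_suml; apply: eq_bigr => i' /eqP ->.
Qed.

Lemma sdim_has_dim V n : sdim (fun _ : V => True) n <-> has_dim V n.
Proof.
split=> [[f [fr sp]]|[f [fr sp]]]; exists f.
  split; first exact/lfree_ffree.
  by move=> v; have [a ->] := (sp v).1 I; exists n, id, a.
split=> [|v]; first exact/lfree_ffree.
split=> // _; have [m [c [a ->]]] := sp v.
exists (fun j => \sum_(i | c i == j) a i).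
rewrite (partition_big c xpredT) //=; apply: eq_bigr => j _.
by rewrite scaler_suml; apply: eq_bigr => i /eqP ->.
Qed.

Lemma sdim_zero V (U : V -> Prop) : (forall v, U v <-> v = 0) -> sdim U 0.
Proof.
move=> U0; exists (fun=> 0); split=> [a _ []//|v]; rewrite U0.
by split=> [->|[a ->]]; [exists (fun=> 0)|]; rewrite big_ord0.
Qed.

Lemma sdim_ext V (U U' : V -> Prop) n : (forall v, U v <-> U' v) -> sdim U n -> sdim U' n.
Proof. by move=> e [f [fr sp]]; exists f; split=> // v; rewrite -e. Qed.

Definition fcons V n (x : V) (f : 'I_n -> V) (i : 'I_n.+1) : V :=
  if unlift ord0 i is Some j then f j else x.

Lemma fcons0 V n (x : V) (f : 'I_n -> V) : fcons x f ord0 = x.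
Proof. by rewrite /fcons unlift_none. Qed.
Lemma fconsS V n (x : V) (f : 'I_n -> V) j : fcons x f (lift ord0 j) = f j.
Proof. by rewrite /fcons liftK. Qed.

Lemma comb_subsp V n (f : 'I_n -> V) c x y : comb f x -> comb f y -> comb f (c *: x + y).
Proof.
move=> [a ->] [b ->]; exists (fun i => c * a i + b i).
by rewrite scaler_sumr -big_split; apply: eq_bigr => i _ /=; rewrite scalerDl scalerA.
Qed.

Lemma ffree_cons V n (f : 'I_n -> V) x : ffree f -> ~ comb f x -> ffree (fcons x f).
Proof.
move=> fr nx a; rewrite big_ord_recl fcons0; under eq_bigr do rewrite fconsS.
move=> e; have a0 : a ord0 = 0.
  apply: contrapT => /eqP a0; apply: nx.
  exists (fun i => - (a ord0)^-1 * a (lift ord0 i)).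
  apply: (scalerI a0); rewrite scaler_sumr.
  under eq_bigr do rewrite scalerA mulrA mulrN mulfV // mulN1r scaleNr.
  by rewrite sumrN; apply/eqP; rewrite -addr_eq0 e.
move=> i; case: (unliftP ord0 i) => [j ->|-> //].
move: e; rewrite a0 scale0r add0r => /(fr (fun j => a (lift ord0 j))); exact.
Qed.

(** Dimensions of spaces in a chain are computed one step at a time. *)
Lemma sdim_step V (U U' : subsp V) n x :
  sdim U n -> U' x -> ~ U x -> (forall v, U v -> U' v) ->
  (forall v, U' v -> exists c, U (v - c *: x)) -> sdim U' n.+1.
Proof.
move=> [f [fr sp]] U'x nUx UU' U'U; exists (fcons x f); split.
  by apply: ffree_cons => // /sp.
move=> v; split.
  move=> /U'U [c /sp [a e]]; exists (fun i => if unlift ord0 i is Some j then a j else c).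
  rewrite big_ord_recl fcons0 unlift_none; under eq_bigr do rewrite fconsS liftK.
  by rewrite -e addrC subrK.
move=> [a ->]; apply: subsp_sum => i _; apply: subspZ.
case: (unliftP ord0 i) => [j ->|->]; last by rewrite fcons0.
rewrite fconsS; apply/UU'/sp; exists (fun i => (i == j)%:R).
by rewrite (bigD1 j) //= eqxx scale1r big1 ?addr0 // => i' /negPf ->; rewrite scale0r.
Qed.

Lemma comb_gen V n (f : 'I_n -> V) j : comb f (f j).
Proof.
exists (fun i => (i == j)%:R).
by rewrite (bigD1 j) //= eqxx scale1r big1 ?addr0 // => i' /negPf ->; rewrite scale0r.
Qed.

Program Definition comb_sp V n (f : 'I_n -> V) : subsp V := @Subsp k V (comb f) _ _.
Next Obligation. by move=> V n f; exists (fun=> 0); rewrite big1 // => i _; rewrite scale0r. Qed.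
Next Obligation. by move=> *; apply: comb_subsp. Qed.

Lemma comb_has_basis V n (f : 'I_n -> V) : exists m, sdim (comb_sp f) m.
Proof.
elim: n f => [|n IH] f.
  exists 0%N; apply: sdim_zero => v; split=> [[a ->]|->]; first by rewrite big_ord0.
  exact: (subsp0 (comb_sp f)).
have [m dm] := IH (fun i => f (lift ord0 i)).
have sub v : comb (fun i => f (lift ord0 i)) v -> comb f v.
  move=> [a ->]; apply: (subsp_sum (U := comb_sp f)) => i _; apply: subspZ.
  exact: comb_gen.
have dec v : comb f v -> exists c, comb (fun i => f (lift ord0 i)) (v - c *: f ord0).
  move=> [a ->]; exists (a ord0), (fun i => a (lift ord0 i)).
  by rewrite big_ord_recl addrC addKr.
have [f0|nf0] := pselect (comb (fun i => f (lift ord0 i)) (f ord0)); last first.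
  exists m.+1.
  exact: (@sdim_step V (comb_sp _) (comb_sp f) m (f ord0) dm (comb_gen f ord0) nf0 sub dec).
exists m; apply: sdim_ext dm => v; split=> [/sub //|/dec [c]].
move=> h; have := subspD (U := comb_sp _) h (subspZ (U := comb_sp _) c f0).
by rewrite subrK.
Qed.

(** Quantifying over subspaces instead of coefficients turns proofs about spans into
  closure properties. *)
Definition lspan V (l : seq V) (v : V) : Prop :=
  forall U : subsp V, (forall x, x \in l -> U x) -> U v.

Lemma lspan_fin_dim V (l : seq V) : (forall v, lspan l v) -> fin_dim V.
Proof.
move=> sp; have [m dm] := comb_has_basis (fun i : 'I_(size l) => l`_i).
exists m; apply/sdim_has_dim; apply: sdim_ext dm => v; split=> // _.
apply: sp => x xl; have i : (index x l < size l)%N by rewrite index_mem.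
by have := comb_gen (fun i : 'I_(size l) => l`_i) (Ordinal i); rewrite /= nth_index.
Qed.

Lemma fin_dim_lspan V : fin_dim V -> exists l : seq V, forall v, lspan l v.
Proof.
move=> [n [f [_ sp]]]; exists (codom f) => v U Uf.
by apply: basis_ind sp _ v => t; apply: Uf; apply: codom_f.
Qed.

Lemma fin_dim_surj V W (f : V -> W) : lin f -> (forall w, exists v, f v = w) ->
  fin_dim V -> fin_dim W.
Proof.
move=> fl fs /fin_dim_lspan [l sp]; apply: (@lspan_fin_dim W (map f l)) => w U Uf.
have [v <-] := fs w.
pose U' : subsp V := @Subsp k V (fun v => U (f v))
  (eq_ind_r U (subsp0 U) (lin0 fl))
  (fun c x y Ux Uy => eq_ind_r U (subspL c Ux Uy) (fl c x y)).
by apply: (sp v U') => x xl; apply: Uf; apply: map_f.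
Qed.

Lemma has_dim_iso V W (f : V -> W) n : lin f -> (forall v, f v = 0 -> v = 0) ->
  (forall w, exists v, f v = w) -> has_dim V n -> has_dim W n.
Proof.
move=> fl fi fs /sdim_has_dim [g [fr sp]]; apply/sdim_has_dim.
exists (f \o g); split=> [a|w]; first by rewrite -lin_comb // => /fi; apply: fr.
split=> // _; have [v <-] := fs w; have [a ->] := (sp v).1 I.
by exists a; rewrite lin_comb.
Qed.

Lemma ffree_dim V n m (f : 'I_n -> V) : ffree f -> has_dim V m -> (n <= m)%N.
Proof.
move=> fr /sdim_has_dim [g [_ sp]].
have [M MP] : {M : 'I_n -> 'I_m -> k & forall i, f i = \sum_j M i j *: g j}.
  by apply: (@choice _ _ (fun i a => f i = \sum_j a j *: g j)) => i; apply/sp.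
rewrite leqNgt; apply/negP => mn.
pose N := \matrix_(i, j) M i j.
have : kermx N != 0.
  rewrite kermx_eq0; apply/negP => /eqP rN.
  by have := rank_leq_col N; rewrite rN leqNgt mn.
move/rowV0Pn => [v /sub_kermxP vN].
move/negP; apply; apply/eqP/rowP => i; rewrite mxE.
apply: (fr (fun i => v 0 i)) => {i}.
under eq_bigr do rewrite MP scaler_sumr.
rewrite exchange_big big1 //= => j _.
under eq_bigr do rewrite scalerA.
rewrite -scaler_suml; move/rowP: vN => /(_ j); rewrite !mxE => e.
rewrite (_ : \sum_i _ = 0) ?scale0r // -[RHS]e.
by apply: eq_bigr => i _; rewrite mxE.
Qed.

Lemma separating_form V (v : V) : fin_dim V -> v <> 0 ->
  exists g : V -> k^o, lin g /\ g v <> 0.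
Proof.
move=> [n [f fb]] nv; have [_ sp] := fb.
have [m [c [a ve]]] := sp v.
apply: contrapT => no; apply: nv; rewrite ve.
have z j : \sum_(i | c i == j) a i = 0.
  apply: contrapT => nz; apply: no.
  have [g [gl gP]] := @linear_extension V k^o _ f (fun i => ((i == j)%:R : k)) fb.
  exists g; split=> //; rewrite ve lin_comb //.
  under eq_bigr do rewrite gP.
  rewrite (_ : \sum_i _ = \sum_(i | c i == j) a i) // [RHS]big_mkcond /=.
  by apply: eq_bigr => i _; case: eqP => _; [exact: mulr1 | exact: mulr0].
rewrite (partition_big c xpredT) //= big1 // => j _.
have -> : \sum_(i | c i == j) a i *: f (c i) = (\sum_(i | c i == j) a i) *: f j.
  by rewrite scaler_suml; apply: eq_bigr => i /eqP ->.
by rewrite z scale0r.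
Qed.

Section Represent.
Variables (V W : lmodType k) (b : V -> W -> k^o).
Hypothesis bl : forall w, lin (fun v => b v w).
Hypothesis br : forall v, lin (b v).
Hypothesis bnd : forall v, (forall w, b v w = 0) -> v = 0.

(** Induction on the family: a vector outside the span of the others, corrected by the
  dual vectors already found, still pairs nontrivially with some [w]. *)
Lemma represent_free n (f : 'I_n -> V) (t : 'I_n -> k^o) :
  ffree f -> exists w, forall i, b (f i) w = t i.
Proof.
elim: n f t => [|n IH] f t fr; first by exists 0 => -[].
pose f' i := f (lift ord0 i).
have f0 : ~ comb f' (f ord0).
  move=> [a e]; pose a' i := if unlift ord0 i is Some j then a j else -1.
  have /(_ ord0) : forall i, a' i = 0.
    apply: fr; rewrite big_ord_recl /a' unlift_none scaleN1r.
    by under eq_bigr do rewrite liftK; rewrite -e addNr.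
  by rewrite /a' unlift_none => /eqP; rewrite oppr_eq0 oner_eq0.
have fr' : ffree f'.
  move=> a e; pose a' i := if unlift ord0 i is Some j then a j else 0.
  have a'0 : forall i, a' i = 0.
    apply: fr; rewrite big_ord_recl /a' unlift_none scale0r add0r -[RHS]e.
    by apply: eq_bigr => i _; rewrite liftK.
  by move=> i; have := a'0 (lift ord0 i); rewrite /a' liftK.
have [w wP] : {w : 'I_n -> W & forall j i, b (f' i) (w j) = (i == j)%:R}.
  by apply: (@choice _ _ (fun j w => forall i, b (f' i) w = (i == j)%:R)) => j; apply: IH.
pose v := f ord0 - \sum_i b (f ord0) (w i) *: f' i.
have nv : v <> 0 by move=> /eqP; rewrite subr_eq0 => /eqP e; apply: f0; eexists; exact: e.
have [w0 /eqP nw0] : exists w0, b v w0 <> 0.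
  apply: contrapT => no; apply: nv; apply: bnd => w0.
  by apply: contrapT => nz; apply: no; exists w0.
pose w' := w0 - \sum_i b (f' i) w0 *: w i.
have w'0 i : b (f' i) w' = 0.
  rewrite (linB (br _)) (lin_comb (br _)).
  under eq_bigr do rewrite wP.
  rewrite (bigD1 i) //= eqxx big1 => [|j /negPf]; last by rewrite eq_sym => ->; exact: mulr0.
  by rewrite addr0 [_ *: _]mulr1 subrr.
have w'1 : b (f ord0) w' = b v w0.
  rewrite (linB (br _)) (lin_comb (br _)) (linB (bl _)) (lin_comb (bl _)).
  by congr (_ - _); apply: eq_bigr => i _; apply: mulrC.
have [w1 w1P] := IH f' (fun i => t (lift ord0 i)) fr'.
exists (w1 + ((t ord0 - b (f ord0) w1) / b v w0) *: w') => i.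
rewrite (linD (br _)) (linZ (br _)); case: (unliftP ord0 i) => [j ->|->].
  by rewrite -/(f' j) w1P w'0 scaler0 addr0.
by rewrite w'1 [_ *: _]mulfVK // addrC subrK.
Qed.

(** Linear forms defined on part of a finite-dimensional [V] by their graph [U] are
  represented by any pairing that is nondegenerate on [V]. *)
Lemma represent (U : V -> k -> Prop) : fin_dim V ->
  (forall c v v' x x', U v x -> U v' x' -> U (c *: v + v') (c * x + x')) ->
  (forall x, U 0 x -> x = 0) -> exists w, forall v x, U v x -> b v w = x.
Proof.
move=> fV UL U0.
have [U00|no] := pselect (exists v x, U v x); last first.
  by exists 0 => v x Uv; case: no; exists v, x.
have {}U00 : U 0 0.
  have [v [x Ux]] := U00; have := UL (-1) _ _ _ _ Ux Ux.
  by rewrite scaleN1r mulN1r !addNr.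
have Usum n (a : 'I_n -> k) f x : (forall i, U (f i) (x i)) ->
    U (\sum_i a i *: f i) (\sum_i a i * x i).
  elim: n a f x => [|n IH] a f x h; first by rewrite !big_ord0.
  by rewrite !big_ord_recl; apply: UL => //; apply: IH.
have Uuniq v x y : U v x -> U v y -> x = y.
  move=> Ux Uy; apply/eqP; rewrite -subr_eq0; apply/eqP/U0.
  by have := UL (-1) _ _ _ _ Uy Ux; rewrite scaleN1r mulN1r addNr addrC.
(* any free family of maximal length in the domain of the form spans it *)
pose good n := exists f : 'I_n -> V, ffree f /\ forall i, exists x, U (f i) x.
have [N dN] := fV.
have gN n : `[< good n >] -> (n <= N)%N.
  by move=> /asboolP [f [fr _]]; apply: ffree_dim fr dN.
have g0 : exists n, `[< good n >].
  exists 0%N; apply/asboolP; exists (fun=> 0); split=> [a _ []//|[]//].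
have [n /asboolP [f [fr fU]] nmax] := ex_maxnP g0 gN.
have [x xP] := choice fU.
have [w wP] := represent_free x fr.
exists w => v y Uvy.
have [a ve] : comb f v.
  apply: contrapT => nc; suff /nmax : `[< good n.+1 >] by rewrite ltnn.
  apply/asboolP; exists (fcons v f); split; first exact: ffree_cons.
  by move=> i; case: (unliftP ord0 i) => [j ->|->]; rewrite ?fconsS ?fcons0; [|exists y].
rewrite ve (lin_comb (bl _)); apply: (Uuniq v) => //; rewrite ve.
have -> : \sum_i a i *: b (f i) w = \sum_i a i * x i by apply: eq_bigr => i _; rewrite wP.
exact: Usum.
Qed.

Lemma fin_dim_pairing : fin_dim V -> (forall w, (forall v, b v w = 0) -> w = 0) -> fin_dim W.
Proof.
move=> [n /sdim_has_dim [f [fr sp]]] bnd'.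
have [w wP] : {w : 'I_n -> W & forall j i, b (f i) (w j) = (i == j)%:R}.
  apply: (@choice _ _ (fun j w => forall i, b (f i) w = (i == j)%:R)) => j.
  exact: represent_free.
apply: (@lspan_fin_dim _ (codom w)) => w0 U Uw.
rewrite -[w0](_ : \sum_j b (f j) w0 *: w j = w0).
  by apply: subsp_sum => j _; apply: subspZ; apply: Uw; apply: codom_f.
apply/eqP; rewrite -subr_eq0; apply/eqP/bnd' => v; have [a ->] := (sp v).1 I.
rewrite (lin_comb (bl _)) big1 // => i _.
rewrite (linB (br _)) (lin_comb (br _)).
under eq_bigr do rewrite wP.
rewrite (bigD1 i) //= eqxx big1 => [|j /negPf]; last by rewrite eq_sym => ->; exact: mulr0.
by rewrite addr0 [b (f i) w0 *: _]mulr1 subrr scaler0.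
Qed.

End Represent.

End Linear.

Lemma eigenvector (k : closedFieldType) (V : lmodType k) (f : V -> V) (v0 : V) :
  lin f -> fin_dim V -> v0 <> 0 -> exists c v, v <> 0 /\ f v = c *: v.
Proof.
move=> fl [n /sdim_has_dim [g [fr sp]]] nv0.
have [M MP] : {M : 'I_n -> 'I_n -> k & forall i, f (g i) = \sum_j M i j *: g j}.
  by apply: (@choice _ _ (fun i a => f (g i) = \sum_j a j *: g j)) => i; apply/sp.
pose N := \matrix_(i, j) M i j.
have n0 : (0 < n)%N.
  case: n g fr sp M MP N => // g _ sp *; case: nv0.
  by have [a ->] := (sp v0).1 I; rewrite big_ord0.
have [c] : exists c, root (char_poly N) c.
  by apply/closed_rootP; rewrite size_char_poly; case: (n) n0.
rewrite -eigenvalue_root_char => /eigenvalueP [a aN na].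
exists c, (\sum_i a 0 i *: g i); split.
  move=> /fr a0; move/negP: na; apply; apply/eqP/rowP => i.
  by rewrite mxE -(a0 i).
rewrite lin_comb //; under eq_bigr do rewrite MP scaler_sumr.
rewrite exchange_big scaler_sumr; apply: eq_bigr => j _ /=.
under eq_bigr do rewrite scalerA.
rewrite -scaler_suml scalerA; congr (_ *: _).
move/rowP: aN => /(_ j); rewrite !mxE => <-.
by apply: eq_bigr => i _; rewrite mxE.
Qed.

(** * Graded modules and correspondences *)

(** Transport along an equation between degrees; such equations are propositional for
  integers, so shifts produce components that are equal but not convertible. *)
Definition dcast (k : fieldType) (V : int -> lmodType k) n m (E : n = m) (v : V n) : V m :=
  eq_rect n (fun m => V m : Type) v m E.

Lemma dcast_id (k : fieldType) (V : int -> lmodType k) n (E : n = n) (v : V n) : dcast E v = v.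
Proof. by rewrite (Prop_irrelevance E erefl). Qed.

Section Modules.
Variables (k : fieldType) (I : Type) (A : galg k I).
Implicit Types V W L J : gmod A.

Lemma dcast_lin V i n m (E : n = m) : lin (fun v : V i n => dcast E v).
Proof. by case: m / E. Qed.

Lemma dcast_act V i j c n m n' m' (E : n = m) (E' : n' = m') (H : c + n = n')
    (H' : c + m = m') (a : A i j c) (v : V j n) :
  dcast E' (mact V H a v) = mact V H' a (dcast E v).
Proof. by case: m / E H' => H'; case: m' / E' H' => H'; rewrite (Prop_irrelevance H H'). Qed.

Lemma mact_irr V i j c n m (H H' : c + n = m) (a : A i j c) (v : V j n) :
  mact V H a v = mact V H' a v.
Proof. by rewrite (Prop_irrelevance H H'). Qed.

Lemma mact_lin_l V i j d e f (H : d + e = f) (v : V j e) :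
  lin (fun a : A i j d => mact V H a v).
Proof. by move=> c x y; apply: mact_linl. Qed.

Lemma mact_lin_r V i j d e f (H : d + e = f) (a : A i j d) :
  lin (fun v : V j e => mact V H a v).
Proof. by move=> c x y; apply: mact_linr. Qed.

Lemma hfun_linear V W d (f : ghom V W d) i n m (H : n + d = m) :
  lin (fun v : V i n => hfun f H v).
Proof. by move=> c x y; apply: hfun_lin. Qed.

Lemma hfunE V W d (f : ghom V W d) i n m (H : n + d = m) (v : V i n) :
  hfun f H v = dcast H (hfun f erefl v).
Proof. by case: m / H. Qed.

Lemma hfun_irr V W d (f : ghom V W d) i n m (H H' : n + d = m) (v : V i n) :
  hfun f H v = hfun f H' v.
Proof. by rewrite (Prop_irrelevance H H'). Qed.

Lemma mfun_lin V W (f : mor V W) i n : lin (fun v : V i n => mfun f v).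
Proof. exact: hfun_linear. Qed.

Lemma mfun0 V W (f : mor V W) i n : mfun f (0 : V i n) = 0.
Proof. exact: (lin0 (mfun_lin f (i := i) (n := n))). Qed.

Lemma mfun_act V W (f : mor V W) i j c n m (H : c + n = m) (a : A i j c) (v : V j n) :
  mfun f (mact V H a v) = mact W H a (mfun f v).
Proof. exact: hfun_act. Qed.

Lemma mor0E V W (f : mor V W) i n m (H : n + 0 = m) (E : n = m) (v : V i n) :
  hfun f H v = dcast E (mfun f v).
Proof. by case: m / E H => H; apply: hfun_irr. Qed.

Program Definition ghom_of V W d (phi : forall i n, V i n -> W i (n + d))
    (phil : forall i n, lin (phi i n))
    (phia : forall i j c n n' (H : c + n = n') (H' : c + (n + d) = n' + d)
       (a : A i j c) (v : V j n), phi i n' (mact V H a v) = mact W H' a (phi j n v)) :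
    ghom V W d :=
  @GHom _ _ _ V W d (fun i n m H v => dcast H (phi i n v)) _ _.
Next Obligation. by move=> V W d phi phil phia i n m H c x y /=; rewrite phil dcast_lin. Qed.
Next Obligation.
move=> V W d phi phil phia i j c n m n' m' H1 H2 H3 H4 a v.
have H5 : c + (n + d) = n' + d by rewrite addrA H1.
by rewrite /= (phia _ _ _ _ _ H1 H5); apply: dcast_act.
Qed.

Program Definition mor_of V W (phi : forall i n, V i n -> W i n)
    (phil : forall i n, lin (phi i n))
    (phia : forall i j c n n' (H : c + n = n')
       (a : A i j c) (v : V j n), phi i n' (mact V H a v) = mact W H a (phi j n v)) :
    mor V W :=
  @GHom _ _ _ V W 0 (fun i n m H v => dcast (etrans (esym (addr0 n)) H) (phi i n v)) _ _.
Next Obligation. by move=> V W phi phil phia i n m H c x y /=; rewrite phil dcast_lin. Qed.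
Next Obligation.
move=> V W phi phil phia i j c n m n' m' H1 H2 H3 H4 a v.
by rewrite /= (phia _ _ _ _ _ H1); apply: dcast_act.
Qed.

Lemma mor_ofE V W phi phil phia i n (v : V i n) :
  mfun (@mor_of V W phi phil phia) v = phi i n v.
Proof. exact: dcast_id. Qed.

(** Graphs instead of functions: a map defined on generators, on a submodule or on a
  section is easily described by its graph, and only the graph over 0 must be checked
  for it to be a function. *)
Record gcorr V W (R : forall i n, V i n -> W i n -> Prop) : Prop := GCorr {
  gcorr0 : forall i n, R i n 0 0;
  gcorrL : forall i n c v v' w w', R i n v w -> R i n v' w' ->
    R i n (c *: v + v') (c *: w + w');
  gcorrA : forall i j c n m (H : c + n = m) (a : A i j c) v w, R j n v w ->
    R i m (mact V H a v) (mact W H a w) }.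

Lemma gcorr_fun V W (R : forall i n, V i n -> W i n -> Prop) :
  gcorr R -> (forall i n w, R i n 0 w -> w = 0) ->
  forall i n v w w', R i n v w -> R i n v w' -> w = w'.
Proof.
move=> gR R0 i n v w w' Rw Rw'; apply/eqP; rewrite -subr_eq0; apply/eqP; apply: (R0 i n).
by have := gcorrL gR (-1) Rw' Rw; rewrite !scaleN1r addNr addrC.
Qed.

(** The relation is the composite of the projection U' -> U'/U with an isomorphism from
  U'/U to [W]; this avoids representatives of classes. *)
Definition sect_iso V (U' U : gsubmod V) W : Prop :=
  exists R : forall i n, V i n -> W i n -> Prop,
    [/\ gcorr R, forall i n v, smset U' v <-> exists w, R i n v w,
        forall i n v w, R i n v w -> (smset U v <-> w = 0) &
        forall i n w, exists v, R i n v w].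

Lemma gsection_iso V (U' U : gsubmod V) W : sm_le U U' ->
  giso (gsection U' U) W <-> sect_iso U' U W.
Proof.
move=> UU'; split.
  move=> [f [fi fs]].
  pose p i n (v : V i n) (Uv : smset U' v) : gsection U' U i n := lpi _ (lsub_in Uv).
  exists (fun i n v w => exists Uv : smset U' v, mfun f (p i n v Uv) = w).
  have plin i n c (v v' : V i n) (Uv : smset U' v) (Uv' : smset U' v')
      (Uvv : smset U' (c *: v + v')) : p _ _ _ Uvv = c *: p _ _ _ Uv + p _ _ _ Uv'.
    rewrite /p -lpiL; congr lpi; apply: lsub_inj.
    by rewrite lsub_valD lsub_valZ.
  have p0 i n (v : V i n) (Uv : smset U' v) : p _ _ _ Uv = 0 <-> smset U v.
    have -> : (p _ _ _ Uv = 0) = (p _ _ _ Uv = lpi _ 0) by [].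
    rewrite lpiP subr0; split=> h; exact: h.
  split.
  - split.
    + move=> i n; exists (subsp0 _); rewrite (p0 _ _ _ _).2 ?mfun0 //; exact: subsp0.
    + move=> i n c v v' w w' [Uv <-] [Uv' <-]; exists (subspL c Uv Uv').
      by rewrite (plin _ _ _ _ _ Uv Uv') (mfun_lin f).
    + move=> i j c n m H a v w [Uv <-]; exists (sm_act H a Uv).
      rewrite -mfun_act; congr mfun; apply/lpiP.
      have E : smset U (mact V H a v - mact V H a (val (lrepr (p _ _ _ Uv)))).
        rewrite -(linB (mact_lin_r _ _)); apply: sm_act.
        have := lrepr_pi (smset (sm_pull U U')) (lsub_in Uv).
        by move/subspN; rewrite opprB; apply.
      exact: E.
  - by move=> i n v; split=> [Uv|[w [Uv _]] //]; exists (mfun f (p _ _ _ Uv)), Uv.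
  - move=> i n v w [Uv <-]; rewrite -(p0 _ _ _ Uv); split=> [->|/fi //]; exact: mfun0.
  - move=> i n w; have [x <-] := fs i n w.
    exists (val (lrepr x)), (lsub_valP (lrepr x)); congr mfun; rewrite /p.
    rewrite -[RHS]lreprK; congr lpi; exact: lsub_inj.
move=> [R [gR Rd Rk Rs]].
have R0 i n w : R i n 0 w -> w = 0 by move/Rk => <-; apply: subsp0.
have ex i n (x : gsection U' U i n) : exists w, R i n (val (lrepr x)) w.
  exact: ((Rd _ _ _).1 (lsub_valP (lrepr x))).
pose phi i n x : W i n := projT1 (cid (ex i n x)).
have phiP i n x v w : lpi (smset (sm_pull U U')) v = x -> R i n (val v) w -> phi i n x = w.
  move=> <- Rw; rewrite /phi; case: cid => w' Rw' /=; apply/eqP; rewrite -subr_eq0.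
  have Rd' := gcorrL gR (-1) Rw Rw'; apply/eqP; move: Rd'; rewrite !scaleN1r [- w + _]addrC.
  move/Rk => <-; rewrite addrC.
  have := lrepr_pi (smset (sm_pull U U')) v; exact.
have phiR i n x : exists v, lpi (smset (sm_pull U U')) v = x /\ R i n (val v) (phi i n x).
  by exists (lrepr x); rewrite lreprK; split=> //; rewrite /phi; case: cid.
have phil i n : lin (phi i n).
  move=> c x y; have [v [vx Rv]] := phiR i n x; have [v' [vy Rv']] := phiR i n y.
  apply: (phiP _ _ _ (c *: v + v')); first by rewrite lpiL vx vy.
  have := gcorrL gR c Rv Rv'; rewrite lsub_valD lsub_valZ; exact.
have phia i j c n n' (H : c + n = n') (a : A i j c) x :
    phi i n' (mact (gsection U' U) H a x) = mact W H a (phi j n x).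
  have [v [vx Rv]] := phiR j n x.
  apply: (phiP _ _ _ (mact (gsub U') H a v)); last exact: gcorrA.
  apply/lpiP; rewrite -vx.
  have E : smset U (mact V H a (val v) - mact V H a (val (lrepr (lpi (smset (sm_pull U U')) v)))).
    rewrite -(linB (mact_lin_r _ _)); apply: sm_act.
    have := lrepr_pi (smset (sm_pull U U')) v.
    by move/subspN; rewrite opprB; apply.
  exact: E.
exists (mor_of phil phia); split=> [i n x|i n w].
  rewrite mor_ofE; have [v [<- Rv]] := phiR i n x => e; move: Rv; rewrite e => /Rk [_ /(_ erefl) Uv].
  rewrite -[RHS]/(lpi _ 0); apply/lpiP; rewrite subr0; exact: Uv.
have [v Rv] := Rs i n w; have Uv : smset U' v by apply/Rd; exists w.
by exists (lpi _ (lsub_in Uv)); rewrite mor_ofE; apply: (phiP _ _ _ (lsub_in Uv)) => //; exact: Rv.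
Qed.

(** The domain of the relation is a submodule [U] of [V], and the relation is the graph
  of a map of degree 0 from q^d U; injectivity extends it along q^d U -> q^d V. *)
Lemma injective_extend J V d (R : forall i n, V i n -> J i (n + d) -> Prop) :
  injective_mod J ->
  (forall i n, R i n 0 0) ->
  (forall i n c v v' w w', R i n v w -> R i n v' w' -> R i n (c *: v + v') (c *: w + w')) ->
  (forall i j c n m (H : c + n = m) (H' : c + (n + d) = m + d) (a : A i j c) v w,
     R j n v w -> R i m (mact V H a v) (mact J H' a w)) ->
  (forall i n w, R i n 0 w -> w = 0) ->
  exists f : ghom V J d, forall i n v w, R i n v w -> hfun f erefl v = w.
Proof.
move=> inj R00 RL RA R0.
have Rfun i n v w w' : R i n v w -> R i n v w' -> w = w'.
  move=> Rw Rw'; apply/eqP; rewrite -subr_eq0; apply/eqP; apply: (R0 i n).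
  by have := RL _ _ (-1) _ _ _ _ Rw' Rw; rewrite !scaleN1r addNr addrC.
pose US i n : subsp (V i n) := @Subsp k _ (fun v => exists w, R i n v w)
  (ex_intro _ 0 (R00 i n))
  (fun c x y '(ex_intro w Rw) '(ex_intro w' Rw') => ex_intro _ _ (RL i n c _ _ _ _ Rw Rw')).
have USa i j c n m (H : c + n = m) (a : A i j c) v : US j n v -> US i m (mact V H a v).
  have H' : c + (n + d) = m + d by rewrite addrA H.
  by move=> [w Rw]; exists (mact J H' a w); apply: RA.
pose U : gsubmod V := @GSubmod _ _ _ V US USa.
have cw i n (u : gsub U i n) : {w | R i n (val u) w}.
  by apply/cid; exact: (lsub_valP u).
pose ch i n u := sval (cw i n u).
have chP i n (u : gsub U i n) w : R i n (val u) w -> ch i n u = w.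
  by move=> Rw; apply: Rfun Rw; rewrite /ch; case: (cw i n u).
have chR i n (u : gsub U i n) : R i n (val u) (ch i n u).
  by rewrite /ch; case: (cw i n u).
pose phi i n (u : gshift d (gsub U) i n) : J i n := dcast (subrK d n) (ch i (n - d) u).
have phil i n : lin (phi i n).
  move=> c x y; rewrite /phi -dcast_lin; congr dcast; apply: chP.
  have E := RL _ _ c _ _ _ _ (chR _ _ x) (chR _ _ y).
  have -> : val (c *: x + y) = c *: val x + val y by rewrite lsub_valD lsub_valZ.
  exact: E.
have phia i j c n n' (H : c + n = n') (a : A i j c) u :
    phi i n' (mact (gshift d (gsub U)) H a u) = mact J H a (phi j n u).
  have H' : c + (n - d + d) = n' - d + d by rewrite !subrK.
  rewrite /phi (chP _ _ _ (mact J H' a (ch _ _ u))); first exact: dcast_act.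
  by apply: RA; apply: chR.
pose psi i n (u : gshift d (gsub U) i n) : gshift d V i n := val u.
have psil i n : lin (psi i n) by move=> c x y; rewrite /psi lsub_valD lsub_valZ.
have psia i j c n n' (H : c + n = n') (a : A i j c) u :
  psi i n' (mact (gshift d (gsub U)) H a u) = mact (gshift d V) H a (psi j n u) by [].
have psiI : mor_inj (mor_of psil psia).
  by move=> i n u; rewrite mor_ofE => e; apply: lsub_inj; rewrite lsub_val0.
have [h hP] := inj _ _ _ (mor_of phil phia) psiI.
have E n : n = n + d - d by rewrite addrK.
pose chi i n (v : V i n) : J i (n + d) := mfun h (dcast (E n) v : gshift d V i (n + d)).
have chil i n : lin (chi i n).
  by move=> c x y; rewrite /chi dcast_lin (mfun_lin h (i := i) (n := n + d)).
have chia i j c n n' (H : c + n = n') (H' : c + (n + d) = n' + d) (a : A i j c) v :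
    chi i n' (mact V H a v) = mact J H' a (chi j n v).
  rewrite /chi -mfun_act; congr mfun.
  exact: (dcast_act (E n) (E n') H (gshift_deg d H') a v).
exists (ghom_of chil chia) => i n v w Rw /=.
have Uv : smset U v by exists w.
pose u : gsub U i n := lsub_in Uv.
have Eu m (e : n = m) : dcast e v = val (dcast e u) by case: m / e.
rewrite /chi Eu -[val _]/(psi _ _ _) -(mor_ofE psil psia) hP mor_ofE /phi.
have Q m (e : n = m) p (e2 : m + d = p) (e3 : n + d = p) :
    dcast e2 (ch i m (dcast e u)) = dcast e3 (ch i n u).
  by case: m / e e2 => e2; rewrite (Prop_irrelevance e2 e3).
by rewrite (Q _ _ _ _ erefl) /= (chP _ _ _ w).
Qed.

Program Definition cyclic_sub V i n (v : V i n) : gsubmod V :=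
  @GSubmod _ _ _ V (fun j m => @Subsp k _
    (fun w => exists a : A j i (m - n), mact V (subrK n m) a v = w) _ _) _.
Next Obligation. by move=> V i n v j m; exists 0; rewrite mact0l. Qed.
Next Obligation.
by move=> V i n v j m c _ _ [a <-] [b <-]; exists (c *: a + b); rewrite mact_linl.
Qed.
Next Obligation.
move=> V i n v l j c m m' H b _ [a <-].
have H' : c + (m - n) = m' - n by rewrite addrA H.
by exists (gmul A H' b a); apply: mactA.
Qed.

Lemma cyclic_sub_self V i n (v : V i n) : smset (cyclic_sub v) v.
Proof.
have E : 0 = n - n by rewrite subrr.
exists (dcast E (gone A i) : A i i (n - n)).
have Q m (e : 0 = m) (H : m + n = n) : mact V H (dcast e (gone A i) : A i i m) v = v.
  by case: m / e H => H; apply: mact1.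
exact: Q.
Qed.

(** Irreducibility and essential extensions in terms of elements: these forms are
  evidently invariant under degree shifts. *)
Definition irr_elt L : Prop :=
  (exists i n (v : L i n), v <> 0) /\
  forall i n (v : L i n), v <> 0 -> forall j m (w : L j m),
    exists d (H : d + n = m) (a : A j i d), mact L H a v = w.

Lemma irreducible_elt L : irreducible L -> irr_elt L.
Proof.
move=> [nz irr]; split=> // i n v nv j m w.
case: (irr (cyclic_sub v)) => [/(_ _ _ v (cyclic_sub_self v)) //|full].
by have [a <-] := full j m w; exists (m - n), (subrK n m), a.
Qed.

Definition ess_elt L J (iota : mor L J) : Prop :=
  forall i n (w : J i n), w <> 0 -> exists j m d (H : d + n = m) (a : A j i d) (l : L j m),
    l <> 0 /\ mact J H a w = mfun iota l.

Lemma hull_elt J L : injective_hull J L ->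
  exists iota : mor L J, mor_inj iota /\ ess_elt iota.
Proof.
move=> [_ [f [fi ess]]]; exists f; split=> // i n w nw.
apply: contrapT => no; apply: nw.
apply: (ess (cyclic_sub w)) (cyclic_sub_self w) => j m l [a e].
by apply: contrapT => nl; apply: no; exists j, m, (m - n), (subrK n m), a, l.
Qed.

(** An irreducible module is cyclic, hence a quotient of a shift of some A 1_i. *)
Lemma irr_locally_findim L : irr_elt L -> alg_locally_findim A -> mod_locally_findim L.
Proof.
move=> [[i [n [v nv]]] irr] Af j m.
apply: (fin_dim_surj (f := fun a : A j i (m - n) => mact L (subrK n m) a v)) (Af _ _ _).
  exact: mact_lin_l.
move=> w; have [d [H [a <-]]] := irr i n v nv j m w.
have E : d = m - n by rewrite -H addrK.
by subst d; exists a; apply: mact_irr.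
Qed.

End Modules.

Arguments dcast_lin {k I A} V i {n m} E c x y.
Arguments mact_lin_l {k I A} V {i j d e f} H v c x y.
Arguments mact_lin_r {k I A} V {i j d e f} H a c x y.
Arguments hfun_linear {k I A V W d} f i {n m} H c x y.
Arguments mfun_lin {k I A V W} f i n c x y.

(** * Multiplicities as dimensions of spaces of maps to an injective hull *)

Section Counting.
Variables (k : fieldType) (I : Type) (A : galg k I).
Implicit Types V W L J : gmod A.

Definition iso_count V L n (F : nat -> gsubmod V) : nat :=
  \sum_(r < n) (`[< giso (gsection (F r) (F r.+1)) L >] : nat).

Lemma section_countE V L d n (F : nat -> gsubmod V) :
  section_count L d n F = iso_count (gshift d L) n F.
Proof.
rewrite /section_count -sum1_card big_mkcond /=; apply: eq_bigr => i _.
by rewrite unfold_in; case: `[< _ >].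
Qed.

Lemma iso_countS V L n (F : nat -> gsubmod V) :
  iso_count L n.+1 F =
  (`[< giso (gsection (F 0%N) (F 1%N)) L >] + iso_count L n (fun r => F r.+1))%N.
Proof. by rewrite /iso_count big_ord_recl. Qed.

Definition descending V n (F : nat -> gsubmod V) : Prop :=
  forall r, (r < n)%N -> sm_le (F r.+1) (F r).

Lemma descendingS V n (F : nat -> gsubmod V) :
  descending n.+1 F -> descending n (fun r => F r.+1).
Proof. by move=> d r rn; apply: d. Qed.

(** Choose a preimage of [l] in each section isomorphic to [L]: such vectors are
  independent, since each lies in a term of the filtration but not in the next one. *)
Lemma iso_count_free V L i d (l : L i d) n (F : nat -> gsubmod V) :
  l <> 0 -> descending n F ->
  exists f : 'I_(iso_count L n F) -> V i d, ffree f /\ forall j, smset (F 0%N) (f j).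
Proof.
move=> nl; elim: n F => [|n IH] F dF.
  rewrite /iso_count big_ord0; exists (fun=> 0); split=> [a _ []//|j]; exact: subsp0.
have [f [fr fF]] := IH _ (descendingS dF).
have F10 : sm_le (F 1%N) (F 0%N) by apply: dF.
rewrite iso_countS; case: asboolP => [/(gsection_iso _ F10) [R [gR Rd Rk Rs]]|_]; last first.
  by exists f; split=> // j; apply: F10.
have [v Rv] := Rs _ _ l; have F0v : smset (F 0%N) v by apply/Rd; exists l.
exists (fcons v f); split.
  apply: ffree_cons => // -[a e]; apply: nl; apply/(Rk _ _ _ _ Rv); rewrite e.
  by apply: subsp_sum => j _; apply: subspZ; apply: fF.
move=> j; case: (unliftP ord0 j) => [j' ->|->]; rewrite ?fcons0 ?fconsS //.
exact: F10.
Qed.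

Lemma iso_count_bound V L i d (l : L i d) N n (F : nat -> gsubmod V) :
  l <> 0 -> has_dim (V i d) N -> descending n F -> (iso_count L n F <= N)%N.
Proof.
move=> nl dV dF; have [f [fr _]] := iso_count_free nl dF.
exact: ffree_dim fr dV.
Qed.

(** Inserting a pair of submodules whose section is [L] inside a section that is not [L]
  increases the count; the two remaining pieces can only add to it. *)
Lemma iso_count_refine V L m n (F : nat -> gsubmod V) (U1 U2 : gsubmod V) :
  (m < n)%N -> descending n F -> sm_le (F m.+1) U2 -> sm_le U2 U1 -> sm_le U1 (F m) ->
  giso (gsection U1 U2) L -> ~ giso (gsection (F m) (F m.+1)) L ->
  exists n' F', [/\ F' 0%N = F 0%N, F' n' = F n, descending n' F' &
    (iso_count L n F < iso_count L n' F')%N].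
Proof.
move=> + + + U21 + iU + ; elim: m n F => [|m IH] [//|n] F mn dF h1 h2 h3.
  pose F' r := match r with 0%N => F 0%N | 1%N => U1 | 2%N => U2 | r'.+3 => F r'.+1 end.
  exists n.+3, F'; split=> //; first by move=> [|[|[|r]]] //= rn; apply: dF.
  rewrite !iso_countS /= (asboolF h3) (asboolT iU) add0n.
  by rewrite addnCA add1n ltnS addnA leq_addl.
have [n' [F' [e0 en d lt]]] := IH n (fun r => F r.+1) mn (descendingS dF) h1 h2 h3.
exists n'.+1, (fun r => if r is r'.+1 then F' r' else F 0%N); split=> //.
  by move=> [|r] rn; [rewrite e0; apply: dF | apply: d].
by rewrite !iso_countS /= e0 ltn_add2l.
Qed.

End Counting.

Section Multiplicity.
Variables (k : closedFieldType) (I : Type) (A : galg k I).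
Variables (V L J : gmod A) (iota : mor L J).
Hypothesis irrL : irr_elt L.
Hypothesis finL : mod_locally_findim L.
Hypothesis finV : mod_locally_findim V.
Hypothesis iota_inj : mor_inj iota.
Hypothesis iota_ess : ess_elt iota.
Hypothesis extJ : forall R : forall i n, V i n -> J i n -> Prop, gcorr R ->
  (forall i n w, R i n 0 w -> w = 0) ->
  exists f : mor V J, forall i n v w, R i n v w -> mfun f v = w.

(** Schur's lemma: since [iota] is essential and [L] irreducible, the map takes values in
  the image of [iota]; it therefore acts on a finite-dimensional component of [L], and an
  eigenvector there generates [L]. *)
Lemma socle_schur (T : forall i n, L i n -> J i n -> Prop) : gcorr T ->
  (forall i n w, T i n 0 w -> w = 0) -> (forall i n l, exists w, T i n l w) ->
  exists c, forall i n l w, T i n l w -> w = c *: mfun iota l.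
Proof.
move=> gT T0 Tt; have Tfun := gcorr_fun gT T0.
have [Tz|] := pselect (forall i n l w, T i n l w -> w = 0).
  by exists 0 => i n l w /Tz ->; rewrite scale0r.
move=> /existsNP [i1 /existsNP [n1 /existsNP [l1 /existsNP [w1]]]] /not_implyP [Tw1 nw1].
have [i2 [n2 [d [H [a [l2 [nl2 e2]]]]]]] := iota_ess nw1.
have T2 : T _ _ (mact L H a l1) (mfun iota l2) by rewrite -e2; apply: gcorrA.
have nl : mact L H a l1 <> 0.
  by move=> e; apply: nl2; apply: iota_inj; move: T2; rewrite e => /T0.
have Tio i n (l : L i n) : exists l', T i n l (mfun iota l').
  have [d' [H' [b <-]]] := irrL.2 _ _ _ nl i n l.
  by exists (mact L H' b l2); rewrite mfun_act; apply: gcorrA.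
have [[i [n [l nl0]]] _] := irrL.
have [f fP] := choice (Tio i n).
have fl : lin f.
  move=> c x y; apply/eqP; rewrite -subr_eq0; apply/eqP; apply: iota_inj.
  rewrite (linB (mfun_lin iota i n)) (mfun_lin iota i n); apply/eqP; rewrite subr_eq0; apply/eqP.
  by apply: Tfun (fP _) _; apply: gcorrL.
have [c [u [nu fu]]] := eigenvector fl (finL i n) nl0.
exists c => j m l' w Tw; have [d' [H' [b lb]]] := irrL.2 _ _ _ nu j m l'.
apply: Tfun Tw _; rewrite -lb mfun_act -(linZ (mact_lin_r _ _ _)) -(linZ (mfun_lin iota _ _)) -fu.
exact: gcorrA.
Qed.

Program Definition killers (U : gsubmod V) : subsp (ghom V J 0) :=
  @Subsp k (ghom V J 0) (fun f => forall i n (v : V i n), smset U v -> mfun f v = 0) _ _.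
Next Obligation. by []. Qed.
Next Obligation.
move=> U c f g hf hg i n v Uv.
have E : c *: mfun f v + mfun g v = 0 by rewrite hf // hg // scaler0 addr0.
exact: E.
Qed.

Lemma killers_sub U f g c : (forall i n (v : V i n), smset U v ->
  mfun f v = c *: mfun g v) -> killers U (f - c *: g).
Proof.
move=> h i n v Uv.
have E : mfun f v - c *: mfun g v = 0 by rewrite h // subrr.
have Q : (-1 : k) *: (c *: mfun g v) = - (c *: mfun g v) by rewrite scaleN1r.
rewrite -E -Q; reflexivity.
Qed.

(** Injectivity supplies a map that is [iota] on the section, and by [socle_schur] every
  other one is a multiple of it modulo maps that vanish on U'. *)
Lemma killers_step U' U n : sm_le U U' -> giso (gsection U' U) L ->
  sdim (killers U') n -> sdim (killers U) n.+1.
Proof.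
move=> UU' /(gsection_iso _ UU') [R [gR Rd Rk Rs]] dU'.
pose R' i n (v : V i n) (w : J i n) := exists2 l, R i n v l & w = mfun iota l.
have [|i0 m0 w [l Rl ->]|f fP] := @extJ R'.
- split=> [i m|i m c v v' w w' [l Rl ->] [l' Rl' ->]|i j c m m' H a v w [l Rl ->]].
  + by exists 0; [apply: gcorr0 | rewrite mfun0].
  + by exists (c *: l + l'); [apply: gcorrL | rewrite (mfun_lin iota)].
  + by exists (mact L H a l); [apply: gcorrA | rewrite mfun_act].
- by move/Rk: Rl => [-> //]; rewrite ?mfun0 //; apply: subsp0.
have fR i m v l : R i m v l -> mfun f v = mfun iota l by move=> Rl; apply: fP; exists l.
have [[i [m [l nl]]] _] := irrL; have [v Rl] := Rs _ _ l.
have U'v : smset U' v by apply/Rd; exists l.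
have graph g : killers U g -> exists c, forall i m v l, R i m v l -> mfun g v = c *: mfun iota l.
  move=> gU; pose T i n (l : L i n) (w : J i n) := exists2 v, R i n v l & w = mfun g v.
  have [|||c cP] := @socle_schur T.
  - split=> [j p|j p c x x' w w' [y Ry ->] [y' Ry' ->]|j j' c p p' H a x w [y Ry ->]].
    + by exists 0; [apply: gcorr0 | rewrite mfun0].
    + by exists (c *: y + y'); [apply: gcorrL | rewrite (mfun_lin g)].
    + by exists (mact V H a y); [apply: gcorrA | rewrite mfun_act].
  - by move=> j p w [y Ry ->]; apply: gU; apply/(Rk _ _ _ _ Ry).
  - by move=> j p x; have [y Ry] := Rs j p x; exists (mfun g y), y.
  by exists c => j p y x Rx; apply: cP; exists y.
have fU : killers U f.
  by move=> j p y Uy; have /Rd [x Rx] := UU' _ _ _ Uy; rewrite (fR _ _ _ _ Rx) ((Rk _ _ _ _ Rx).1 Uy) mfun0.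
apply: sdim_step dU' fU _ _ _.
- by move=> /(_ _ _ _ U'v); rewrite (fR _ _ _ _ Rl) => /iota_inj.
- by move=> g gU' j p y /UU'; apply: gU'.
move=> g gU; have [c cP] := graph g gU; exists c; apply: killers_sub.
by move=> j p y /Rd [x Rx]; rewrite (cP _ _ _ _ Rx) (fR _ _ _ _ Rx).
Qed.

(** The image of U' under [f] is a nonzero submodule of [J], so it contains the socle;
  take the preimage of the socle and the kernel of [f] inside U'. *)
Lemma killers_refine U' U (f : mor V J) : sm_le U U' -> killers U f -> ~ killers U' f ->
  exists U1 U2 : gsubmod V, [/\ sm_le U U2, sm_le U2 U1, sm_le U1 U' & giso (gsection U1 U2) L].
Proof.
move=> UU' fU nf.
have [i1 [n1 [v1 [U'v1 nv1]]]] : exists i n v, smset U' (v : V i n) /\ mfun f v <> 0.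
  apply: contrapT => no; apply: nf => i n v U'v; apply: contrapT => nv; apply: no.
  by exists i, n, v.
pose s1 i n : subsp (V i n) := @Subsp k _
  (fun v => smset U' v /\ exists l, mfun f v = mfun iota l)
  (conj (subsp0 _) (ex_intro _ 0 (etrans (mfun0 f i n) (esym (mfun0 iota i n)))))
  (fun c x y '(conj U'x (ex_intro l e)) '(conj U'y (ex_intro l' e')) =>
    conj (subspL c U'x U'y) (ex_intro _ (c *: l + l')
      (etrans (mfun_lin f i n c x y) (etrans (f_equal2 (fun a b => c *: a + b) e e')
         (esym (mfun_lin iota i n c l l')))))).
pose s2 i n : subsp (V i n) := @Subsp k _
  (fun v => smset U' v /\ mfun f v = 0)
  (conj (subsp0 _) (mfun0 f i n))
  (fun c x y '(conj U'x e) '(conj U'y e') =>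
    conj (subspL c U'x U'y)
      (etrans (mfun_lin f i n c x y) (etrans (f_equal2 (fun a b => c *: a + b) e e')
         (etrans (addr0 _) (scaler0 _ c))))).
have a1 i j d e g (H : d + e = g) (a : A i j d) (v : V j e) : s1 _ _ v -> s1 _ _ (mact V H a v).
  by move=> [U'v [l fl]]; split; [apply: sm_act | exists (mact L H a l); rewrite !mfun_act fl].
have a2 i j d e g (H : d + e = g) (a : A i j d) (v : V j e) : s2 _ _ v -> s2 _ _ (mact V H a v).
  by move=> [U'v fv]; split; [apply: sm_act | rewrite mfun_act fv mact0r].
exists (@GSubmod _ _ _ V s1 a1), (@GSubmod _ _ _ V s2 a2).
have s21 : sm_le (@GSubmod _ _ _ V s2 a2) (@GSubmod _ _ _ V s1 a1).
  by move=> i n v [U'v fv]; split=> //; exists 0; rewrite mfun0.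
split=> //; first by move=> i n v Uv; split; [apply: UU' | apply: fU].
  by move=> i n v [].
apply/(gsection_iso _ s21); exists (fun i n v l => smset U' v /\ mfun f v = mfun iota l); split.
- split=> [i n|i n c v v' w w' [Uv e] [Uv' e']|i j c n m H a v w [Uv e]].
  + by split; [apply: subsp0 | rewrite !mfun0].
  + by split; [apply: subspL | rewrite (mfun_lin f) (mfun_lin iota) e e'].
  + by split; [apply: sm_act | rewrite !mfun_act e].
- by move=> i n v; split=> [[Uv [l e]]|[l [Uv e]]]; [exists l | split=> //; exists l].
- move=> i n v l [Uv e]; split=> [[_]|l0]; first by rewrite e => /iota_inj.
  by split=> //; rewrite e l0 mfun0.
move=> i n l; have [j [m [d [H [a [l1 [nl1 e1]]]]]]] := iota_ess nv1.
have [d' [H' [b <-]]] := irrL.2 _ _ _ nl1 i n l.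
exists (mact V H' b (mact V H a v1)); split; first by do 2!apply: sm_act.
by rewrite !mfun_act e1.
Qed.

Program Definition sm_full : gsubmod V := @GSubmod _ _ _ V
  (fun i n => @Subsp k _ (fun=> True) _ _) _.
Next Obligation. by []. Qed.
Next Obligation. by []. Qed.
Next Obligation. by []. Qed.

Program Definition sm_zero : gsubmod V := @GSubmod _ _ _ V
  (fun i n => @Subsp k _ (fun v => v = 0) _ _) _.
Next Obligation. by []. Qed.
Next Obligation. by move=> i n c x y -> ->; rewrite scaler0 addr0. Qed.
Next Obligation. by move=> i j d e f H a v ->; apply: mact0r. Qed.

(** Along a filtration with the largest number of sections [L], the space of maps that
  vanish on the successive terms grows by one exactly at these sections. *)
Theorem multiplicity_hom : exists c, has_dim (ghom V J 0) c /\
  (exists n F, filtration n F /\ iso_count (V := V) L n F = c) /\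
  (forall n F, filtration n F -> (iso_count (V := V) L n F <= c)%N).
Proof.
have [[i0 [n0 [l0 nl0]]] _] := irrL.
have [N dN] := finV i0 n0.
pose good c := exists n F, filtration n F /\ iso_count (V := V) L n F = c.
have gN c : `[< good c >] -> (c <= N)%N.
  by move=> /asboolP [n [F [[_ _ dF] <-]]]; apply: iso_count_bound nl0 dN dF.
have g0 : exists c, `[< good c >].
  exists (iso_count L 1 (fun r => if r is 0%N then sm_full else sm_zero)).
  by apply/asboolP; exists 1%N, (fun r => if r is 0%N then sm_full else sm_zero); split=> //;
    split=> // -[|r].
have [c /asboolP [n [F [filF <-]]] cmax] := ex_maxnP g0 gN.
exists (iso_count L n F); split; last split; first last.
- by move=> n' F' fil'; apply: cmax; apply/asboolP; exists n', F'.
- by exists n, F.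
have [F0 Fn dF] := filF.
have key m : (m <= n)%N -> sdim (killers (F m)) (iso_count L m F).
  elim: m => [_|m IH mn].
    rewrite /iso_count big_ord0; apply: sdim_zero => f; split=> [h|-> //].
    apply: ghom_ext => i p q H v; rewrite (mor0E f H (etrans (esym (addr0 p)) H)) h //.
    by rewrite (lin0 (dcast_lin _ _ _)).
  have dm := IH (ltnW mn); rewrite /iso_count big_ord_recr /= -/(iso_count L m F).
  case: asboolP => [iU|niU]; first by rewrite addn1; apply: killers_step dm => //; apply: dF.
  rewrite addn0; apply: sdim_ext dm => f; split=> [h i p v Fv|h].
    by apply: h; apply: dF Fv.
  apply: contrapT => nh.
  have [U1 [U2 [s1 s2 s3 iU]]] := killers_refine (dF _ mn) h nh.
  have [n' [F' [e0 en d lt]]] := iso_count_refine mn dF s1 s2 s3 iU niU.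
  suff /cmax : `[< good (iso_count L n' F') >] by rewrite leqNgt lt.
  apply/asboolP; exists n', F'; split=> //; split=> //.
    by move=> i p v; rewrite e0; apply: F0.
  by move=> i p v; rewrite en; apply: Fn.
apply/sdim_has_dim; apply: sdim_ext (key n (leqnn n)) => f; split=> // _ i p v Fv.
by rewrite (Fn _ _ _ Fv) mfun0.
Qed.

End Multiplicity.

Section Shift.
Variables (k : fieldType) (I : Type) (A : galg k I).
Implicit Types V W L J : gmod A.

Lemma irr_elt_shift e L : irr_elt L -> irr_elt (gshift e L).
Proof.
move=> [[i [n [v nv]]] irr]; split.
  by exists i, (n + e); rewrite /= addrK; exists v.
move=> j m w nw i' m' w'; have [d [H [a e1]]] := irr _ _ _ nw i' (m' - e) w'.
have H' : d + m = m' by apply: (addIr (- e)); rewrite -addrA.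
by exists d, H', a; rewrite -e1; exact: (mact_irr (gshift_deg e H') H a w).
Qed.

Lemma findim_shift e L : mod_locally_findim L -> mod_locally_findim (gshift e L).
Proof. by move=> h i n; apply: h. Qed.

Program Definition mor_shift e V W (f : mor V W) : mor (gshift e V) (gshift e W) :=
  @mor_of _ _ _ (gshift e V) (gshift e W) (fun i n v => mfun f v) _ _.
Next Obligation. by move=> e V W f i n c x y; exact: (mfun_lin f i (n - e) c x y). Qed.
Next Obligation. by move=> e V W f i j c n n' H a v; exact: (mfun_act f (gshift_deg e H) a v). Qed.

Lemma mor_shiftE e V W (f : mor V W) i n (v : V i (n - e)) :
  mfun (mor_shift e f) (v : gshift e V i n) = mfun f v.
Proof. exact: mor_ofE. Qed.

Lemma ess_elt_shift e L J (f : mor L J) : ess_elt f -> ess_elt (mor_shift e f).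
Proof.
move=> h i n w nw; have [j [m [d [H [a [l [nl e1]]]]]]] := h _ _ _ nw.
have Em : d + n - e = m by rewrite -H addrA.
move: H l nl e1; case: m / Em => H l nl e1; exists j, (d + n), d, erefl, a, l; split=> //.
by rewrite mor_shiftE -e1; exact: (mact_irr (gshift_deg e erefl) H a w).
Qed.

Program Definition unshift_hom e V J (f : mor V (gshift e J)) : ghom V J (- e) :=
  @ghom_of _ _ _ V J (- e) (fun i n v => mfun f v) _ _.
Next Obligation. by move=> e V J f i n c x y; apply: (mfun_lin f). Qed.
Next Obligation.
by move=> e V J f i j c n n' H H' a v; rewrite /= (mfun_act f); exact: mact_irr.
Qed.

Program Definition shift_hom e V J (f : ghom V J (- e)) : mor V (gshift e J) :=
  @mor_of _ _ _ V (gshift e J) (fun i n v => hfun f erefl v) _ _.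
Next Obligation. by move=> e V J f i n c x y; exact: (hfun_lin f). Qed.
Next Obligation. by move=> e V J f i j c n n' H a v; exact: (hfun_act f H erefl erefl (gshift_deg e H) a v). Qed.

Lemma has_dim_unshift e V J c : has_dim (ghom V (gshift e J) 0) c -> has_dim (ghom V J (- e)) c.
Proof.
apply: (has_dim_iso (f := @unshift_hom e V J)) => [a x y|f e0|f].
- apply: ghom_ext => i n m H v.
  rewrite -[RHS]/(a *: hfun (unshift_hom x) H v + hfun (unshift_hom y) H v).
  by rewrite -dcast_lin.
- apply: ghom_ext => i n m H v; rewrite (mor0E f H (etrans (esym (addr0 n)) H)).
  have -> : mfun f v = 0.
    by have : hfun (unshift_hom f) erefl v = 0 by rewrite e0.
  by rewrite (lin0 (dcast_lin _ _ _)).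
exists (shift_hom f); apply: ghom_ext => i n m H v.
rewrite [LHS](_ : _ = dcast H (mfun (shift_hom f) v)) // mor_ofE.
by rewrite -hfunE.
Qed.

End Shift.

(** Apply [multiplicity_hom] to q^e L and q^e J: a map of degree 0 to q^e J is a map of
  degree -e to [J]. *)
Theorem comp_mult_hull (k : closedFieldType) (I : Type) (A : galg k I) (V L J : gmod A) :
  alg_locally_findim A -> irreducible L -> injective_hull J L -> mod_locally_findim V ->
  exists m, comp_mult V L m /\ forall d, has_dim (ghom V J d) (m (- d)).
Proof.
move=> Af /irreducible_elt irrL hull finV; have inj := hull.1.
have [iota [ii ie]] := hull_elt hull.
have finL := irr_locally_findim irrL Af.
have h e : exists c, has_dim (ghom V J (- e)) c /\
  (exists n F, filtration n F /\ section_count (V := V) L e n F = c) /\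
  (forall n F, filtration n F -> (section_count (V := V) L e n F <= c)%N).
  have ii' : mor_inj (mor_shift e iota) by move=> i n v; rewrite mor_shiftE; apply: ii.
  have [|c [d [m1 m2]]] := multiplicity_hom (irr_elt_shift e irrL) (findim_shift e finL) finV
    ii' (ess_elt_shift (e := e) ie).
  - move=> R gR R0; have [||||f fP] := @injective_extend _ _ _ J V (- e) R inj.
    + exact: (gcorr0 gR).
    + exact: (gcorrL gR).
    + move=> i j c n m H H' a v w Rw.
      have := gcorrA gR H a Rw; rewrite /=.
      by rewrite (Prop_irrelevance (gshift_deg e H) H').
    + exact: R0.
    + by exists (shift_hom f) => i n v w Rw; rewrite mor_ofE; apply: fP.
  exists c; split; first exact: has_dim_unshift.
  split; last by move=> n F fF; rewrite section_countE; apply: m2.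
  by have [n [F [fF <-]]] := m1; exists n, F; rewrite section_countE.
have [m mP] := choice h; exists m; split=> [d|d].
  by have [_ [h1 h2]] := mP d; split.
by have [] := mP (- d); rewrite opprK.
Qed.

(** * Straightening in a graded triangular basis *)

Section Subspaces.
Variable k : fieldType.

Lemma fin_dim_inj (V W : lmodType k) (f : V -> W) : lin f ->
  (forall v, f v = 0 -> v = 0) -> fin_dim W -> fin_dim V.
Proof.
move=> fl fi [N dN]; pose good n := exists g : 'I_n -> V, ffree g.
have gN n : `[< good n >] -> (n <= N)%N.
  move=> /asboolP [g fr]; apply: (ffree_dim (f := f \o g)) dN => a.
  by rewrite -lin_comb // => /fi; apply: fr.
have g0 : exists n, `[< good n >].
  by exists 0%N; apply/asboolP; exists (fun=> 0) => a _ [].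
have [n /asboolP [g fr] nmax] := ex_maxnP g0 gN.
exists n; apply/sdim_has_dim; exists g; split=> // v; split=> // _.
apply: contrapT => nc; suff /nmax : `[< good n.+1 >] by rewrite ltnn.
by apply/asboolP; exists (fcons v g); apply: ffree_cons.
Qed.

Lemma fin_dim_sub (V : lmodType k) (U : subsp V) : fin_dim V -> fin_dim (lsub U).
Proof.
apply: (fin_dim_inj (f := fun u : lsub U => val u)) => [c x y|u e].
  by rewrite lsub_valD lsub_valZ.
by apply: lsub_inj; rewrite lsub_val0.
Qed.

Program Definition preim_sp (V W : lmodType k) (f : V -> W) (fl : lin f) (P : subsp W) : subsp V :=
  @Subsp k V (fun v => P (f v)) _ _.
Next Obligation. by move=> V W f fl P; rewrite /= (lin0 fl); apply: subsp0. Qed.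
Next Obligation. by move=> V W f fl P c x y Px Py; rewrite /= fl; apply: subspL. Qed.

Program Definition null_sp (V W : lmodType k) (f : V -> W) (fl : lin f) : subsp V :=
  @Subsp k V (fun v => f v = 0) _ _.
Next Obligation. by move=> V W f fl; rewrite /= (lin0 fl). Qed.
Next Obligation. by move=> V W f fl c x y /= fx fy; rewrite fl fx fy scaler0 addr0. Qed.

Lemma lin_comp (V W X : lmodType k) (f : W -> X) (g : V -> W) :
  lin f -> lin g -> lin (fun v => f (g v)).
Proof. by move=> fl gl c x y; rewrite gl fl. Qed.

Lemma lpi_lin (V : lmodType k) (U : subsp V) : lin (lpi U).
Proof. by move=> c x y; apply: lpiL. Qed.

Lemma lpi0P (V : lmodType k) (U : subsp V) x : lpi U x = 0 <-> U x.
Proof. by rewrite -[0]/(lpi U 0) lpiP subr0. Qed.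

End Subspaces.
Arguments lpi_lin {k V} U c x y.

Section Associativity.
Variables (k : fieldType) (I : Type) (A : galg k I).

Lemma gmul_lin_l i j l d e f (H : d + e = f) (b : A j l e) :
  lin (fun a : A i j d => gmul A H a b).
Proof. by move=> c x y; apply: gmul_linl. Qed.

Lemma gmul_lin_r i j l d e f (H : d + e = f) (a : A i j d) :
  lin (fun b : A j l e => gmul A H a b).
Proof. by move=> c x y; apply: gmul_linr. Qed.

Fact assocr (d e f de def : int) : d + e = de -> de + f = def -> d + (e + f) = def.
Proof. by move=> <- <-; rewrite addrA. Qed.
Fact assocl (d e f ef def : int) : e + f = ef -> d + ef = def -> d + e + f = def.
Proof. by move=> <- <-; rewrite addrA. Qed.

Lemma gmulAr i j l m d e f de def (H1 : d + e = de) (H2 : de + f = def)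
    (a : A i j d) (b : A j l e) (c : A l m f) :
  gmul A H2 (gmul A H1 a b) c = gmul A (assocr H1 H2) a (gmul A erefl b c).
Proof. exact: gmulA. Qed.

Lemma gmulAl i j l m d e f ef def (H3 : e + f = ef) (H4 : d + ef = def)
    (a : A i j d) (b : A j l e) (c : A l m f) :
  gmul A H4 a (gmul A H3 b c) = gmul A (assocl H3 H4) (gmul A erefl a b) c.
Proof. by rewrite (gmulA erefl (assocl H3 H4) H3 H4). Qed.

Lemma mactAr (V : gmod A) i j l d e f de def (H1 : d + e = de) (H2 : de + f = def)
    (a : A i j d) (b : A j l e) (v : V l f) :
  mact V H2 (gmul A H1 a b) v = mact V (assocr H1 H2) a (mact V erefl b v).
Proof. exact: mactA. Qed.

Lemma mactAl (V : gmod A) i j l d e f ef def (H3 : e + f = ef) (H4 : d + ef = def)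
    (a : A i j d) (b : A j l e) (v : V l f) :
  mact V H4 a (mact V H3 b v) = mact V (assocl H3 H4) (gmul A erefl a b) v.
Proof. by rewrite (mactA erefl (assocl H3 H4) H3 H4). Qed.

Lemma gmul_irr i j l d e f (H H' : d + e = f) (a : A i j d) (b : A j l e) :
  gmul A H a b = gmul A H' a b.
Proof. by rewrite (Prop_irrelevance H H'). Qed.

End Associativity.
Arguments gmul_lin_l {k I A i j l d e f} H b c x y.
Arguments gmul_lin_r {k I A i j l d e f} H a c x y.

Section Basis.
Variables (k : fieldType) (disp : Order.disp_t) (Lam : porderType disp).
Variables (I : Type) (A : galg k I) (T : gtbasis Lam A).
Notation sS := {s : I | s \in gS T}.

(** Lower finiteness of the poset makes its order well founded. *)
Lemma gLam_ind (P : Lam -> Prop) :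
  (forall mu, (forall nu, (nu < mu)%O -> P nu) -> P mu) -> forall mu, P mu.
Proof.
move=> H mu; have /finite_seqP [s es] := gLam_fin T mu.
have {es} : forall nu, (nu <= mu)%O -> nu \in s.
  by move=> nu h; have := f_equal (fun X : Lam -> Prop => X nu) es; rewrite /= => <-.
have [n] := ubnP (size s); elim: n s mu => // n IH s mu sn hs; apply: H => nu lt.
apply: (IH [seq x <- s | x != mu]).
  rewrite ltnS in sn; rewrite size_filter; apply: leq_trans sn.
  rewrite -(count_predC (pred1 mu) s) -add1n leq_add2r -has_count has_pred1.
  exact: hs.
move=> xi le; rewrite mem_filter hs ?(le_trans le (ltW lt)) // andbT.
by rewrite (lt_eqF (le_lt_trans le lt)).
Qed.

Lemma gH_dot (s t : sS) d h : gH (g := T) (s := s) (t := t) (d := d) h -> gdot s = gdot t.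
Proof.
move=> hh; have [->//|ne] := pselect (s = t).
by apply: gtb_H ne _; exists h.
Qed.

Lemma gX_dot (s t : sS) d x : gX (g := T) (i := sval s) (s := t) (d := d) x ->
  (gdot t <= gdot s)%O.
Proof.
move=> hx; have [->//|ne] := pselect (s = t).
by apply: ltW; apply: gtb_X ne _; exists x.
Qed.

Lemma gY_dot (s t : sS) d y : gY (g := T) (t := s) (j := sval t) (d := d) y ->
  (gdot s <= gdot t)%O.
Proof.
move=> hy; have [->//|ne] := pselect (s = t).
by apply: ltW; apply: gtb_Y ne _; exists y.
Qed.

(** In a basis element [x h y] of 1_s A, either [x] passes through some s' of strictly
  lower weight, or it lies in X(s,s) = {1_s} and disappears. *)
Lemma left_expansion (s : sS) i d (P : subsp (A (sval s) i d)) :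
  (forall t dh dy (E : dh + dy = d) h y, gH (g := T) (s := s) (t := t) (d := dh) h ->
     gY (g := T) (t := t) (j := i) (d := dy) y -> P (gmul A E h y)) ->
  (forall (s' : sS) d1 d2 (E : d1 + d2 = d) (a : A (sval s) (sval s') d1)
     (b : A (sval s') i d2), (gdot s' < gdot s)%O -> P (gmul A E a b)) ->
  forall a, P a.
Proof.
move=> Phy Plow; apply: (basis_ind (gtb_basis T _ _ _).2).
move=> [s' t dx dh dy deg x h y Xx Hh Yy]; rewrite /gtriple_mul /=.
have [e|ne] := pselect (s = s'); last first.
  by rewrite gmulAr; apply: Plow; apply: gtb_X ne _; exists x.
case: s' / e deg x h Xx Hh => deg x h Xx Hh.
have [e|ne] := pselect (dx = 0); last by move: Xx; rewrite gtb_Xd.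
subst dx; move: Xx; rewrite gtb_X1 => ->.
have H3 : dh + dy = d by rewrite -deg add0r.
by rewrite (gmulA erefl deg H3 (add0r d)) gmul1l; apply: Phy.
Qed.

(** The mirror image of [left_expansion]: here the factor [y] lies in Y(t,t) = {1_t} or
  starts at strictly lower weight. *)
Lemma right_expansion (t : sS) j d (P : subsp (A j (sval t) d)) :
  (forall s dx dh (E : dx + dh = d) x h, gX (g := T) (i := j) (s := s) (d := dx) x ->
     gH (g := T) (s := s) (t := t) (d := dh) h -> P (gmul A E x h)) ->
  (forall (t' : sS) d1 d2 (E : d1 + d2 = d) (a : A j (sval t') d1)
     (b : A (sval t') (sval t) d2), (gdot t' < gdot t)%O -> P (gmul A E a b)) ->
  forall a, P a.
Proof.
move=> Pxh Plow; apply: (basis_ind (gtb_basis T _ _ _).2).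
move=> [s t' dx dh dy deg x h y Xx Hh Yy]; rewrite /gtriple_mul /=.
have [e|ne] := pselect (t' = t); last by apply: Plow; apply: gtb_Y ne _; exists y.
subst t'.
have [e|ne] := pselect (dy = 0); last by move: Yy; rewrite gtb_Yd.
subst dy; move: Yy; rewrite gtb_Y1 => ->.
have e : dx + dh = d by rewrite -deg addr0.
by case: d / e deg P Pxh Plow => deg P Pxh Plow; rewrite gmul1r; apply: Pxh.
Qed.

(** Straightening.  Expand [b] on the left to a product [h y], then [a h] on the right to
  a product [x h']: the result is a basis element unless one of the expansions passes
  through strictly lower weight, where the induction applies. *)
Lemma through_span (s : sS) j i d e f (H : d + e = f) (a : A j (sval s) d)
    (b : A (sval s) i e) (P : subsp (A j i f)) :
  (forall u : gtriple (gX (g := T)) (gH (g := T)) (gY (g := T)) j i f,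
     (gdot (tr_s u) <= gdot s)%O -> P (gtriple_mul u)) ->
  P (gmul A H a b).
Proof.
have [mu e1] : exists mu, gdot s = mu by eexists.
elim/gLam_ind: mu => mu IH in s e1 j i d e f H a b P *; subst mu => Pu.
apply: (left_expansion (P := preim_sp (gmul_lin_r H a) P)) => [t dh dy E h y Hh Yy|
  s' d1 d2 E a1 b1 lt] /=; last first.
  rewrite gmulAl; apply: IH (lt) _ erefl _ _ _ _ _ _ _ _ _ _.
  by move=> u le; apply: Pu; apply: le_trans le (ltW lt).
rewrite gmulAl; set H' := assocl _ _.
pose P' := preim_sp (gmul_lin_l H' y) P.
apply: (right_expansion (P := P')) => [s' dx dh' E' x h' Xx Hh'|
  t' d1 d2 E' a1 b1 lt] /=; last first.
  have lt' : (gdot t' < gdot s)%O by rewrite (gH_dot Hh).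
  rewrite gmulAr; apply: IH (lt') _ erefl _ _ _ _ _ _ _ _ _ _.
  by move=> u le; apply: Pu; apply: le_trans le (ltW lt').
move: H' @P'; case: _ / E' => H' P'.
by have := Pu (GTriple H' Xx Hh' Yy); apply; rewrite /= (gH_dot Hh') (gH_dot Hh).
Qed.

Lemma ideal_span mu i j d (c : A i j d) (P : subsp (A i j d)) :
  idset (ideal_not_ge T mu) c ->
  (forall (s : sS) d1 d2 (E : d1 + d2 = d) (a : A i (sval s) d1) (b : A (sval s) j d2),
     ~~ (mu <= gdot s)%O -> P (gmul A E a b)) -> P c.
Proof.
move=> h; elim: h P => {i j d c}.
- move=> i [s [-> ns]] P Pg; rewrite -(gmul1l (add0r 0) (gone A _)); exact: Pg.
- by move=> i j d P _; apply: subsp0.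
- by move=> i j d c a b _ IHa _ IHb P Pg; apply: subspL; [apply: IHa | apply: IHb].
- move=> i j l d e f H a b _ IH P Pg.
  apply: (IH (preim_sp (gmul_lin_r H a) P)) => s d1 d2 E a' b' ns /=.
  by rewrite gmulAl; apply: Pg.
- move=> i j l d e f H a b _ IH P Pg.
  apply: (IH (preim_sp (gmul_lin_l H b) P)) => s d1 d2 E a' b' ns /=.
  by rewrite gmulAr; apply: Pg.
Qed.

Lemma ideal_through mu (s : sS) i j d e f (H : d + e = f) (a : A i (sval s) d)
    (b : A (sval s) j e) : ~~ (mu <= gdot s)%O -> idset (ideal_not_ge T mu) (gmul A H a b).
Proof.
move=> ns; apply: id_mull; have E : 0 + e = e by rewrite add0r.
rewrite -(gmul1l E b); apply: id_mulr; apply: ideal_gen_one; by exists s.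
Qed.

Lemma age_mul mu i j l d e f (H : d + e = f) (a : A i j d) (b : A j l e) :
  gmul (Age T mu) H (lpi _ a) (lpi _ b) = lpi _ (gmul A H a b).
Proof. exact: lpi_gmul. Qed.

End Basis.

(** * The layers of an injective module *)

Section Layer.
Variables (k : fieldType) (disp : Order.disp_t) (Lam : porderType disp).
Variables (I : Type) (A : galg k I) (T : gtbasis Lam A).
Notation sS := {s : I | s \in gS T}.
Variable V : gmod A.

(** The module denoted V^D at the beginning of this file. *)
Program Definition vanish (D : Lam -> Prop) : gsubmod V :=
  @GSubmod _ _ _ V (fun i n => @Subsp k _
    (fun v => forall (t : sS) d m (H : d + n = m) (a : A (sval t) i d),
       D (gdot t) -> mact V H a v = 0) _ _) _.
Next Obligation. by move=> D i n t d m H a _; rewrite mact0r. Qed.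
Next Obligation.
by move=> D i n c x y hx hy t d m H a Dt; rewrite mact_linr hx // hy // scaler0 addr0.
Qed.
Next Obligation.
by move=> D i j d e f H a v hv t d' m H' a' Dt; rewrite mactAl; apply: hv.
Qed.

Variables (mu : Lam) (D : Lam -> Prop).
Hypothesis Dlow : forall nu, (nu < mu)%O -> D nu.
Hypothesis Dup : forall nu, D nu -> ~~ (mu <= nu)%O.
Let N := vanish D.
Notation p := (@gS_at_val _ _ _ _ _ T mu).
Notation idl := (ideal_not_ge T mu).

(** In a product through 1_u with u of weight not above [mu], the factor in 1_s A 1_u
  has no part of the form [h y], because that would force the weight of u to be at least
  [mu]; so it passes through weights below [mu], and these act as zero. *)
Lemma ideal_kills_left (s : sS) j d n m (H : d + n = m) (c : A (sval s) j d) (v : V j n) :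
  gdot s = mu -> idset idl c -> smset N v -> mact V H c v = 0.
Proof.
move=> es cI Nv; apply: (ideal_span (P := null_sp (mact_lin_l V H v))) cI _.
move=> u d1 d2 E a b nu /=.
apply: (left_expansion (P := null_sp (lin_comp (mact_lin_l V H v) (gmul_lin_l E b)))) => /=.
  move=> t dh dy E' h y Hh Yy; case/negP: nu.
  by rewrite -es (gH_dot Hh) (gY_dot Yy).
move=> s' d1' d2' E' a' b' lt; rewrite gmulAr mactAr Nv ?mact0r //.
by apply: Dlow; rewrite -es.
Qed.

Lemma ideal_kills_right (s : sS) j d n m (H : d + n = m) (c : A j (sval s) d)
    (v : V (sval s) n) :
  gdot s = mu -> idset idl c -> smset N v -> mact V H c v = 0.
Proof.
move=> es cI Nv; apply: (ideal_span (P := null_sp (mact_lin_l V H v))) cI _.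
move=> u d1 d2 E a b nu /=.
apply: (right_expansion (P := null_sp (lin_comp (mact_lin_l V H v) (gmul_lin_r E a)))) => /=.
  move=> s' dx dh E' x h Xx Hh; case/negP: nu.
  by rewrite -es -(gH_dot Hh) (gX_dot Xx).
move=> t' d1' d2' E' a' b' lt; rewrite gmulAl mactAr Nv ?mact0r //.
by apply: Dlow; rewrite -es.
Qed.

(** Elements of A_(>= mu) act on the weight-[mu] part through any of their lifts. *)
Lemma lrepr_kills_left (s : sS) j d n m (H : d + n = m) (a : A (sval s) j d) (v : V j n) :
  gdot s = mu -> smset N v -> mact V H (lrepr (lpi (idset idl (i:=_) (j:=_) (d:=_)) a)) v = mact V H a v.
Proof.
move=> es Nv; apply/eqP; rewrite -subr_eq0 -(linB (mact_lin_l V H v)); apply/eqP.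
by apply: ideal_kills_left es _ Nv; apply: lrepr_pi.
Qed.

Lemma gS_atP (s : gS_at T mu) : gdot (sval s) = mu.
Proof. exact/eqP/(valP s). Qed.

Let wcar (s : gS_at T mu) n := lsub (@smset _ _ _ _ N (p s) n).

(** The A_mu-module e_mu V^D. *)
Program Definition layer_mod : gmod (Aat T mu) :=
  @GMod k (gS_at T mu) (Aat T mu) wcar
    (fun s t d e f H a v => lsub_in (sm_act H (lrepr a) (lsub_valP v))) _ _ _ _.
Next Obligation.
move=> s t d e f H v c a a'; apply: lsub_inj; rewrite lsub_valD lsub_valZ /=.
rewrite -{1}(lreprK a) -{1}(lreprK a') -lpiL lrepr_kills_left ?mact_linl //.
  exact: gS_atP.
exact: lsub_valP.
Qed.
Next Obligation.
move=> s t d e f H a c v v'; apply: lsub_inj.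
rewrite [RHS]lsub_valD [X in _ = X + _]lsub_valZ.
have E : mact V H (lrepr a) (val (c *: v + v')) =
    c *: mact V H (lrepr a) (val v) + mact V H (lrepr a) (val v').
  by rewrite lsub_valD lsub_valZ mact_linr.
exact: E.
Qed.
Next Obligation.
move=> s t u d e f de ef def H1 H2 H3 H4 a b v; apply: lsub_inj => /=.
rewrite -(mactA H1 H2 H3 H4) lrepr_kills_left //; first exact: gS_atP.
exact: lsub_valP.
Qed.
Next Obligation.
move=> s d H v; apply: lsub_inj => /=.
rewrite lrepr_kills_left ?mact1 //; first exact: gS_atP.
exact: lsub_valP.
Qed.

Lemma layer_modE (s t : gS_at T mu) d e f (H : d + e = f) (a : A (p s) (p t) d)
    (v : layer_mod t e) :
  val (mact layer_mod H (lpi _ a : Aat T mu s t d) v) = mact V H a (val v).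
Proof. by rewrite /= lrepr_kills_left //; [apply: gS_atP | apply: lsub_valP]. Qed.

Lemma layer_findim : mod_locally_findim V -> mod_locally_findim layer_mod.
Proof. by move=> h s n; apply: fin_dim_sub; apply: h. Qed.

Lemma layer_bounded : mod_bounded_above V -> mod_bounded_above layer_mod.
Proof.
move=> h s; have [M hM] := h (p s); exists M => d dM v.
by apply: lsub_inj; rewrite lsub_val0; apply: hM.
Qed.

End Layer.

Section LayerSection.
Variables (k : fieldType) (disp : Order.disp_t) (Lam : porderType disp).
Variables (I : Type) (A : galg k I) (T : gtbasis Lam A).
Notation sS := {s : I | s \in gS T}.
Variable V : gmod A.
Variables (mu : Lam) (D : Lam -> Prop).
Hypothesis Dlow : forall nu, (nu < mu)%O -> D nu.
Hypothesis Dup : forall nu, D nu -> ~~ (mu <= nu)%O.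
Notation N := (vanish T V D).
Notation p := (@gS_at_val _ _ _ _ _ T mu).
Notation idl := (ideal_not_ge T mu).
Notation cls a := (lpi (@idset _ _ _ idl _ _ _) a).
Notation W := (layer_mod T V Dlow).

Lemma if_idP_true (b : bool) (X : Type) (F : b -> X) x (E : b) :
  (if @idP b is ReflectT E' then F E' else x) = F E.
Proof.
have H b' (r : reflect b b') : (if r is ReflectT E' then F E' else x) = F E.
  by case: r => [E'|/(_ E)//]; rewrite (Prop_irrelevance E E').
exact: H.
Qed.

Lemma if_idP_false (b : bool) (X : Type) (F : b -> X) x : ~~ b ->
  (if @idP b is ReflectT E' then F E' else x) = x.
Proof.
move=> nb; have H b' (r : reflect b b') : (if r is ReflectT E' then F E' else x) = x.
  by case: r => // E'; case/negP: nb.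
exact: H.
Qed.

Section JstarValue.
Variables (i : I) (d : int) (f : jstar W i d).

Definition jstar_val (s : gS_at T mu) n m (H : n + d = m) (x : A (p s) i n) : V (p s) m :=
  val (hfun (f : ghom (gmod_trunc p (lreg (Age T mu) i)) W d) H
    (cls x : gmod_trunc p (lreg (Age T mu) i) s n)).

Lemma jstar_val_lin s n m (H : n + d = m) : lin (fun x : A (p s) i n => jstar_val H x).
Proof.
move=> c x y; rewrite /jstar_val lpiL.
by rewrite (hfun_lin (f : ghom (gmod_trunc p (lreg (Age T mu) i)) W d)) lsub_valD lsub_valZ.
Qed.

Lemma jstar_val_act s t c n m n' m' (H1 : c + n = n') (H2 : n' + d = m') (H3 : n + d = m)
    (H4 : c + m = m') (h : A (p s) (p t) c) (x : A (p t) i n) :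
  jstar_val H2 (gmul A H1 h x) = mact V H4 h (jstar_val H3 x).
Proof.
rewrite /jstar_val -(age_mul T mu).
rewrite (hfun_act (f : ghom (gmod_trunc p (lreg (Age T mu) i)) W d) H1 H2 H3 H4
  (cls h : Aat T mu s t c)).
exact: layer_modE.
Qed.

Lemma jstar_val_ideal s n m (H : n + d = m) (x : A (p s) i n) : idset idl x -> jstar_val H x = 0.
Proof.
move=> /lpi0P e; rewrite /jstar_val e.
by rewrite (lin0 (hfun_linear (f : ghom (gmod_trunc p (lreg (Age T mu) i)) W d) _ _)).
Qed.

End JstarValue.

Section Extension.
Variables (i : I) (d : int) (f : jstar W i d).
Notation triple j e := (gtriple (gX (g := T)) (gH (g := T)) (gY (g := T)) j i e).

Fact ext_deg (dx dh dy e : int) : dx + dh + dy = e -> dx + (dh + dy + d) = e + d.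
Proof. by move=> <-; rewrite !addrA. Qed.

(** The map x h y |-> x f(h y); it is set to zero on the basis elements that do not pass
  through S_mu. *)
Definition ext_on j e (u : triple j e) (E : gdot (tr_s u) == mu) : V j (e + d) :=
  mact V (ext_deg (tr_deg u)) (tr_x u)
    (jstar_val f (s := exist _ (tr_s u) E) erefl (gmul A erefl (tr_h u) (tr_y u))).

Definition ext_val j e (u : triple j e) : V j (e + d) :=
  if @idP (gdot (tr_s u) == mu) is ReflectT E then ext_on E else 0.

Lemma ext_exists j e : exists phi : A j i e -> V j (e + d),
  lin phi /\ forall u : triple j e, phi (gtriple_mul u) = ext_val u.
Proof. by apply: linear_extension; apply: gtb_basis. Qed.

Definition ext_map j e : A j i e -> V j (e + d) := projT1 (cid (ext_exists j e)).

Lemma ext_map_lin j e : lin (@ext_map j e).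
Proof. by rewrite /ext_map; case: cid => phi []. Qed.

Lemma ext_mapE j e (u : triple j e) : ext_map (gtriple_mul u) = ext_val u.
Proof. by rewrite /ext_map; case: cid => phi []. Qed.

Lemma ext_map_through (t : sS) j d1 d2 e (E : d1 + d2 = e) (a : A j (sval t) d1)
    (b : A (sval t) i d2) : ~~ (mu <= gdot t)%O -> ext_map (gmul A E a b) = 0.
Proof.
move=> nt; suff : null_sp (@ext_map_lin j e) (gmul A E a b) by [].
apply: (@through_span _ _ _ _ _ T) => u le.
rewrite /= ext_mapE /ext_val if_idP_false //.
by apply: contra nt => /eqP <-.
Qed.

Lemma ext_map_X (s : sS) (Es : gdot s == mu) j dx dc e m (H : dx + dc = e) (H' : dc + d = m)
    (H'' : dx + m = e + d) (x : A j (sval s) dx) (c : A (sval s) i dc) :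
  gX (g := T) (i := j) (s := s) (d := dx) x ->
  ext_map (gmul A H x c) = mact V H'' x (jstar_val f (s := exist _ s Es) H' c).
Proof.
move=> Xx; case: m / H' H'' => H''.
apply: (left_expansion (P := equal_sp
  (lin_comp (@ext_map_lin j e) (gmul_lin_r H x))
  (lin_comp (mact_lin_r V H'' x)
    (@jstar_val_lin i d f (exist _ s Es) dc _ erefl)))) => /=.
- move=> t dh dy E h y Hh Yy; case: _ / E H H'' => H H''.
  rewrite gmulAl; set H2 := assocl _ _.
  rewrite [LHS](ext_mapE (GTriple H2 Xx Hh Yy)) /ext_val (if_idP_true _ _ Es).
  exact: mact_irr.
- move=> s' d1 d2 E a b lt.
  have ns : ~~ (mu <= gdot s')%O by apply: Dup; apply: Dlow; rewrite -(eqP Es).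
  rewrite gmulAl ext_map_through // jstar_val_ideal ?mact0r //.
  exact: ideal_through.
Qed.

(** This is the linearity over [A] of the map determined by [f] on the submodule
  generated by e_mu A 1_i.  Parts of [a] and [c] that pass through weights below [mu]
  are killed on both sides. *)
Lemma ext_map_S (s : sS) (Es : gdot s == mu) j da dc e m (H : da + dc = e) (H' : dc + d = m)
    (H'' : da + m = e + d) (a : A j (sval s) da) (c : A (sval s) i dc) :
  ext_map (gmul A H a c) = mact V H'' a (jstar_val f (s := exist _ s Es) H' c).
Proof.
apply: (right_expansion (P := equal_sp
  (lin_comp (@ext_map_lin j e) (gmul_lin_l H c)) (mact_lin_l V H'' _))) => /=.
- move=> s1 dx dh E x h Xx Hh.
  have Es1 : gdot s1 == mu by rewrite (gH_dot Hh).
  have H1 : dh + dc + d = dh + m by rewrite -H' addrA.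
  have H2 : dx + (dh + m) = e + d by rewrite addrA E.
  rewrite gmulAr (ext_map_X Es1 _ H1 H2) //.
  by rewrite (@jstar_val_act i d f (exist _ s1 Es1) (exist _ s Es) dh dc m _ _ erefl H1 H' erefl) (mactA _ _ erefl H2).
- move=> t' d1 d2 E a1 b1 lt.
  have Dt : D (gdot t') by apply: Dlow; rewrite -(eqP Es).
  rewrite gmulAr ext_map_through ?Dup // mactAr.
  have Nc : smset N (jstar_val f (s := exist _ s Es) H' c) by exact: lsub_valP.
  by rewrite Nc ?mact0r.
Qed.

End Extension.

Definition add_mu (D : Lam -> Prop) nu := D nu \/ nu = mu.

(** A vector [v] corresponds to the map x |-> x v on e_mu A 1_i.  Conversely, a map [f]
  yields a map to [V] from the submodule of A 1_i generated by the 1_t A 1_i with t of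
  weight [mu] or in [D], which is zero on the latter; extend it to A 1_i and evaluate it
  at 1_i. *)
Lemma layer_section_iso : injective_mod V ->
  sect_iso N (vanish T V (add_mu D)) (jstar W).
Proof.
move=> injV.
exists (fun i d (v : V i d) (f : jstar W i d) => smset N v /\
  forall s n m (H : n + d = m) (x : A (p s) i n), jstar_val f H x = mact V H x v).
split.
- split.
  + move=> i n; split=> [|s c m H x]; first exact: subsp0.
    by rewrite mact0r /jstar_val lsub_val0.
  + move=> i n c v v' f f' [Nv fv] [Nv' fv']; split=> [|s e m H x]; first exact: subspL.
    rewrite mact_linr -fv -fv' -lsub_valZ -lsub_valD; reflexivity.
  + move=> i j c n m H a v f [Nv fv]; split=> [|s e q H' x]; first exact: sm_act.
    rewrite mactAl -fv /jstar_val -(age_mul T mu).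
    rewrite -(coind_actE H (cls a : Age T mu i j c) (f : coind W j n) H'); reflexivity.
- move=> i d v; split=> [Nv|[f []] //].
  pose g (s : gS_at T mu) n m (H : n + d = m)
    (x : gmod_trunc p (lreg (Age T mu) i) s n) : W s m := lsub_in (sm_act H (lrepr x) Nv).
  have gE s n m (H : n + d = m) (x : A (p s) i n) : val (g s n m H (cls x)) = mact V H x v.
    by rewrite /= (lrepr_kills_left Dlow) //; apply: gS_atP.
  have gl s n m (H : n + d = m) c x x' : g s n m H (c *: x + x') = c *: g s n m H x + g s n m H x'.
    rewrite -(lreprK x) -(lreprK x') -lpiL; apply: lsub_inj.
    by rewrite lsub_valD lsub_valZ !gE mact_linl.
  have ga (s t : gS_at T mu) c n m n' m' (H1 : c + n = n') (H2 : n' + d = m') (H3 : n + d = m)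
      (H4 : c + m = m') (a : Aat T mu s t c) x :
      g s n' m' H2 (mact (gmod_trunc p (lreg (Age T mu) i)) H1 a x) = mact W H4 a (g t n m H3 x).
    rewrite -(lreprK a) -(lreprK x); apply: lsub_inj.
    rewrite [mact (gmod_trunc _ _) _ _ _]age_mul gE layer_modE gE; exact: mactA.
  exists (@GHom _ _ _ (gmod_trunc p (lreg (Age T mu) i)) W d g gl ga : jstar W i d).
  by split=> // s n m H x; rewrite -gE.
- move=> i d v f [Nv fv]; split=> [N'v|f0].
    apply: (@ghom_ext _ _ _ (gmod_trunc p (lreg (Age T mu) i)) W d) => s n m H x.
    rewrite -(lreprK x); apply: lsub_inj; rewrite lsub_val0 -[LHS]/(jstar_val f H (lrepr x)) fv.
    by apply: N'v; right; apply: gS_atP.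
  move=> t c m H a [Dt|et]; first exact: Nv.
  have Et : gdot t == mu by apply/eqP.
  have := fv (exist _ t Et) c m H a; rewrite f0 => <-.
  by rewrite /jstar_val lsub_val0.
move=> i d f; pose phi := ext_map f.
pose M j n (a : A j i n) := forall P : subsp (A j i n),
  (forall (t : sS) d1 d2 (E : d1 + d2 = n) (a1 : A j (sval t) d1) (a2 : A (sval t) i d2),
    add_mu D (gdot t) -> P (gmul A E a1 a2)) -> P a.
have phia j l c n n' (H : c + n = n') (H' : c + (n + d) = n' + d) (b : A j l c) a :
    M l n a -> phi j n' (gmul A H b a) = mact V H' b (phi l n a).
  pose P := equal_sp (lin_comp (@ext_map_lin i d f j n') (gmul_lin_r H b))
     (lin_comp (mact_lin_r V H' b) (@ext_map_lin i d f l n)).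
  move=> /(_ P); apply=> /= t d1 d2 E a1 a2 [Dt|/eqP Et].
    by rewrite gmulAl !ext_map_through ?Dup // mact0r.
  have E2 : d1 + (d2 + d) = n + d by rewrite addrA E.
  have E3 : (c + d1) + (d2 + d) = n' + d by rewrite -addrA E2.
  rewrite gmulAl (ext_map_S f Et _ erefl E3) (ext_map_S f Et _ erefl E2).
  by rewrite (mactA _ _ E2 H').
have [||||F FP] := @injective_extend _ _ _ V (lreg A i) d
  (fun j n a w => M j n a /\ w = phi j n a) injV.
- move=> j n; split; last by rewrite /phi (lin0 (@ext_map_lin i d f j n)).
  by move=> P _; apply: subsp0.
- move=> j n c a a' _ _ [Ma ->] [Ma' ->]; split; last by rewrite /phi (@ext_map_lin i d f j n).
  by move=> P h; apply: subspL; [apply: Ma | apply: Ma'].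
- move=> j l c n m H H' b a _ [Ma ->]; split; last by rewrite phia.
  move=> P h; apply: (Ma (preim_sp (gmul_lin_r H b) P)) => t d1 d2 E a1 a2 Dt /=.
  by rewrite gmulAl; apply: h.
- by move=> j n w [_ ->]; rewrite /phi (lin0 (@ext_map_lin i d f j n)).
pose v : V i d := hfun F (add0r d) (gone A i : lreg A i i 0).
have Fv j n m (H : n + d = m) (x : A j i n) : mact V H x v = dcast H (hfun F erefl (x : lreg A i j n)).
  rewrite /v -(hfun_act F (addr0 n) H (add0r d) H (x : A j i n)) /= gmul1r; exact: hfunE.
have unit (t : sS) n (x : A (sval t) i n) : x = gmul A (add0r n) (gone A (sval t)) x.
  by rewrite gmul1l.
have FM (t : sS) n (x : A (sval t) i n) : add_mu D (gdot t) ->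
    hfun F erefl (x : lreg A i (sval t) n) = phi _ _ x.
  by move=> Dt; apply: FP; split=> // P h; rewrite [x]unit; apply: h.
exists v; split=> [t n m H x Dt|s n m H x].
  rewrite Fv FM; last by left.
  by rewrite [x]unit /phi ext_map_through ?Dup // (lin0 (dcast_lin V _ _)).
rewrite Fv (FM (sval s)); last by right; apply: gS_atP.
case: m / H; rewrite dcast_id.
have -> : phi _ _ x = ext_map f (gmul A (add0r n) (gone A (sval (sval s))) x).
  by rewrite gmul1l.
rewrite (ext_map_S f (valP s) _ erefl (add0r _)) mact1.
case: s x => s Es x; move: (valP _) => /= Es'.
by rewrite (Prop_irrelevance Es Es').
Qed.

End LayerSection.

(** * Induction from A_mu preserves injections *)

Section TensorLift.
Variables (k : fieldType) (K I : Type) (p : K -> I) (A : galg k I).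
Variable V : gmod (galg_trunc p A).
Variables (i : I) (d : int).
Notation tns := (tens V i d).
Notation pure H a v := (tpi [:: @PTens k K I p A V i d _ _ _ H a v]).

Lemma tens_ind (P : subsp tns) :
  (forall s m n (H : m + n = d) a (v : V s n), P (pure H a v)) -> forall x, P x.
Proof.
move=> Pp x; rewrite -(treprK x); elim: (trepr x) => [|[s m n H a v] u IH].
  exact: subsp0.
by rewrite -cat1s tpiD; apply: subspD.
Qed.

Lemma pure_lin_l s m n (H : m + n = d) (v : V s n) :
  lin (fun a : A i (p s) m => pure H a v : tns).
Proof.
move=> c x y; rewrite -tpiZ -tpiD; apply/tpiP; exact: tens_addl.
Qed.

Lemma pure_lin_r s m n (H : m + n = d) (a : A i (p s) m) :
  lin (fun v : V s n => pure H a v : tns).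
Proof.
move=> c x y.
have Z (v : V s n) : pure H a (c *: v) = c *: (pure H a v : tns).
  rewrite -tpiZ; apply/tpiP; rewrite /= /pscale /=.
  (* the scalar is moved across the tensor product through c 1_s *)
  have E1 : m + 0 = m by rewrite addr0.
  have := tens_bal E1 H (add0r n) H a (c *: gone A (p s) : galg_trunc p A s s 0) v.
  rewrite [mact _ _ _ _]mactZl (mact1 (add0r n)) gmulZr gmul1r; exact: tens_sym.
rewrite -Z -tpiD; apply/tpiP; exact: tens_addr.
Qed.

Lemma pure_bal s t m c n mc cn (H1 : m + c = mc) (H2 : mc + n = d) (H3 : c + n = cn)
    (H4 : m + cn = d) (a : A i (p s) m) (b : galg_trunc p A s t c) (v : V t n) :
  pure H2 (gmul A H1 a b) v = pure H4 a (mact V H3 b v).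
Proof. by apply/tpiP; apply: tens_bal. Qed.

Lemma tens_lift (X : lmodType k)
    (g : forall s m n, m + n = d -> A i (p s) m -> V s n -> X) :
  (forall s m n (H : m + n = d) (v : V s n), lin (fun a => g s m n H a v)) ->
  (forall s m n (H : m + n = d) a, lin (g s m n H a)) ->
  (forall s t m c n mc cn (H1 : m + c = mc) (H2 : mc + n = d) (H3 : c + n = cn)
     (H4 : m + cn = d) (a : A i (p s) m) (b : galg_trunc p A s t c) (v : V t n),
     g t mc n H2 (gmul A H1 a b) v = g s m cn H4 a (mact V H3 b v)) ->
  exists G : tns -> X, lin G /\ forall s m n (H : m + n = d) a (v : V s n),
    G (pure H a v) = g s m n H a v.
Proof.
move=> gl gr gb.
pose g1 (t : ptens V i d) := g _ _ _ (pt_deg t) (pt_left t) (pt_right t).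
pose g' (u : seq (ptens V i d)) : X := \sum_(t <- u) g1 t.
have g'e u v : tens_eq u v -> g' u = g' v.
  elim=> {u v} //.
  - by move=> u v w _ -> _ ->.
  - by move=> u u' v v' _ e _ e'; rewrite /g' !big_cat /= -!/(g' _) e e'.
  - by move=> u v; rewrite /g' !big_cat /= addrC.
  - by move=> s m n H v; rewrite /g' big_seq1 big_nil /g1 /= (lin0 (gl _ _ _ _ _)).
  - by move=> s m n H a a' v; rewrite /g' !big_cons !big_nil !addr0 /g1 /= (linD (gl _ _ _ _ _)).
  - by move=> s m n H a v v'; rewrite /g' !big_cons !big_nil !addr0 /g1 /= (linD (gr _ _ _ _ _)).
  - by move=> *; rewrite /g' !big_seq1 /g1 /=; apply: gb.
exists (fun x => g' (trepr x)); split=> [c x y|s m n H a v].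
  rewrite -{1}(treprK x) -{1}(treprK y) -tpiZ -tpiD (g'e _ _ (trepr_pi _)).
  rewrite /g' big_cat big_map /= scaler_sumr; congr (_ + _).
  by apply: eq_bigr => -[s m n H a v] _; rewrite /g1 /= (linZ (gl _ _ _ _ _)).
by rewrite (g'e _ _ (trepr_pi _)) /g' big_seq1.
Qed.

End TensorLift.

Section Induced.
Variables (k : fieldType) (disp : Order.disp_t) (Lam : porderType disp).
Variables (I : Type) (A : galg k I) (T : gtbasis Lam A) (mu : Lam).
Notation sS := {s : I | s \in gS T}.
Notation p := (@gS_at_val _ _ _ _ _ T mu).
Notation idl := (ideal_not_ge T mu).
Notation cls a := (lpi (@idset _ _ _ idl _ _ _) a).

Definition pten (M : gmod (Aat T mu)) j d s m n (H : m + n = d) (a : Age T mu j (p s) m)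
  (v : M s n) : jlower M j d := tpi [:: PTens H a v].

Section OneModule.
Variable M : gmod (Aat T mu).

Lemma pten_ind j d (P : subsp (jlower M j d)) :
  (forall s m n (H : m + n = d) a (v : M s n), P (pten H a v)) -> forall x, P x.
Proof. exact: tens_ind. Qed.

Lemma pten_lin_l j d s m n (H : m + n = d) (v : M s n) :
  lin (fun a : Age T mu j (p s) m => pten H a v).
Proof. exact: pure_lin_l. Qed.

Lemma pten_lin_r j d s m n (H : m + n = d) (a : Age T mu j (p s) m) :
  lin (fun v : M s n => pten H a v).
Proof. exact: pure_lin_r. Qed.

Lemma pten_bal j d s t m c n mc cn (H1 : m + c = mc) (H2 : mc + n = d) (H3 : c + n = cn)
    (H4 : m + cn = d) (a : Age T mu j (p s) m) (b : Aat T mu s t c) (v : M t n) :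
  pten H2 (gmul (Age T mu) H1 a b) v = pten H4 a (mact M H3 b v).
Proof. exact: pure_bal. Qed.

Lemma pten_act i j d e f (H : d + e = f) (b : A i j d) s m n (Hx : m + n = e)
    (a : Age T mu j (p s) m) (v : M s n) dm (H1 : d + m = dm) (H2 : dm + n = f) :
  mact (jlower M) H b (pten Hx a v) = pten H2 (gmul (Age T mu) H1 (cls b) a) v.
Proof.
rewrite -[LHS]/(ind_act H (cls b : Age T mu i j d) (tpi [:: PTens Hx a v])).
by rewrite tpi_act /= (ptens_actE _ _ _ _ _ H1 H2).
Qed.

Lemma jlower_lift (V : gmod A)
    (g : forall j d s m n, m + n = d -> Age T mu j (p s) m -> M s n -> V j d) :
  (forall j d s m n (H : m + n = d) (v : M s n), lin (fun a => g j d s m n H a v)) ->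
  (forall j d s m n (H : m + n = d) a, lin (g j d s m n H a)) ->
  (forall j d s t m c n mc cn (H1 : m + c = mc) (H2 : mc + n = d) (H3 : c + n = cn)
     (H4 : m + cn = d) (a : Age T mu j (p s) m) (b : Aat T mu s t c) (v : M t n),
     g j d t mc n H2 (gmul (Age T mu) H1 a b) v = g j d s m cn H4 a (mact M H3 b v)) ->
  (forall i j d e f (H : d + e = f) (b : A i j d) s m n (Hx : m + n = e)
    (a : Age T mu j (p s) m) (v : M s n) dm (H1 : d + m = dm) (H2 : dm + n = f),
    g i f s dm n H2 (gmul (Age T mu) H1 (cls b) a) v = mact V H b (g j e s m n Hx a v)) ->
  exists F : mor (jlower M) V, forall j d s m n (H : m + n = d) a (v : M s n),
    mfun F (pten H a v) = g j d s m n H a v.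
Proof.
move=> gl gr gb ga.
have ex j d := @tens_lift _ _ _ p (Age T mu) M j d (V j d) (g j d) (gl j d) (gr j d) (gb j d).
pose phi j d : jlower M j d -> V j d := projT1 (cid (ex j d)).
have phil j d : lin (phi j d) by rewrite /phi; case: cid => G [].
have phiE j d s m n (H : m + n = d) a (v : M s n) : phi j d (pten H a v) = g j d s m n H a v.
  by rewrite /phi; case: cid => G []; rewrite /pten /= => _ ->.
have phia i j c n n' (H : c + n = n') (b : A i j c) x :
    phi i n' (mact (jlower M) H b x) = mact V H b (phi j n x).
  apply: (pten_ind (P := equal_sp
    (lin_comp (phil i n') (mact_lin_r (jlower M) H b))
    (lin_comp (mact_lin_r V H b) (phil j n)))) => s m e Hx a v.
  suff : phi i n' (mact (jlower M) H b (pten Hx a v)) =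
    mact V H b (phi j n (pten Hx a v)) by [].
  have H2 : (c + m) + e = n' by rewrite -addrA Hx.
  by rewrite (pten_act _ _ _ _ _ erefl H2) !phiE; apply: ga.
by exists (mor_of phil phia) => *; rewrite mor_ofE phiE.
Qed.

End OneModule.

(** The elements of X(j,s) with s in S_mu: a basis of the right A_mu-module
  1_j A_(>= mu) e_mu.  Keeping index, degree and element in a single key allows basis
  elements of different types to be compared. *)
Record xelt (j : I) := XElt {
  xkey : {s : sS & {e : int & A j (sval s) e}};
  xkeyX : gX (g := T) (i := j) (s := tag xkey) (d := tag (tagged xkey)) (tagged (tagged xkey));
  xmu : gdot (tag xkey) == mu }.

Section Coordinates.
Variable j : I.
Implicit Type q : xelt j.

Definition xs q : gS_at T mu := exist _ (tag (xkey q)) (xmu q).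
Definition xe q : int := tag (tagged (xkey q)).
Definition xx q : A j (p (xs q)) (xe q) := tagged (tagged (xkey q)).

Lemma xelt_inj q q' : xkey q = xkey q' -> q = q'.
Proof.
case: q q' => [u X M] [u' X' M'] /= e; subst u'.
by congr XElt; apply: Prop_irrelevance.
Qed.

Section At.
Variables (i : I) (m : int).
Notation triple := (gtriple (gX (g := T)) (gH (g := T)) (gY (g := T)) j i m).

Definition tkey (u : triple) : {s : sS & {e : int & A j (sval s) e}} :=
  Tagged _ (Tagged (fun e => A j (sval (tr_s u)) e : Type) (tr_x u)).

Fact coord_deg (dx dh dy : int) : dx + dh + dy = m -> dh + dy = m - dx.
Proof. by move=> E; apply: (addIr dx); rewrite subrK addrC addrA. Qed.

Definition tval (u : triple) : Age T mu (sval (tag (tkey u))) i (m - tag (tagged (tkey u))) :=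
  cls (gmul A (coord_deg (tr_deg u)) (tr_h u) (tr_y u)).

(** The coordinate at [q] is the linear map x h y |-> delta_(x,q) h y. *)
Definition coord_val q (u : triple) : Age T mu (p (xs q)) i (m - xe q) :=
  if pselect (tkey u = xkey q) is left E then
    eq_rect (tkey u) (fun key => Age T mu (sval (tag key)) i (m - tag (tagged key)) : Type)
      (tval u) (xkey q) E
  else 0.

Lemma coord_exists q : exists h : A j i m -> Age T mu (p (xs q)) i (m - xe q),
  lin h /\ forall u, h (gtriple_mul u) = coord_val q u.
Proof. by apply: linear_extension; apply: gtb_basis. Qed.

Definition coord q : A j i m -> Age T mu (p (xs q)) i (m - xe q) := projT1 (cid (coord_exists q)).

Lemma coord_lin q : lin (coord q).
Proof. by rewrite /coord; case: cid => h []. Qed.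

Lemma coordE q u : coord q (gtriple_mul u) = coord_val q u.
Proof. by rewrite /coord; case: cid => h []. Qed.

Lemma coord_ideal q c : idset idl c -> coord q c = 0.
Proof.
move=> cI; apply: (ideal_span (P := null_sp (coord_lin q))) cI _ => s d1 d2 E a b ns.
apply: (@through_span _ _ _ _ _ T) => u le /=; rewrite coordE /coord_val.
case: pselect => // e; case/negP: ns; apply: le_trans le.
have /eqP <- := xmu q; rewrite -e; exact: lexx.
Qed.

Lemma coord_same q (H : xe q + (m - xe q) = m) (c : A (p (xs q)) i (m - xe q)) :
  coord q (gmul A H (xx q) c) = cls c.
Proof.
case: q H c => -[s [e x]] X M; rewrite /xx /xe /xs /= => H c; set q := XElt X M.
pose P := equal_sp (lin_comp (@coord_lin q) (gmul_lin_r H x))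
  (lpi_lin (@idset _ _ _ idl (sval s) i (m - e))).
suff : P c by [].
apply: (left_expansion (s := s)).
- move=> t dh dy E h y Hh Yy.
  suff : coord q (gmul A H x (gmul A E h y)) = cls (gmul A E h y) by [].
  rewrite gmulAl; set H' := assocl _ _.
  rewrite [LHS](coordE q (GTriple H' X Hh Yy)) /coord_val.
  case: pselect => [E'|[//]]; rewrite (Prop_irrelevance E' erefl) /=.
  by congr lpi; apply: gmul_irr.
- move=> s' d1 d2 E a b lt.
  have ns : ~~ (mu <= gdot s')%O by rewrite (lt_geF (lt_le_trans lt _)) // (eqP M).
  suff : coord q (gmul A H x (gmul A E a b)) = cls (gmul A E a b) by [].
  rewrite gmulAl coord_ideal; last exact: ideal_through.
  by apply/esym/lpi0P; apply: ideal_through.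
Qed.

Lemma coord_other q (s : sS) dx dc (H : dx + dc = m) (x : A j (sval s) dx) (c : A (sval s) i dc) :
  gX (g := T) (i := j) (s := s) (d := dx) x -> gdot s = mu ->
  Tagged _ (Tagged (fun e => A j (sval s) e : Type) x) <> xkey q ->
  coord q (gmul A H x c) = 0.
Proof.
move=> Xx es ne.
apply: (left_expansion (P := null_sp (lin_comp (coord_lin q) (gmul_lin_r H x)))) => /=.
- move=> t dh dy E h y Hh Yy; rewrite gmulAl; set H' := assocl _ _.
  rewrite [LHS](coordE q (GTriple H' Xx Hh Yy)) /coord_val.
  by case: pselect.
- move=> s' d1 d2 E a b lt; rewrite gmulAl coord_ideal //; apply: ideal_through.
  by rewrite -es (lt_geF lt).
Qed.

End At.

(** Coordinates are right A_mu-linear, so that they pass to tensor products. *)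
Lemma coord_mul q (s : gS_at T mu) i m1 m2 m (H : m1 + m2 = m) (H' : (m1 - xe q) + m2 = m - xe q)
    (a : A j (p s) m1) (b : A (p s) i m2) :
  coord q (gmul A H a b) = gmul (Age T mu) H' (coord q a) (cls b).
Proof.
pose P := equal_sp (lin_comp (@coord_lin i m q) (gmul_lin_l H b))
  (lin_comp (gmul_lin_l H' (cls b : Age T mu (p s) i m2)) (@coord_lin (p s) m1 q)).
suff : P a by [].
apply: (right_expansion (t := sval s)).
- move=> s1 dx dh E x h Xx Hh.
  suff : coord q (gmul A H (gmul A E x h) b) =
    gmul (Age T mu) H' (coord q (gmul A E x h)) (cls b) by [].
  clear P.
  have es1 : gdot s1 = mu by rewrite (gH_dot Hh); apply: gS_atP.
  have [e|ne] := pselect (Tagged _ (Tagged (fun e => A j (sval s1) e : Type) x) = xkey q).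
    have dhE : dh = m1 - dx by rewrite -E addrC addKr.
    subst dh; case: q H' e => key X M H' e; rewrite /= in e; subst key.
    set q := XElt X M.
    have -> : coord q (gmul A E x h) = cls h by apply: (coord_same (q := q)).
    rewrite gmulAr.
    have H2 : (m1 - dx) + m2 = m - dx := H'.
    have H3 : dx + (m - dx) = m by rewrite addrC subrK.
    have -> : gmul A (assocr E H) x (gmul A erefl h b) = gmul A H3 x (gmul A H2 h b).
      by move: (assocr E H); case: _ / (H2) (H3) => H4 H5; apply: gmul_irr.
    rewrite (coord_same (q := q)) age_mul; congr lpi; exact: gmul_irr.
  by rewrite gmulAr !coord_other // gmul0l.
- move=> t' d1 d2 E a1 b1 lt.
  suff : coord q (gmul A H (gmul A E a1 b1) b) =
    gmul (Age T mu) H' (coord q (gmul A E a1 b1)) (cls b) by [].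
  have nt : ~~ (mu <= gdot t')%O by rewrite (lt_geF (lt_le_trans lt _)) // (gS_atP s).
  have -> : coord q (gmul A E a1 b1) = 0 by apply: coord_ideal; apply: ideal_through.
  rewrite gmul0l.
  by rewrite gmulAr coord_ideal //; apply: ideal_through.
Qed.

Section OnTensors.
Variable M : gmod (Aat T mu).

Fact coord_tens_deg (m n d e : int) : m + n = d -> (m - e) + n = d - e.
Proof. by move=> <-; rewrite addrAC. Qed.

Lemma coord_cl q i m (a : A j i m) : coord q (lrepr (cls a)) = coord q a.
Proof.
apply/eqP; rewrite -subr_eq0 -(linB (@coord_lin i m q)); apply/eqP.
by apply: coord_ideal; apply: lrepr_pi.
Qed.

Lemma tcoord_exists d q : exists G : jlower M j d -> M (xs q) (d - xe q), lin G /\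
  forall s m n (H : m + n = d) (a : A j (p s) m) (v : M s n),
    G (pten H (cls a) v) =
    mact M (coord_tens_deg (xe q) H) (coord q a : Aat T mu (xs q) s (m - xe q)) v.
Proof.
have [|||G [Gl GE]] := @tens_lift _ _ _ p (Age T mu) M j d (M (xs q) (d - xe q))
  (fun s m n H a v => mact M (coord_tens_deg (xe q) H)
     (coord q (lrepr a) : Aat T mu (xs q) s (m - xe q)) v).
- move=> s m n H v c x y; rewrite -{1}(lreprK x) -{1}(lreprK y) -lpiL coord_cl.
  by rewrite coord_lin mact_linl.
- by move=> s m n H a c x y; rewrite mact_linr.
- move=> s t m c n mc cn H1 H2 H3 H4 a b v.
  have H1' : (m - xe q) + c = mc - xe q by rewrite -H1 addrAC.
  rewrite -{1}(lreprK a) -(lreprK b) age_mul coord_cl (coord_mul _ H1').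
  exact: (mactA H1' _ H3 _).
exists G; split=> // s m n H a v; rewrite GE coord_cl; reflexivity.
Qed.

Definition tcoord d q : jlower M j d -> M (xs q) (d - xe q) := projT1 (cid (tcoord_exists d q)).

Lemma tcoord_lin d q : lin (@tcoord d q).
Proof. by rewrite /tcoord; case: cid => h []. Qed.

Lemma tcoordE d q s m n (H : m + n = d) (a : A j (p s) m) (v : M s n) :
  tcoord q (pten H (cls a) v) =
  mact M (coord_tens_deg (xe q) H) (coord q a : Aat T mu (xs q) s (m - xe q)) v.
Proof. by rewrite /tcoord; case: cid => h [hl hE] /=; apply: hE. Qed.

Fact xdeg d q : xe q + (d - xe q) = d.
Proof. by rewrite addrC subrK. Qed.

(** A tensor is the sum of the x_q (x) v_q over its coordinates v_q.  Allowing every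
  sufficiently large finite set of indices makes this property additive. *)
Definition expands d (z : jlower M j d) : Prop :=
  exists l0 : seq {classic xelt j}, forall l : seq {classic xelt j}, uniq l -> {subset l0 <= l} ->
    z = \sum_(q <- l) pten (xdeg d q) (cls (xx q)) (tcoord (q : xelt j) z).

Program Definition expands_sp d : subsp (jlower M j d) := @Subsp k _ (@expands d) _ _.
Next Obligation.
move=> d; exists [::] => l _ _; rewrite big1 // => q _.
by rewrite (lin0 (@tcoord_lin d q)) (lin0 (pten_lin_r _ _)).
Qed.
Next Obligation.
move=> d c x y [l1 h1] [l2 h2]; exists (l1 ++ l2) => l ul sl.
rewrite {1}(h1 l) // => [|q ql]; last by apply: sl; rewrite mem_cat ql.
rewrite {1}(h2 l) // => [|q ql]; last by apply: sl; rewrite mem_cat ql orbT.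
rewrite scaler_sumr -big_split /=; apply: eq_bigr => q _.
by rewrite tcoord_lin -(pten_lin_r _ _).
Qed.

Lemma tens_expands d (z : jlower M j d) : expands z.
Proof.
apply: (pten_ind (P := expands_sp d)) => s m n H a v; rewrite -(lreprK a); move: (lrepr a) => {}a.
apply: (right_expansion (t := sval s) (P := preim_sp (lin_comp (pten_lin_l H v) (lpi_lin _))
  (expands_sp d))) => /=.
- move=> s1 dx dh E x h Xx Hh.
  have es1 : gdot s1 == mu by rewrite (gH_dot Hh); apply/eqP; apply: gS_atP.
  pose q0 : xelt j := @XElt j (Tagged _ (Tagged (fun e => A j (sval s1) e : Type) x)) Xx es1.
  have dhE : dh = m - dx by rewrite -E addrC addKr.
  subst dh; exists [:: q0 : {classic xelt j}] => l ul sl.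
  have q0l : (q0 : {classic xelt j}) \in l by apply: sl; rewrite mem_head.
  rewrite (bigD1_seq (q0 : {classic xelt j})) //= big1 => [|q ne]; last first.
    rewrite tcoordE coord_other ?mact0l ?(lin0 (pten_lin_r _ _)) //; first exact/eqP.
    move=> e; case/negP: ne; apply/eqP; exact: (@xelt_inj q q0).
  rewrite addr0 tcoordE; have -> : coord q0 (gmul A E x h) = cls h by apply: (coord_same (q := q0)).
  rewrite -(age_mul T mu).
  exact: (@pten_bal M j d (xs q0) s dx (m - dx) n m (d - dx) E H (coord_tens_deg dx H)
    (xdeg d q0) (cls x : Age T mu j (p (xs q0)) dx) (cls h : Aat T mu (xs q0) s (m - dx)) v).
- move=> t' d1 d2 E a1 b1 lt.
  have -> : cls (gmul A E a1 b1) = 0.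
    by apply/lpi0P; apply: ideal_through; rewrite (lt_geF (lt_le_trans lt _)) // (gS_atP s).
  by rewrite (lin0 (pten_lin_l _ _)); apply: (subsp0 (expands_sp d)).
Qed.

Lemma tcoord_eq0 d (z : jlower M j d) : (forall q, tcoord q z = 0) -> z = 0.
Proof.
move=> z0; have [l0 h] := tens_expands z.
have zE := h (undup l0) (undup_uniq _) (fun q ql => etrans (mem_undup l0 q) ql).
by rewrite zE big1 // => q _; rewrite z0 (lin0 (pten_lin_r _ _)).
Qed.

End OnTensors.

End Coordinates.

(** Tensors are determined by their coordinates, and these are natural in the module. *)
Lemma jlower_inj (M M' : gmod (Aat T mu)) (g : mor M M') (G : mor (jlower M) (jlower M')) :
  mor_inj g ->
  (forall j d s m n (H : m + n = d) (a : Age T mu j (p s) m) (v : M s n),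
     mfun G (pten H a v) = pten H a (mfun g v)) -> mor_inj G.
Proof.
move=> gi GE j d z Gz; apply: tcoord_eq0 => q; apply: gi.
have nat : tcoord q (mfun G z) = mfun g (tcoord q z).
  apply: (pten_ind (P := equal_sp (lin_comp (@tcoord_lin j M' d q) (mfun_lin G j d))
    (lin_comp (mfun_lin g _ _) (@tcoord_lin j M d q)))) => s m n H a v /=.
  by rewrite GE -(lreprK a) !tcoordE mfun_act.
by rewrite -nat Gz (lin0 (@tcoord_lin j M' d q)).
Qed.

End Induced.

(** * Layers are coinduced from injective modules *)

Section LayerInjective.
Variables (k : fieldType) (disp : Order.disp_t) (Lam : porderType disp).
Variables (I : Type) (A : galg k I) (T : gtbasis Lam A).
Variable V : gmod A.
Variables (mu : Lam) (D : Lam -> Prop).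
Hypothesis Dlow : forall nu, (nu < mu)%O -> D nu.
Hypothesis Dup : forall nu, D nu -> ~~ (mu <= nu)%O.
Notation N := (vanish T V D).
Notation p := (@gS_at_val _ _ _ _ _ T mu).
Notation idl := (ideal_not_ge T mu).
Notation cls a := (lpi (@idset _ _ _ idl _ _ _) a).
Notation W := (layer_mod T V Dlow).

Lemma lrepr_kills_right (s : gS_at T mu) j d n m (H : d + n = m) (a : A j (p s) d) (v : W s n) :
  mact V H (lrepr (cls a)) (val v) = mact V H a (val v).
Proof.
apply/eqP; rewrite -subr_eq0 -(linB (mact_lin_l V H (val v))); apply/eqP.
apply: (@ideal_kills_right _ _ _ _ _ T V mu D Dlow (sval s)).
- exact: gS_atP.
- exact: lrepr_pi.
- exact: lsub_valP.
Qed.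

Lemma layer_adjoint (M : gmod (Aat T mu)) (f : mor M W) :
  exists F : mor (jlower M) V, forall j d s m n (H : m + n = d) (a : A j (p s) m) (v : M s n),
    mfun F (pten H (cls a) v) = mact V H a (val (mfun f v)).
Proof.
have [||||F FE] := @jlower_lift _ _ _ _ _ T mu M V
  (fun j d s m n H a v => mact V H (lrepr a) (val (mfun f v))).
- move=> j d s m n H v c x y; rewrite -{1}(lreprK x) -{1}(lreprK y) -lpiL.
  by rewrite lrepr_kills_right mact_linl.
- by move=> j d s m n H a c x y; rewrite (mfun_lin f) lsub_valD lsub_valZ mact_linr.
- move=> j d s t m c n mc cn H1 H2 H3 H4 a b v.
  rewrite -{1}(lreprK a) -(lreprK b) age_mul lrepr_kills_right mfun_act layer_modE.
  exact: mactA.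
- move=> i j d e f' H b s m n Hx a v dm H1 H2.
  by rewrite -{1}(lreprK a) age_mul lrepr_kills_right; apply: mactA.
by exists F => j d s m n H a v; rewrite FE lrepr_kills_right.
Qed.

(** By adjunction a map M -> e_mu V^D is a map j_! M -> V; it extends to j_! M' because
  j_! M -> j_! M' is injective, and the restriction of the extension to the elements
  1 (x) v takes values in V^D, as e_nu kills them in A_(>= mu) for nu in [D]. *)
Lemma layer_injective : injective_mod V -> injective_mod W.
Proof.
move=> injV M M' g f gi.
have [||||G GE] := @jlower_lift _ _ _ _ _ T mu M (jlower M')
  (fun j d s m n H a v => pten H a (mfun g v)).
- by move=> *; apply: pten_lin_l.
- by move=> j d s m n H a c x y; rewrite (mfun_lin g) pten_lin_r.
- by move=> *; rewrite mfun_act; apply: pten_bal.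
- by move=> i j d e f' H b s m n Hx a v dm H1 H2; rewrite (pten_act _ _ _ _ _ H1 H2).
have Gi := jlower_inj gi GE.
have [F FE] := layer_adjoint f.
have [h hP] := injV _ _ G F Gi.
pose psi (s : gS_at T mu) n (v : M' s n) : V (p s) n := mfun h (pten (add0r n) (cls (gone A (p s))) v).
have psia (s : gS_at T mu) n (v : M' s n) j d m (H : d + n = m) (a : A j (p s) d) :
    mact V H a (psi s n v) = mfun h (pten H (cls a) v).
  by rewrite -mfun_act (pten_act _ _ _ _ _ (addr0 d) H) age_mul gmul1r.
have psiN s n v : smset N (psi s n v).
  move=> t d m H a Dt; rewrite psia.
  have -> : cls a = 0.
    apply/lpi0P; rewrite -(gmul1l (add0r d) a); apply: ideal_through; exact: Dup.
  by rewrite (lin0 (pten_lin_l _ _)) mfun0.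
pose phi s n (v : M' s n) : W s n := lsub_in (psiN s n v).
have phil s n : lin (phi s n).
  move=> c x y; apply: lsub_inj; rewrite lsub_valD lsub_valZ /= /psi pten_lin_r.
  exact: mfun_lin.
have phia (s t : gS_at T mu) c n n' (H : c + n = n') (b : Aat T mu s t c) v :
    phi s n' (mact M' H b v) = mact W H b (phi t n v).
  rewrite -(lreprK b); apply: lsub_inj; rewrite layer_modE /= psia /psi.
  rewrite -(pten_bal (add0r c) H H (add0r n')); congr (mfun h (pten _ _ _)).
  by rewrite age_mul gmul1l.
exists (mor_of phil phia) => s n v; rewrite mor_ofE; apply: lsub_inj.
by rewrite /= /psi -GE hP FE mact1.
Qed.

End LayerInjective.

(** * Flags of injective hulls *)

Section Flag.
Variables (k : fieldType) (disp : Order.disp_t) (Lam : porderType disp).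
Variables (I : Type) (A : galg k I) (T : gtbasis Lam A).

(** A linear extension of the finite order below [lam]: sort by the number of smaller
  elements. *)
Lemma linear_extension_below (lam : Lam) : exists s : seq Lam,
  [/\ uniq s, forall nu, (nu \in s) = (nu <= lam)%O &
      forall j, (j < size s)%N -> forall nu, (nu < nth lam s j)%O -> nu \in take j s].
Proof.
have /finite_seqP [s1 es] := gLam_fin T lam.
have ms1 nu : (nu \in s1) = (nu <= lam)%O.
  by apply/idP/idP => h; have := f_equal (fun X : Lam -> Prop => X nu) es; rewrite /= => e;
    [rewrite e | rewrite -e].
pose s0 := undup s1; pose key x := count (fun y => (y <= x)%O) s0.
pose s := sort (fun x y => (key x <= key y)%N) s0.
have us : uniq s by rewrite sort_uniq undup_uniq.
have ms nu : (nu \in s) = (nu <= lam)%O by rewrite mem_sort mem_undup ms1.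
have srt : sorted (fun x y => (key x <= key y)%N) s.
  by apply: sort_sorted => x y; apply: leq_total.
exists s; split=> // j js nu lt; set mu := nth lam s j in lt *.
have mus : mu \in s by apply: mem_nth.
have nus : nu \in s by move: mus; rewrite !ms; apply: le_trans (ltW lt).
have klt : (key nu < key mu)%N.
  have mus0 : mu \in s0 by move: mus; rewrite mem_sort.
  rewrite /key.
  have := count_predUI (fun y => (y <= nu)%O) (pred1 mu) s0.
  have -> : count (predI (fun y => (y <= nu)%O) (pred1 mu)) s0 = 0%N.
    rewrite (@eq_count _ _ pred0) ?count_pred0 // => x /=.
    by apply/negbTE/negP => /andP [xnu /eqP e]; move: xnu; rewrite e (lt_geF lt).
  rewrite addn0 count_uniq_mem ?undup_uniq // mus0 addn1 => <-.
  apply: sub_count => x /= /orP [xnu|/eqP ->]; last exact: lexx.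
  exact: le_trans xnu (ltW lt).
have i_s : (index nu s < size s)%N by rewrite index_mem.
have ij : (index nu s < j)%N.
  rewrite ltnNge; apply/negP => ji.
  have := @sorted_leq_nth _ (fun x y => (key x <= key y)%N)
    (fun y x z => @leq_trans (key y) (key x) (key z)) (fun x => leqnn _) lam s srt
    j (index nu s) js i_s ji.
  by rewrite nth_index // -/mu leqNgt klt.
by rewrite in_take.
Qed.

Lemma vanish_ext V (D D' : Lam -> Prop) : (forall nu, D nu <-> D' nu) ->
  vanish T V D = vanish T V D'.
Proof. by move=> e; congr vanish; apply: funext => nu; apply: propext. Qed.

(** The r-th term of the flag is V^D for D the first r weights of a linear extension. *)
Theorem nabla_flag (J : gmod A) (lam : Lam) :
  injective_mod J -> mod_locally_findim J -> mod_bounded_above J ->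
  sm_is_zero (vanish T J (fun nu => (nu <= lam)%O)) -> has_nabla_flag T J.
Proof.
move=> injJ finJ bndJ Jz; have [s [us ms low]] := linear_extension_below lam.
pose D r nu := nu \in take r s.
have Dlow r : (r < size s)%N -> forall nu, (nu < nth lam s r)%O -> D r nu by apply: low.
have Dup r : (r < size s)%N -> forall nu, D r nu -> ~~ (nth lam s r <= nu)%O.
  move=> rs nu Dnu; have nus : nu \in s by apply: mem_take Dnu.
  have ir : (index nu s < r)%N by rewrite -in_take.
  have i_s : (index nu s < size s)%N by rewrite index_mem.
  apply/negP; rewrite le_eqVlt => /orP [/eqP e|lt].
    by move: ir; rewrite -e index_uniq ?ltnn.
  have := low _ i_s (nth lam s r); rewrite nth_index // => /(_ lt).
  by rewrite in_take ?mem_nth // index_uniq // ltnNge (ltnW ir).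
have DS r : (r < size s)%N -> forall nu, D r.+1 nu <-> add_mu (nth lam s r) (D r) nu.
  move=> rs nu; rewrite /D (take_nth lam rs) mem_rcons inE /add_mu.
  by split=> [/orP [/eqP|]|[|->]]; [right|left| by rewrite orbC => -> | rewrite eqxx].
exists (size s), (fun r => vanish T J (D r)), (fun r : 'I_(size s) => nth lam s r); split.
- split=> [i n v t d m H a|i n v|r rs i n v h t d m H a Dt]; first by rewrite /D take0.
    rewrite (@vanish_ext J _ (fun nu => (nu <= lam)%O)); first exact: Jz.
    by move=> nu; rewrite /D take_size ms.
  by apply: h; apply/(DS _ rs); left.
- move=> r r' e; apply: val_inj; apply/eqP.
  by rewrite -(nth_uniq lam (ltn_ord r) (ltn_ord r') us) e.
- move=> r; have rs := ltn_ord r; exists (layer_mod T J (Dlow r rs)); split.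
  + by apply: layer_injective injJ; apply: Dup.
  + exact: layer_findim.
  + exact: layer_bounded.
  rewrite (vanish_ext J (DS r rs)); apply/gsection_iso; last first.
    by apply: layer_section_iso injJ; apply: Dup.
  by move=> i n v h t d m H a Dt; apply: h; left.
Qed.

(** j_! P is generated by the elements 1 (x) z, which lie in the components 1_s with s
  in S_lam. *)
Lemma jlower_quot_support (lam : Lam) (P : gmod (Aat T lam)) (L : gmod A)
    (f : mor (jlower P) L) : mor_surj f -> (exists i n (l : L i n), l <> 0) ->
  exists (s : gS_at T lam) n (z : P s n),
    mfun f (pten (add0r n) (lpi _ (gone A (gS_at_val s))) z) <> 0.
Proof.
move=> fs [i [n [l nl]]]; apply: contrapT => no; apply: nl.
have [x <-] := fs i n l.
apply: (pten_ind (P := null_sp (mfun_lin f i n))) => s m e H a z /=.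
have -> : pten H a z = mact (jlower P) H (lrepr a) (pten (add0r e) (lpi _ (gone A (gS_at_val s))) z).
  by rewrite (pten_act _ _ _ _ _ (addr0 m) H) (age_mul T lam) gmul1r lreprK.
rewrite mfun_act [mfun f _](_ : _ = 0) ?mact0r //.
by apply: contrapT => nz; apply: no; exists s, e, z.
Qed.

Lemma hull_vanish (lam : Lam) (L J : gmod A) (iota : mor L J) :
  irr_elt L -> mor_inj iota -> ess_elt iota ->
  (exists (s : gS_at T lam) n (l : L (gS_at_val s) n), l <> 0) ->
  sm_is_zero (vanish T J (fun nu => (nu <= lam)%O)).
Proof.
move=> irrL ii ie [s [n0 [l0 nl0]]] i n w Nw; apply: contrapT => nw.
have [j [m [d [H [a [l [nl e1]]]]]]] := ie _ _ _ nw.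
have [d' [H' [b e2]]] := irrL.2 _ _ _ nl _ _ l0.
apply: nl0; apply: ii; rewrite -e2 mfun_act -e1.
by apply: (sm_act H a Nw); rewrite (gS_atP s).
Qed.

(** A nonzero [w] of degree d is carried by some [a] to a fixed nonzero vector of the
  socle, so the degree of [a] decreases as d grows, and it is bounded below. *)
Lemma hull_bounded (L J : gmod A) (iota : mor L J) : alg_bounded_below A ->
  irr_elt L -> mor_inj iota -> ess_elt iota -> mod_bounded_above J.
Proof.
move=> Ab [[i0 [n0 [l0 nl0]]] irr] ii ie i; have [N NP] := Ab i0 i.
exists (n0 - N) => d dN w; apply: contrapT => nw.
have [j [m [c [H [a [l [nl e1]]]]]]] := ie _ _ _ nw.
have [c' [H' [b e2]]] := irr _ _ _ nl _ _ l0.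
apply: nl0; apply: ii; rewrite -e2 mfun_act -e1 mactAl.
rewrite (NP _ _ (gmul A erefl b a)) ?mact0l ?mfun0 //.
have -> : c' + c = n0 - d by rewrite -H' -H addrA addrK.
by rewrite ltrBlDr -ltrBlDl.
Qed.

End Flag.

Section Finiteness.
Variables (k : closedFieldType) (disp : Order.disp_t) (Lam : porderType disp).
Variables (I : Type) (A : galg k I) (T : gtbasis Lam A).
Hypothesis Af : alg_locally_findim A.
Hypothesis Ab : alg_bounded_below A.

Program Definition act_on (J : gmod A) i d (v : J i d) : ghom (lreg A i) J d :=
  @ghom_of _ _ _ (lreg A i) J d (fun j n (a : A j i n) => mact J erefl a v) _ _.
Next Obligation. by move=> J i d v j n c x y; apply: mact_linl. Qed.
Next Obligation. by move=> J i d v j l c n n' H H' a b; apply: mactA. Qed.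

(** The space 1_i J_d is Hom(A 1_i, J)_d. *)
Lemma hull_findim (L J : gmod A) : irreducible L -> injective_hull J L -> mod_locally_findim J.
Proof.
move=> irrL hull i d.
have [m [_ /(_ d) dm]] := comp_mult_hull Af irrL hull (V := lreg A i) (fun j d => Af j i d).
apply: (fin_dim_surj (f := fun f : ghom (lreg A i) J d => hfun f (add0r d) (gone A i))).
- by move=> c f g.
- move=> v; exists (act_on v); rewrite hfunE /=.
  have gen m' (e : 0 + d = m') : dcast e (mact J erefl (gone A i) v) = mact J e (gone A i) v.
    by case: m' / e.
  by rewrite gen mact1.
- by exists (m (- d)).
Qed.

Lemma Age_findim mu i j d : fin_dim (Age T mu i j d).
Proof.
apply: (fin_dim_surj (f := fun a : A i j d => lpi _ a : Age T mu i j d)) (Af i j d).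
  exact: lpi_lin.
by move=> a; exists (lrepr a); apply: lreprK.
Qed.

(** In a tensor a (x) v of given degree, the degrees of [a] and [v] are both bounded
  below, and S_mu is finite; so finitely many pairs of finite-dimensional spaces
  contribute. *)
Lemma jlower_findim mu (E : gmod (Aat T mu)) : irreducible E -> mod_locally_findim (jlower E).
Proof.
move=> /irreducible_elt irrE j d.
have AtF : alg_locally_findim (Aat T mu) by move=> s t e; apply: Age_findim.
have Ef := irr_locally_findim irrE AtF.
have [[s0 [n0 [v0 nv0]]] irr] := irrE.
have [B1 B1P] : {B1 : gS_at T mu -> int & forall s m, m < B1 s ->
    forall a : Age T mu j (gS_at_val s) m, a = 0}.
  apply: (@choice _ _ (fun s b => forall m, m < b ->
    forall a : Age T mu j (gS_at_val s) m, a = 0)) => s.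
  have [b bP] := Ab j (gS_at_val s); exists b => m mb a.
  by rewrite -(lreprK a) (bP _ mb (lrepr a)); apply/lpi0P; apply: subsp0.
have [B2 B2P] : {B2 : gS_at T mu -> int & forall s n, n < B2 s -> forall v : E s n, v = 0}.
  apply: (@choice _ _ (fun s b => forall n, n < b -> forall v : E s n, v = 0)) => s.
  have [b bP] := Ab (gS_at_val s) (gS_at_val s0); exists (b + n0) => n nb v.
  have [c [H [a <-]]] := irr _ _ _ nv0 s n v.
  have a0 : a = 0.
    rewrite -(lreprK a) (bP _ _ (lrepr a)); first by apply/lpi0P; apply: subsp0.
    by move: nb; rewrite -H ltrD2r.
  by rewrite a0 mact0l.
have piece (sm : gS_at T mu * int) : exists l : seq (jlower E j d),
    forall n (H : sm.2 + n = d) (a : Age T mu j (gS_at_val sm.1) sm.2) (v : E sm.1 n),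
    lspan l (pten H a v).
  case: sm => s m /=.
  have [la laP] := fin_dim_lspan (Age_findim mu j (gS_at_val s) m).
  have [lv lvP] := fin_dim_lspan (Ef s (d - m)).
  have H0 : m + (d - m) = d by rewrite addrC subrK.
  exists [seq pten H0 a v | a <- la, v <- lv] => n H a v U Ux.
  have e : n = d - m by rewrite -H addrC addKr.
  subst n; rewrite (Prop_irrelevance H H0).
  apply: (laP a (preim_sp (pten_lin_l H0 v) U)) => a' a'l.
  apply: (lvP v (preim_sp (pten_lin_r H0 a') U)) => v' v'l /=.
  by apply: Ux; apply: allpairs_f.
have [pc pcP] := choice piece.
have /(@finite_seqP {classic {s : I | s \in gS T}}) [ls lsP] := gdot_fin T mu.
have inls (s : gS_at T mu) : (sval s : {classic _}) \in ls.
  have := f_equal (fun X : {s : I | s \in gS T} -> Prop => X (sval s)) lsP.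
  by rewrite /= => <-; apply: gS_atP.
pose degs (s : gS_at T mu) := [seq B1 s + i%:Z | i <- iota 0 (absz (d - B2 s - B1 s)%R).+1].
pose at_s (s : gS_at T mu) := flatten [seq pc (s, m) | m <- degs s].
pose at_t (t : {classic {s : I | s \in gS T}}) :=
  if @idP (gdot (t : {s : I | s \in gS T}) == mu) is ReflectT E' then at_s (exist _ t E') else [::].
apply: (@lspan_fin_dim _ _ (flatten (map at_t ls))) => x U Ux; move: x.
apply: pten_ind => s m n H a v.
have [mB|Bm] := ltP m (B1 s).
  by rewrite (B1P s m mB a) (lin0 (pten_lin_l _ _)); apply: subsp0.
have [nB|Bn] := ltP n (B2 s).
  by rewrite (B2P s n nB v) (lin0 (pten_lin_r _ _)); apply: subsp0.
apply: (pcP (s, m) n H a v U) => y yp; apply: Ux.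
apply/flatten_mapP; exists (sval s); first exact: inls.
rewrite /at_t (if_idP_true _ _ (valP s)).
have -> : exist _ (sval s) (valP s) = s.
  by case: (s) => t pt /=; congr exist; apply: Prop_irrelevance.
apply/flatten_mapP; exists m => //.
have le0 : 0 <= m - B1 s by rewrite subr_ge0.
have mE : m = B1 s + (absz (m - B1 s)%R)%:Z by rewrite gez0_abs // addrC subrK.
apply/mapP; exists (absz (m - B1 s)%R) => //; rewrite mem_iota /= add0n ltnS.
have le1 : m - B1 s <= d - B2 s - B1 s.
  by rewrite lerD2r -H -addrA lerDl subr_ge0.
by rewrite -lez_nat !gez0_abs // (le_trans le0).
Qed.

End Finiteness.

(** * Duality *)

Section Pairings.
Variables (k : fieldType) (I : Type) (A : galg k I).

(** A perfect pairing between graded modules that turns the action of [a] into that of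
  the elements related to it by [rho], the graph of an anti-automorphism.  Working with
  the graph makes the notion symmetric in the two modules. *)
Record pairing (rho : forall i j d, A i j d -> A j i d -> Prop) (V W : gmod A) := Pairing {
  pr :> forall i n m, n + m = 0 :> int -> V i n -> W i m -> k^o;
  pr_lin_l : forall i n m (H : n + m = 0) (w : W i m), lin (fun v : V i n => pr H v w);
  pr_lin_r : forall i n m (H : n + m = 0) (v : V i n), lin (fun w : W i m => pr H (v : V i n) w);
  pr_adj : forall i j c (a : A i j c) (a' : A j i c), rho i j c a a' ->
    forall n n1 m m1 (H1 : c + n = n1) (H2 : n1 + m = 0) (H3 : c + m = m1) (H4 : n + m1 = 0) (v : V j n) (w : W i m),
    pr H2 (mact V H1 a v) w = pr H4 v (mact W H3 a' w);
  pr_nondeg_l : forall i n m (H : n + m = 0) (v : V i n), (forall w, pr H v w = 0) -> v = 0;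
  pr_nondeg_r : forall i n m (H : n + m = 0) (w : W i m), (forall v, pr H v w = 0) -> w = 0 }.

Fact flip_deg (n m : int) : n + m = 0 -> m + n = 0.
Proof. by rewrite addrC. Qed.

Program Definition pairing_flip rho V W (b : pairing rho V W) :
    pairing (fun i j d a a' => rho j i d a' a) W V :=
  @Pairing (fun i j d a a' => rho j i d a' a) W V (fun i m n H w v => pr b (flip_deg H) v w) _ _ _ _ _.
Next Obligation. by move=> rho V W b i n m H w; apply: pr_lin_r. Qed.
Next Obligation. by move=> rho V W b i n m H w; apply: pr_lin_l. Qed.
Next Obligation.
move=> rho V W b i j c a a' r n n1 m m1 H1 H2 H3 H4 v w /=.
by rewrite -(pr_adj b r H3 (flip_deg H4) H1 (flip_deg H2)).
Qed.
Next Obligation. by move=> rho V W b i n m H v h; apply: (pr_nondeg_r (p := b) (H := flip_deg H)). Qed.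
Next Obligation. by move=> rho V W b i n m H v h; apply: (pr_nondeg_l (p := b) (H := flip_deg H)). Qed.

Lemma pairing_findim rho V W (b : pairing rho V W) :
  mod_locally_findim V -> mod_locally_findim W.
Proof.
move=> fV i m; have H : - m + m = 0 by rewrite addNr.
apply: (fin_dim_pairing (b := @pr _ _ _ b i (- m) m H)) (fV i (- m)) _.
- exact: pr_lin_l.
- exact: pr_lin_r.
- exact: pr_nondeg_l.
- exact: pr_nondeg_r.
Qed.

Section Annihilators.
Variable rho : forall i j d, A i j d -> A j i d -> Prop.
Hypothesis rho_l : forall i j d (a' : A j i d), exists a, rho a a'.
Variables (V W L L' : gmod A) (b : pairing rho V W) (c : pairing rho L L').
Hypothesis fV : mod_locally_findim V.
Hypothesis fL : mod_locally_findim L.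

Program Definition ann (U : gsubmod V) : gsubmod W := @GSubmod _ _ _ W
  (fun i m => @Subsp k _ (fun w => forall n (H : n + m = 0) v, smset U v -> pr b H v w = 0) _ _) _.
Next Obligation. by move=> U i m n H v _; rewrite (lin0 (pr_lin_r b H v)). Qed.
Next Obligation.
move=> U i m a x y hx hy n H v Uv.
by rewrite (pr_lin_r b H v) hx // hy // scaler0 addr0.
Qed.
Next Obligation.
move=> U j i d m m1 H3 a' w hw n H4 v Uv; have [a r] := rho_l a'.
have H2 : d + n + m = 0 by rewrite addrAC H3 addrC.
by rewrite -(pr_adj b r erefl H2 H3 H4); apply: hw; apply: sm_act.
Qed.

Fact pair_shift_deg (e n m : int) : n + m = 0 -> (n - e) + (m - - e) = 0.
Proof. by move=> H; rewrite opprK addrACA H addNr addr0. Qed.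

(** The section U^perp / U'^perp is the dual of U'/U: vectors of [W] that annihilate [U]
  induce linear forms on the components of q^e L, which [c] represents by vectors of
  q^(-e) L'; and every such form extends to the finite-dimensional component of [V] and
  is represented there by [b]. *)
Lemma ann_section (U' U : gsubmod V) e : sm_le U U' ->
  sect_iso U' U (gshift e L) -> sect_iso (ann U) (ann U') (gshift (- e) L').
Proof.
move=> UU' [R [gR Rd Rk Rs]].
have R0 i n l : R i n 0 l -> l = 0 by move/Rk => <-; apply: subsp0.
exists (fun i m (w : W i m) (l' : gshift (- e) L' i m) => smset (ann U) w /\
  forall n (H : n + m = 0) (v : V i n) (l : L i (n - e)), R i n v l ->
  pr b H v w = pr c (pair_shift_deg e H) l l').
have neg (n m : int) : n + m = 0 -> n = - m by move=> H; apply/eqP; rewrite -addr_eq0 H.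
split.
- split.
  + move=> i m; split=> [|n H v l _]; first exact: subsp0.
    by rewrite (lin0 (pr_lin_r b H v)) (lin0 (pr_lin_r c _ l)).
  + move=> i m a w w' l l' [aw hw] [aw' hw']; split=> [|n H v x Rx]; first exact: subspL.
    by rewrite (pr_lin_r b H v) (pr_lin_r c _ x) (hw _ _ _ _ Rx) (hw' _ _ _ _ Rx).
  + move=> j i d m m1 H3 a' w l' [aw hw]; split=> [|n H4 v x Rx]; first exact: sm_act.
    have [a r] := rho_l a'.
    have H2 : d + n + m = 0 by rewrite addrAC H3 addrC.
    have H1 : d + (n - e) = d + n - e by rewrite addrA.
    rewrite -(pr_adj b r erefl H2 H3 H4).
    rewrite (hw _ _ _ _ (gcorrA gR (erefl (d + n)) a Rx)).
    exact: (pr_adj c r (gshift_deg e erefl) _ (gshift_deg (- e) H3)).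
- move=> i m w; split=> [aw|[l' []] //].
  have H : - m + m = 0 by rewrite addNr.
  have [|||||w' w'P] := @represent k _ _ (@pr _ _ _ c i _ _ (pair_shift_deg e H)) _ _ _
    (fun l x => exists2 v, R i (- m) v l & x = pr b H v w) (fL i _).
  + exact: pr_lin_l.
  + exact: pr_lin_r.
  + exact: pr_nondeg_l.
  + move=> a l l' x x' [v Rv ->] [v' Rv' ->]; exists (a *: v + v'); first exact: (gcorrL gR).
    by rewrite (pr_lin_l b H w).
  + by move=> x [v Rv ->]; apply: aw; apply/(Rk _ _ _ _ Rv).
  exists w'; split=> // n H' v l Rv; have e1 := neg _ _ H'; subst n.
  by rewrite (Prop_irrelevance H' H) (w'P _ (pr b H v w)) //; exists v.
- move=> i m w l' [aw hw]; have H : - m + m = 0 by rewrite addNr.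
  split=> [aw'|l0].
    apply: (pr_nondeg_r (p := c) (H := pair_shift_deg e H)) => l.
    have [v Rv] := Rs i (- m) l; rewrite -(hw _ _ _ _ Rv); apply: aw'.
    by apply/Rd; exists l.
  move=> n H' v /Rd [l Rl]; rewrite (hw _ _ _ _ Rl) l0.
  by rewrite (lin0 (pr_lin_r c _ l)).
- move=> i m l'; have H : - m + m = 0 by rewrite addNr.
  have [|||||w wP] := @represent k _ _ (@pr _ _ _ b i _ _ H) _ _ _
    (fun v x => exists2 l, R i (- m) v l & x = pr c (pair_shift_deg e H) l l') (fV i _).
  + exact: pr_lin_l.
  + exact: pr_lin_r.
  + exact: pr_nondeg_l.
  + move=> a v v' x x' [l Rl ->] [y Ry ->]; exists (a *: l + y); first exact: (gcorrL gR).
    by rewrite (pr_lin_l c _ l').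
  + by move=> x [l /R0 -> ->]; rewrite (lin0 (pr_lin_l c _ l')).
  have wE n (H' : n + m = 0) v l : R i n v l -> pr b H' v w = pr c (pair_shift_deg e H') l l'.
    move=> Rv; have e1 := neg _ _ H'; subst n; rewrite (Prop_irrelevance H' H).
    by apply: wP; exists l.
  exists w; split=> // n H' v Uv; have /Rd [l Rl] := UU' _ _ _ Uv.
  by rewrite (wE _ _ _ _ Rl) ((Rk _ _ _ _ Rl).1 Uv) (lin0 (pr_lin_l c _ l')).
Qed.

Lemma ann_filtration n (F : nat -> gsubmod V) e : filtration n F ->
  exists G : nat -> gsubmod W, filtration n G /\
    (section_count L e n F <= section_count L' (- e) n G)%N.
Proof.
move=> [F0 Fn dF]; exists (fun r => ann (F (n - r)%N)).
have ann_le U U' : sm_le U U' -> sm_le (ann U') (ann U).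
  by move=> h i m w hw p H v Uv; apply: hw; apply: h.
split.
  split=> [i m w p H v|i m w aw|r rn].
  - by rewrite subn0 => /Fn ->; rewrite (lin0 (pr_lin_l b H w)).
  - have H : - m + m = 0 by rewrite addNr.
    apply: (pr_nondeg_r (p := b) (H := H)) => v; apply: aw; rewrite subnn; exact: F0.
  - apply: ann_le; rewrite -(subnSK rn); apply: dF.
    by rewrite ltn_subrL /= (leq_ltn_trans _ rn).
rewrite !section_countE /iso_count [X in (_ <= X)%N](reindex_inj rev_ord_inj) /=.
apply: leq_sum => r _; have rn := ltn_ord r.
have -> : (n - (n - r.+1) = r.+1)%N by rewrite subKn.
have -> : (n - (n - r.+1).+1 = r)%N by rewrite subnSK // subKn // ltnW.
have le : sm_le (F r.+1) (F r) by apply: dF.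
case: asboolP => // /(gsection_iso _ le) iso; rewrite asboolT //.
apply/gsection_iso; first exact: ann_le.
exact: ann_section.
Qed.

End Annihilators.

(** Annihilators of a filtration of [V] show that [W] has at least as many sections
  q^(-e) L' as [V] has sections q^e L.  The flipped pairings give the converse. *)
Lemma comp_mult_pairing (rho : forall i j d, A i j d -> A j i d -> Prop) V W L L' m
    (b : pairing rho V W) (c : pairing rho L L') :
  (forall i j d (a' : A j i d), exists a, rho i j d a a') ->
  (forall i j d (a : A i j d), exists a', rho i j d a a') ->
  mod_locally_findim V -> mod_locally_findim L ->
  comp_mult V L m -> comp_mult W L' (bar_series m).
Proof.
move=> rl rr fV fL mV d.
have [[n [F [fF cF]]] mx] := mV (- d).
have up n' G : filtration n' G -> (section_count (V := W) L' d n' G <= m (- d)%R)%N.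
  move=> fG.
  have [F' [fF' le]] := ann_filtration (rho := fun i j d a a' => rho j i d a' a)
    (fun i j d a => rr j i d a)
    (pairing_flip b) (pairing_flip c)
    (pairing_findim b fV) (pairing_findim c fL) d fG.
  by apply: leq_trans le _; apply: mx.
split; last exact: up.
have [G [fG le]] := ann_filtration rl b c fV fL (- d) fF.
exists n, G; split=> //; apply/eqP; rewrite eqn_leq up //=.
by rewrite /bar_series -cF; move: le; rewrite opprK.
Qed.

Variable tau : duality A.
Definition graph i j d (a : A i j d) (a' : A j i d) : Prop := a' = du tau a.

Lemma graph_l i j d (a' : A j i d) : exists a, graph (i := i) (j := j) a a'.
Proof. by have [g gK gK'] := du_bij tau i j d; exists (g a'). Qed.

Lemma graph_r i j d (a : A i j d) : exists a', graph a a'.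
Proof. by exists (du tau a). Qed.

Lemma self_dual_pairing (L : gmod A) : mod_locally_findim L ->
  giso (gdual tau L) L -> inhabited (pairing graph L L).
Proof.
move=> fL [g [gi gs]].
have [chi chiP] : {chi : forall i n, L i n -> gdual tau L i n &
    forall i n (l : L i n), mfun g (chi i n l) = l}.
  exists (fun i n l => projT1 (cid (gs i n l))) => i n l; by case: cid.
have chiK i n x : chi i n (mfun g x) = x.
  apply/eqP; rewrite -subr_eq0; apply/eqP; apply: gi.
  by rewrite (linB (mfun_lin g i n)) chiP subrr.
have chil i n : lin (chi i n).
  by move=> a x y; rewrite -[RHS]chiK (mfun_lin g) !chiP.
have chia i j d n m (H : d + n = m) (a : A i j d) l :
    chi i m (mact L H a l) = mact (gdual tau L) H a (chi j n l).
  by rewrite -[RHS]chiK mfun_act chiP.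
have neg (n m : int) : n + m = 0 -> m = - n.
  by move=> H; apply/eqP; rewrite -addr_eq0 addrC H.
pose b i n m (H : n + m = 0) (l l' : L i _) : k^o := val (chi i n l) (dcast (neg n m H) l').
split; apply: (@Pairing graph L L b).
- move=> i n m H l' a x y; rewrite /b chil lsub_valD lsub_valZ; reflexivity.
- by move=> i n m H l a x y; rewrite /b dcast_lin dual_lin.
- move=> i j d a a' -> n n1 m m1 H1 H2 H3 H4 v w; rewrite /b chia /=; congr (val _ _).
  symmetry; apply: dcast_act.
- move=> i n m H l h; rewrite -(chiP _ _ l); have -> : chi i n l = 0; last exact: mfun0.
  apply: lsub_inj; rewrite lsub_val0; apply: funext => x.
  have e : - n = m by rewrite (neg _ _ H).
  have := h (dcast e x); rewrite /b.
  have -> : dcast (neg n m H) (dcast e x) = x.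
    by move: (neg n m H) => e'; case: m / e e' H h => e' _ _; apply: dcast_id.
  exact.
- move=> i n m H l h; apply: contrapT => nl.
  have nl' : dcast (neg n m H) l <> 0.
    move=> e; apply: nl; move: (neg n m H) e => e1 e; move: l H h e; case: _ / e1.
    by move=> l _ _; rewrite dcast_id.
  have [phi [phil nz]] := separating_form (fL i (- n)) nl'.
  pose x : gdual tau L i n := @lsub_in _ _ (linear_forms (L i (- n))) phi phil.
  by apply: nz; have := h (mfun g x); rewrite /b chiK.
Qed.

End Pairings.

Section InverseDuality.
Variables (k : fieldType) (I : Type) (A : galg k I) (tau : duality A).

Lemma du_surj i j d (a : A j i d) : exists b : A i j d, du tau b = a.
Proof. by have [g gK gK'] := du_bij tau i j d; exists (g a). Qed.

Definition dinv i j d (a : A i j d) : A j i d := projT1 (cid (du_surj a)).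

Lemma dinvK i j d (a : A i j d) : du tau (dinv a) = a.
Proof. by rewrite /dinv; case: cid. Qed.

Lemma du_inj i j d : injective (@du _ _ _ tau i j d).
Proof. exact: bij_inj (du_bij tau i j d). Qed.

Lemma dinvK' i j d (a : A i j d) : dinv (du tau a) = a.
Proof. by apply: du_inj; rewrite dinvK. Qed.

Program Definition dual_inv : duality A := @Duality _ _ A dinv _ _ _ _.
Next Obligation. by move=> i j d c a b; apply: du_inj; rewrite du_lin !dinvK. Qed.
Next Obligation.
by move=> i j d; exists (@du _ _ _ tau j i d) => a; [apply: dinvK | apply: dinvK'].
Qed.
Next Obligation. by move=> i; apply: du_inj; rewrite dinvK du_one. Qed.
Next Obligation.
by move=> i j l d e f H H' a b; apply: du_inj; rewrite dinvK (du_mul tau H' H) !dinvK.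
Qed.

End InverseDuality.

Section DualPairing.
Variables (k : closedFieldType) (disp : Order.disp_t) (Lam : porderType disp).
Variables (I : Type) (A : galg k I) (T : gtbasis Lam A) (mu : Lam).
Notation p := (@gS_at_val _ _ _ _ _ T mu).
Notation idl := (ideal_not_ge T mu).
Notation cls a := (lpi (@idset _ _ _ idl _ _ _) a).

Lemma ideal_dual (tau : duality A) i j d (a : A i j d) : idset idl a -> idset idl (du tau a).
Proof.
elim=> {i j d a}.
- by move=> i h; rewrite du_one; apply: ideal_gen_one.
- move=> i j d; have := du_lin tau (-1) (0 : A i j d) 0.
  by rewrite scaler0 addr0 scaleN1r addNr => ->; apply: ideal_gen_zero.
- by move=> i j d c a b _ ha _ hb; rewrite du_lin; apply: ideal_gen_lin.
- move=> i j l d e f H a b _ hb; have H' : e + d = f by rewrite addrC.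
  by rewrite (du_mul tau H H'); apply: ideal_gen_mulr.
- move=> i j l d e f H a b _ hb; have H' : e + d = f by rewrite addrC.
  by rewrite (du_mul tau H H'); apply: ideal_gen_mull.
Qed.

Section AgeDual.
Variable tau : duality A.

Lemma du_linear i j d : lin (@du _ _ _ tau i j d).
Proof. by move=> c x y; apply: du_lin. Qed.

Definition qdu i j d (a : Age T mu i j d) : Age T mu j i d := cls (du tau (lrepr a)).

Lemma qduE i j d (a : A i j d) : qdu (cls a : Age T mu i j d) = cls (du tau a).
Proof.
apply/lpiP; rewrite -(linB (@du_linear i j d)); apply: ideal_dual; exact: lrepr_pi.
Qed.

End AgeDual.

Program Definition age_duality (tau : duality A) : duality (Age T mu) :=
  @Duality _ _ (Age T mu) (qdu tau) _ _ _ _.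
Next Obligation.
move=> tau i j d c a b; rewrite -{1}(lreprK a) -{1}(lreprK b) -lpiL qduE du_lin.
exact: lpiL.
Qed.
Next Obligation.
move=> tau i j d; exists (qdu (dual_inv tau) (i:=j) (j:=i) (d:=d)) => a.
  by rewrite -(lreprK a) !qduE /= dinvK'.
by rewrite -(lreprK a) !qduE /= dinvK.
Qed.
Next Obligation. by move=> tau i; rewrite [LHS]qduE du_one. Qed.
Next Obligation.
move=> tau i j l d e f H H' a b; rewrite -(lreprK a) -(lreprK b).
by rewrite age_mul !qduE age_mul (du_mul tau H H').
Qed.

(** The truncation of [L] to the components in S_mu is an irreducible quotient of [P], and
  a projective cover has only one: if one of the two kernels were not contained in the
  other, they would together span [P], so that the one belonging to [L] would be all of
  [P]. *)
Lemma head_truncation (P E : gmod (Aat T mu)) (L : gmod A) (f : mor (jlower P) L) :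
  projective_cover P E -> irr_elt E -> irr_elt L -> mor_surj f ->
  exists theta : forall s n, E s n -> L (p s) n,
    [/\ forall s n, lin (theta s n),
        forall s t c n m (H : c + n = m) (a : A (p s) (p t) c) (e : E t n),
          theta s m (mact E H (cls a : Aat T mu s t c) e) = mact L H a (theta t n e),
        forall s n e, theta s n e = 0 -> e = 0 &
        forall s n l, exists e, theta s n e = l].
Proof.
move=> [_ [pi [pis sup]]] irrE irrL fs.
pose u s n (z : P s n) : L (p s) n := mfun f (pten (add0r n) (cls (gone A (p s))) z).
have ul s n : lin (u s n).
  by move=> c x y; rewrite /u pten_lin_r (mfun_lin f).
have ua s t c n m (H : c + n = m) (a : A (p s) (p t) c) (z : P t n) :
    u s m (mact P H (cls a : Aat T mu s t c) z) = mact L H a (u t n z).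
  rewrite /u -mfun_act (pten_act _ _ _ _ _ (addr0 c) H) (age_mul T mu) gmul1r.
  by rewrite -(pten_bal (add0r c) H H (add0r m)) (age_mul T mu) gmul1l.
have us s n (l : L (p s) n) : exists z, u s n z = l.
  have [x <-] := fs _ _ l.
  pose U : subsp (jlower P (p s) n) := @Subsp k _ (fun x => exists z, u s n z = mfun f x)
    (ex_intro _ 0 (etrans (lin0 (ul s n)) (esym (mfun0 f (p s) n))))
    (fun c x y '(ex_intro z e) '(ex_intro z' e') => ex_intro _ (c *: z + z')
      (etrans (ul s n c z z') (etrans (f_equal2 (fun a b => c *: a + b) e e')
         (esym (mfun_lin f _ _ c x y))))).
  apply: (pten_ind (P := U)) => t m e H a z.
  exists (mact P H (a : Aat T mu s t m) z).
  rewrite -(lreprK a) ua /u -mfun_act (pten_act _ _ _ _ _ (addr0 m) H) (age_mul T mu).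
  by rewrite gmul1r.
have Ka i j d e g (H : d + e = g) (a : Aat T mu i j d) (v : P j e) :
    null_sp (ul j e) v -> null_sp (ul i g) (mact P H a v).
  by rewrite -(lreprK a) /= ua => ->; rewrite mact0r.
pose K : gsubmod P := @GSubmod _ _ _ P (fun s n => null_sp (ul s n)) Ka.
have Kproper : ~ sm_is_full K.
  move=> full; have [s [n [z]]] := jlower_quot_support fs irrL.1.
  by apply; apply: full.
have cov s n (z : P s n) : mfun pi z = 0 <-> u s n z = 0.
  split=> z0; apply: contrapT => nz; apply: Kproper; apply: sup => s' n' v.
    have [d [H [a e]]] := irrL.2 _ _ _ nz _ _ (u s' n' v).
    pose y := mact P H (cls a : Aat T mu s' s d) z.
    exists (v - y), y; split; last by rewrite subrK.
      by rewrite /= (linB (ul s' n')) /y ua e subrr.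
    by rewrite /y mfun_act z0 mact0r.
  have [d [H [a e]]] := irrE.2 _ _ _ nz _ _ (mfun pi v).
  pose y := mact P H a z.
  exists y, (v - y); split; last by rewrite addrC subrK.
    exact: (sm_act H a (z0 : smset K z)).
  by rewrite (linB (mfun_lin pi s' n')) /y mfun_act e subrr.
pose theta s n (e : E s n) := u s n (projT1 (cid (pis s n e))).
have thetaE s n z : theta s n (mfun pi z) = u s n z.
  rewrite /theta; case: cid => z' /= e; apply/eqP; rewrite -subr_eq0 -(linB (ul s n)).
  by apply/eqP/cov; rewrite (linB (mfun_lin pi s n)) e subrr.
exists theta; split.
- move=> s n c x y; have [z <-] := pis _ _ x; have [z' <-] := pis _ _ y.
  by rewrite -(mfun_lin pi) !thetaE ul.
- by move=> s t c n m H a e; have [z <-] := pis _ _ e; rewrite -mfun_act !thetaE ua.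
- by move=> s n e; have [z <-] := pis _ _ e; rewrite thetaE => /cov.
- by move=> s n l; have [z <-] := us s n l; exists (mfun pi z); rewrite thetaE.
Qed.

Section Contragredient.
Variable tau : duality A.
Let tauA := age_duality tau.

Definition at_graph (s t : gS_at T mu) d (a : Aat T mu s t d) (a' : Aat T mu t s d) : Prop :=
  a' = du tauA (a : Age T mu (p s) (p t) d).

Lemma truncated_pairing (E : gmod (Aat T mu)) (L : gmod A) (b : pairing (@graph _ _ _ tau) L L)
    (theta : forall s n, E s n -> L (p s) n) :
  (forall s n, lin (theta s n)) ->
  (forall s t c n m (H : c + n = m) (a : A (p s) (p t) c) (e : E t n),
     theta s m (mact E H (cls a : Aat T mu s t c) e) = mact L H a (theta t n e)) ->
  (forall s n e, theta s n e = 0 -> e = 0) ->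
  (forall s n l, exists e, theta s n e = l) ->
  inhabited (pairing at_graph E E).
Proof.
move=> tl ta ti ts.
split; apply: (@Pairing _ _ _ at_graph E E (fun s n m H e e' => pr b H (theta s n e) (theta s m e'))).
- by move=> s n m H e' c x y; rewrite tl (pr_lin_l b H).
- by move=> s n m H e c x y; rewrite tl (pr_lin_r b H).
- move=> s t c a a' -> n n1 m m1 H1 H2 H3 H4 v w; rewrite -(lreprK a) ta.
  have -> : du tauA (cls (lrepr a) : Age T mu (p s) (p t) c) = cls (du tau (lrepr a)) := qduE _ _.
  by rewrite ta; apply: pr_adj.
- move=> s n m H e h; apply: ti; apply: (pr_nondeg_l (p := b) (H := H)) => l.
  by have [e' <-] := ts s m l.
- move=> s n m H e h; apply: ti; apply: (pr_nondeg_r (p := b) (H := H)) => l.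
  by have [e' <-] := ts s n l.
Qed.

Variables (E : gmod (Aat T mu)) (bE : pairing at_graph E E).
Hypothesis fE : mod_locally_findim E.
Hypothesis fV : mod_locally_findim (jlower E).

Section OneForm.
Variables (i : I) (m' : int) (f : jstar E i m').

Definition coind_val (s : gS_at T mu) n m (H : n + m' = m) (x : Age T mu (p s) i n) : E s m :=
  hfun (f : ghom (gmod_trunc p (lreg (Age T mu) i)) E m') H
    (x : gmod_trunc p (lreg (Age T mu) i) s n).

Lemma coind_val_lin (s : gS_at T mu) n m (H : n + m' = m) : lin (fun x : Age T mu (p s) i n => coind_val H x).
Proof. by move=> c x y; apply: (hfun_lin (f : ghom (gmod_trunc p (lreg (Age T mu) i)) E m')). Qed.

Lemma coind_val_act (s t : gS_at T mu) c n m n' q (H1 : c + n = n') (H2 : n' + m' = q)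
    (H3 : n + m' = m) (H4 : c + m = q) (h : Aat T mu s t c) (x : Age T mu (p t) i n) :
  coind_val H2 (gmul (Age T mu) H1 h x) = mact E H4 h (coind_val H3 x).
Proof.
exact: (hfun_act (f : ghom (gmod_trunc p (lreg (Age T mu) i)) E m') H1 H2 H3 H4 h).
Qed.

Fact form_deg (d m n : int) : d + m' = 0 -> m + n = d -> n + (m + m') = 0.
Proof. by move=> H e; rewrite addrA [n + m]addrC e H. Qed.

(** The pairing of j_! E with j_* E is <a (x) v, f> = <v, f(tau a)>. *)
Lemma form_exists d (H : d + m' = 0) : exists G : jlower E i d -> k^o, lin G /\
  forall s m n (Hx : m + n = d) (a : Age T mu i (p s) m) (v : E s n),
    G (pten Hx a v) = pr bE (form_deg H Hx) v (coind_val erefl (du tauA a)).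
Proof.
have [|||G [Gl GE]] := @tens_lift _ _ _ p (Age T mu) E i d k^o
  (fun s m n Hx a v => pr bE (form_deg H Hx) v (coind_val erefl (du tauA a))); last by exists G.
- by move=> s m n Hx v c x y; rewrite du_lin coind_val_lin (pr_lin_r bE).
- by move=> s m n Hx a c x y; rewrite (pr_lin_l bE).
- move=> s t m c n mc cn H1 H2 H3 H4 a b v.
  have H1' : c + m = mc by rewrite addrC.
  have H5 : c + (m + m') = mc + m' by rewrite addrA H1'.
  rewrite (du_mul tauA H1 H1').
  rewrite (coind_val_act H1' erefl erefl H5 (du tauA b : Aat T mu t s c) (du tauA a)).
  exact: esym (pr_adj bE (erefl : at_graph b (du tauA b)) H3 _ H5 _ v _).
Qed.

Definition form d (H : d + m' = 0) : jlower E i d -> k^o := projT1 (cid (form_exists H)).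

Lemma form_lin d (H : d + m' = 0) : lin (form H).
Proof. by rewrite /form; case: cid => h []. Qed.

Lemma formE d (H : d + m' = 0) s m n (Hx : m + n = d) (a : Age T mu i (p s) m) (v : E s n) :
  form H (pten Hx a v) = pr bE (form_deg H Hx) v (coind_val erefl (du tauA a)).
Proof. by rewrite /form; case: cid => h [hl hE] /=; apply: hE. Qed.

End OneForm.

(** The map [f] attached to the form [phi] is determined by
  <v, f(x)> = phi (tau^(-1) x (x) v) for all [v]. *)
Lemma form_surj i d m' (H : d + m' = 0) (phi : jlower E i d -> k^o) : lin phi ->
  exists f : jstar E i m', forall z, form f H z = phi z.
Proof.
move=> phil; pose tinv := dual_inv tauA.
pose good (s : gS_at T mu) n q (x : Age T mu (p s) i n) (w : E s q) :=
  forall c (H1 : c + q = 0) (H2 : n + c = d) (v : E s c),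
    pr bE H1 v w = phi (pten H2 (du tinv x) v).
have gex (s : gS_at T mu) n q (Hq : n + m' = q) (x : Age T mu (p s) i n) : exists w, good s n q x w.
  have H1 : - q + q = 0 by rewrite addNr.
  have H2 : n + - q = d.
    by rewrite -Hq opprD addNKr; apply/eqP; rewrite eq_sym -addr_eq0 H.
  have [|||||w wP] := @represent k _ _ (@pr _ _ _ _ _ _ bE s (- q) q H1) _ _ _
    (fun v c => c = phi (pten H2 (du tinv x) v)) (fE s (- q)).
  - exact: pr_lin_l.
  - exact: pr_lin_r.
  - exact: pr_nondeg_l.
  - by move=> c v v' y y' -> ->; rewrite pten_lin_r phil.
  - by move=> y ->; rewrite (lin0 (pten_lin_r _ _)) (lin0 phil).
  exists w => c H1' H2' v.
  have e : c = - q by apply/eqP; rewrite -addr_eq0 H1'.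
  subst c; rewrite (Prop_irrelevance H1' H1) (Prop_irrelevance H2' H2); exact: wP.
have guniq (s : gS_at T mu) n q (Hq : n + m' = q) (x : Age T mu (p s) i n) w w' :
    good s n q x w -> good s n q x w' -> w = w'.
  move=> gw gw'; apply/eqP; rewrite -subr_eq0; apply/eqP.
  have H1 : - q + q = 0 by rewrite addNr.
  have H2 : n + - q = d.
    by rewrite -Hq opprD addNKr; apply/eqP; rewrite eq_sym -addr_eq0 H.
  apply: (pr_nondeg_r (p := bE) (H := H1)) => v.
  by rewrite (linB (pr_lin_r bE H1 v)) (gw _ H1 H2) (gw' _ H1 H2) subrr.
pose g (s : gS_at T mu) n q (Hq : n + m' = q)
  (x : gmod_trunc p (lreg (Age T mu) i) s n) : E s q := projT1 (cid (gex s n q Hq x)).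
have gP s n q Hq x : good s n q x (g s n q Hq x) by rewrite /g; case: cid.
have gl s n q (Hq : n + m' = q) c x x' :
    g s n q Hq (c *: x + x') = c *: g s n q Hq x + g s n q Hq x'.
  apply: guniq (gP _ _ _ _ _) _ => // e H1 H2 v.
  rewrite (pr_lin_r bE H1 v) (gP _ _ _ _ _ _ H1 H2) (gP _ _ _ _ _ _ H1 H2).
  by rewrite du_lin pten_lin_l phil.
have ga (s t : gS_at T mu) c n m n1 m1 (H1 : c + n = n1) (H2 : n1 + m' = m1) (H3 : n + m' = m)
    (H4 : c + m = m1) (a : Aat T mu s t c) x :
    g s n1 m1 H2 (mact (gmod_trunc p (lreg (Age T mu) i)) H1 a x) = mact E H4 a (g t n m H3 x).
  apply: guniq (gP _ _ _ _ _) _ => // e G1 G2 v.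
  have K1 : c + e + m = 0 by rewrite addrAC H4 addrC.
  have K2 : n + (c + e) = d by rewrite addrA [n + c]addrC H1.
  have K3 : n + c = n1 by rewrite addrC.
  have r : at_graph (du tinv (a : Age T mu (p s) (p t) c) : Aat T mu t s c) a.
    exact: esym (dinvK tauA _).
  rewrite -(pr_adj bE r erefl K1 H4 G1) (gP _ _ _ _ _ _ K1 K2).
  rewrite -(pten_bal K3 G2 erefl K2); congr (phi (pten _ _ _)).
  exact: esym (du_mul tinv H1 K3 (a : Age T mu (p s) (p t) c) x).
pose f : jstar E i m' := @GHom _ _ _ (gmod_trunc p (lreg (Age T mu) i)) E m' g gl ga.
exists f; apply: (pten_ind (P := equal_sp (form_lin f H) phil)) => s m n Hx a v.
suff : form f H (pten Hx a v) = phi (pten Hx a v) by [].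
rewrite formE; have -> : a = du tinv (du tauA a) by rewrite /= dinvK'.
by rewrite [in LHS]/= dinvK'; apply: gP.
Qed.

Theorem jlower_jstar_pairing : inhabited (pairing (@graph _ _ _ tau) (jlower E) (jstar E)).
Proof.
split; apply: (@Pairing _ _ _ _ (jlower E) (jstar E) (fun i d m' H z f => form f H z)).
- by move=> i d m' H f; apply: form_lin.
- move=> i d m' H z c f f'.
  have gl : lin (fun z => c *: form f H z + form f' H z).
    by move=> e x y; rewrite !form_lin !scalerDr !scalerA [c * e]mulrC addrACA.
  pose P := equal_sp (form_lin (c *: f + f') H) gl.
  apply: (pten_ind (P := P)) => s m n Hx a v.
  suff : form (c *: f + f') H (pten Hx a v) = c *: form f H (pten Hx a v) + form f' H (pten Hx a v) by [].
  by rewrite !formE -(pr_lin_r bE).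
- move=> i j c a a' -> n n1 m m1 H1 H2 H3 H4 z f.
  pose P := equal_sp (lin_comp (form_lin f H2) (mact_lin_r (jlower E) H1 a))
    (form_lin (mact (jstar E) H3 (du tau a) f) H4).
  apply: (pten_ind (P := P)) => s e q Hx x v.
  suff : form f H2 (mact (jlower E) H1 a (pten Hx x v)) =
    form (mact (jstar E) H3 (du tau a) f) H4 (pten Hx x v) by [].
  have K1 : c + e + q = n1 by rewrite -addrA Hx.
  have K2 : e + c = c + e by rewrite addrC.
  have K3 : c + e + m = e + m1 by rewrite -H3 addrA [e + c]addrC.
  rewrite (pten_act _ _ _ _ _ erefl K1) !formE (du_mul tauA erefl K2).
  have -> : coind_val (mact (jstar E) H3 (du tau a) f) erefl (du tauA x) =
    coind_val f K3 (gmul (Age T mu) K2 (du tauA x) (du tauA (cls a))).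
    have -> : du tauA (cls a : Age T mu i j c) = cls (du tau a) := qduE _ _.
    exact: (coind_actE H3 (cls (du tau a) : Age T mu j i c) (f : coind E i m) erefl
      (du tauA x) K2 K3).
  have gen y (G : _ + m = y) (G' : q + y = 0) (G0 : q + (c + e + m) = 0) x' :
      pr bE G0 v (coind_val f erefl x') = pr bE G' v (coind_val f G x').
    by case: y / G G' => G'; rewrite (Prop_irrelevance G0 G').
  exact: gen.
- move=> i n m H z h; apply: contrapT => nz.
  have [phi [phil pz]] := separating_form (fV i n) nz.
  by have [f fP] := form_surj H phil; apply: pz; rewrite -fP h.
- move=> i d m' H f h.
  apply: (@ghom_ext _ _ _ (gmod_trunc p (lreg (Age T mu) i)) E m') => s n q Hq x.
  have H1 : - q + q = 0 by rewrite addNr.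
  have H2 : n + - q = d.
    by rewrite -Hq opprD addNKr; apply/eqP; rewrite eq_sym -addr_eq0 H.
  apply: (pr_nondeg_r (p := bE) (H := H1)) => v.
  have := h (pten H2 (du (dual_inv tauA) (x : Age T mu (p s) i n)) v).
  rewrite formE [du tauA _]dinvK => <-.
  by case: q / Hq H1 H2 v => H1 H2 v; rewrite (Prop_irrelevance H1 (form_deg H H2)).
Qed.

End Contragredient.

End DualPairing.

(** * Injective hulls of irreducible modules *)

Theorem corollary8p9 (k : closedFieldType) (disp : Order.disp_t) (Lam : porderType disp)
    (I : Type) (A : galg k I)
    (A_fin : alg_locally_findim A) (A_bdd : alg_bounded_below A)
    (T : gtbasis Lam A)
    (B : Lam -> Type)
    (Ls : forall lam : Lam, B lam -> gmod (Aat T lam))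
    (Ls_full : forall lam : Lam, full_irreducibles (Ls lam))
    (Ps : forall lam : Lam, B lam -> gmod (Aat T lam))
    (Ps_cover : forall (lam : Lam) (b : B lam), projective_cover (Ps lam b) (Ls lam b))
    (L : forall lam : Lam, B lam -> gmod A)
    (L_irr : forall (lam : Lam) (b : B lam), irreducible (L lam b))
    (L_quot : forall (lam : Lam) (b : B lam),
       exists f : mor (jlower (Ps lam b)) (L lam b), mor_surj f)
    (J : forall lam : Lam, B lam -> gmod A)
    (J_hull : forall (lam : Lam) (b : B lam), injective_hull (J lam b) (L lam b))
    (lam : Lam) (b : B lam) :
  [/\ has_nabla_flag T (J lam b),
      forall (mu : Lam) (a : B mu), exists m : int -> nat,
        comp_mult (jlower (Ls mu a)) (L lam b) m /\
        nabla_mult (Ls mu a) (J lam b) (bar_series m) &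
      forall tau : duality A, giso (gdual tau (L lam b)) (L lam b) ->
        forall (mu : Lam) (a : B mu), giso (gdual tau (L mu a)) (L mu a) ->
        exists m : int -> nat,
          comp_mult (jstar (Ls mu a)) (L lam b) m /\
          nabla_mult (Ls mu a) (J lam b) m].
Proof.
have finJ : mod_locally_findim (J lam b) := hull_findim A_fin (L_irr lam b) (J_hull lam b).
have bndJ : mod_bounded_above (J lam b).
  have [iota [ii ie]] := hull_elt (J_hull lam b).
  exact: hull_bounded A_bdd (irreducible_elt (L_irr lam b)) ii ie.
have Lsirr mu a : irreducible (Ls mu a) by have [] := Ls_full mu.
have barfin mu a : mod_locally_findim (jlower (Ls mu a)) by apply: jlower_findim.
have irr mu a := irreducible_elt (L_irr mu a).
have mult mu a := comp_mult_hull A_fin (L_irr lam b) (J_hull lam b) (barfin mu a).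
split.
- have [iota [ii ie]] := hull_elt (J_hull lam b); have [f fs] := L_quot lam b.
  apply: (@nabla_flag _ _ _ _ _ _ (J lam b) lam).
  + exact: (J_hull lam b).1.
  + exact: finJ.
  + exact: bndJ.
  + apply: hull_vanish (irr lam b) ii ie _.
    by have [s [n [z nz]]] := jlower_quot_support fs (irr lam b).1; exists s, n; eexists; exact: nz.
- by move=> mu a; have [m [cm dm]] := mult mu a; exists m.
move=> tau db mu a da; have [m [cm dm]] := mult mu a; exists (bar_series m); split=> //.
have finL nu c : mod_locally_findim (L nu c) by apply: irr_locally_findim (irr nu c) A_fin.
have [bL] := self_dual_pairing (finL _ b) db; have [bLa] := self_dual_pairing (finL _ a) da.
have [f fs] := L_quot mu a.
have [theta [t1 t2 t3 t4]] := head_truncation (Ps_cover mu a) (irreducible_elt (Lsirr mu a)) (irr mu a) fs.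
have [bE] := truncated_pairing bLa t1 t2 t3 t4.
have finE : mod_locally_findim (Ls mu a).
  apply: (irr_locally_findim (irreducible_elt (Lsirr mu a))) => s t d.
  exact: Age_findim.
have [bV] := jlower_jstar_pairing bE finE (barfin mu a).
apply: (comp_mult_pairing bV bL _ _ (barfin mu a) (finL _ b) cm).
- exact: graph_l.
- exact: graph_r.
Qed.
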